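(* There are infinitely many planar cubic hypohamiltonian graphs of girth $5$. More specifically, there exists a planar cubic hypohamiltonian graph of girth $5$ of order $n$ for every $n = 74k + a$, where $k \ge 2$ is an integer and $a \in \{2,4\}$.
   Context: All graphs are finite, undirected, without loops or multiple edges. A graph is hamiltonian if it has a cycle through all its vertices; a graph $G$ is hypohamiltonian if $G$ is non-hamiltonian but $G - v$ is hamiltonian for every vertex $v$ of $G$. A graph is cubic if every vertex has degree $3$. The girth is the length of a shortest cycle. *)

(* Defs.v *)
From HB Require Import structures.
From mathcomp Require Import all_boot all_order all_algebra.
From mathcomp Require Import all_classical all_reals all_analysis.
From mathcomp Require Import Rstruct Rstruct_topology.
Set Implicit Arguments. Unset Strict Implicit. Unset Printing Implicit Defensive.
Import Order.TTheory GRing.Theory Num.Theory.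

Definition simple_graph (T : finType) (e : rel T) : Prop :=
  symmetric e /\ irreflexive e.

Definition cubic (T : finType) (e : rel T) : Prop :=
  forall x : T, #|[set y | e x y]| = 3.

Definition is_graph_cycle (T : finType) (e : rel T) (s : seq T) : Prop :=
  [/\ uniq s, 3 <= size s & cycle e s].

Definition hamiltonian_on (T : finType) (e : rel T) (A : {set T}) : Prop :=
  exists s : seq T, is_graph_cycle e s /\ (forall x, (x \in s) = (x \in A)).

Definition hamiltonian (T : finType) (e : rel T) : Prop :=
  hamiltonian_on e [set: T].

Definition hypohamiltonian (T : finType) (e : rel T) : Prop :=
  ~ hamiltonian e /\ forall v : T, hamiltonian_on e [set~ v].

Definition girth (T : finType) (e : rel T) (g : nat) : Prop :=
  (exists s, is_graph_cycle e s /\ size s = g) /\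
  (forall s, is_graph_cycle e s -> g <= size s).

Local Open Scope ring_scope.
Local Open Scope classical_set_scope.

Definition planar (T : finType) (e : rel T) : Prop :=
  exists (p : T -> (Rdefinitions.R * Rdefinitions.R)%type) (arc : T -> T -> Rdefinitions.R -> (Rdefinitions.R * Rdefinitions.R)%type),
    injective p /\
    (forall x y, e x y ->
       [/\ arc x y 0 = p x, arc x y 1 = p y,
           {within `[0, 1], continuous (arc x y)},
           (forall t s : Rdefinitions.R, 0 <= t <= 1 -> 0 <= s <= 1 ->
              arc x y t = arc x y s -> t = s)
         & (forall t : Rdefinitions.R, 0 <= t <= 1 -> arc y x t = arc x y (1 - t))]) /\
    (forall x y z (t : Rdefinitions.R), e x y -> 0 < t < 1 -> arc x y t <> p z) /\
    (forall x y u v (t s : Rdefinitions.R), e x y -> e u v -> 0 < t < 1 -> 0 < s < 1 ->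
       arc x y t = arc u v s -> (u = x /\ v = y) \/ (u = y /\ v = x)).

(* Main.v *)
From Stdlib Require Import NArith ZArith Reals Lra.
Require Import Defs.
From mathcomp Require Import all_boot zify ssrZ.
From mathcomp Require all_order all_algebra all_classical all_reals all_analysis.
From mathcomp Require Rstruct Rstruct_topology.
Set Implicit Arguments. Unset Strict Implicit. Unset Printing Implicit Defensive.
Delimit Scope R_scope with R.

(** The graphs are chains: a left piece with four outgoing half-edges 0, 1, 2, 3 on its outer face
(76 vertices when [a = 2], 152 vertices when [a = 4]), then copies of one 74-vertex piece, each glued
along four edges, and finally two closing edges joining the outputs 0-1 and 2-3.

A Hamiltonian cycle restricts on every prefix of the chain to a system of paths covering it, and a
transfer computation over the pieces shows that the ends of these paths can only be paired as
{02}, {03}, {12}, {13} or {01, 23}; none of these closes up to a single cycle. Conversely every prefix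
has covers of type {03}, {12} and {01, 23}, and after deleting any vertex a cover by one path of type
{01} or {23}, which the closing edge turns into a Hamiltonian cycle of the vertex-deleted graph.

A prefix is drawn in a square with its outputs at the corners; an affine map carries this square to a
parallelogram inside a face of the drawing of the next piece. *)

(** * Frontier dynamic programming for Hamiltonian cycles *)

(** The same prefix lies in infinitely many closed graphs, so what is proved about it must not
    depend on what follows. The non-hamiltonian side therefore speaks of an arbitrary symmetric
    relation [F], connected and 2-regular, on an arbitrary host into which the prefix is embedded by
    [h], the outer ends of its half-edges being arbitrary. As the set of five pairings is stable
    under gluing [piece74], one finite run settles every length of chain. No path is recorded as a
    list: a vertex set that [F] leaves only through the two end edges is enough, because a nonempty
    set that [F] never leaves is the whole host. The other side is existential: each cover of a
    longer prefix is assembled from one cover of the shorter prefix and a route through the new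
    piece, and the routes are given as bit strings, to be checked and not searched for. Girth 5
    requires that the two vertices joined by a closing edge be far apart in the prefix. This depends
    on the last piece only; [piece74] and [piece152] ensure it, while [piece76] does not and is
    always followed by a copy of [piece74]. *)

(* The used edges leaving the processed vertices, paired when they end the same path. *)
Definition state := seq (N * N).
Definition flat (st : state) : seq N := flatten [seq [:: p.1; p.2] | p <- st].

(** Pairs and states are kept ordered so that equal pairings have equal representations and can be
    merged during the run. *)
Definition mkpair (a b : N) : N * N := if N.leb a b then (a, b) else (b, a).

Fixpoint insert (p : N * N) (st : state) : state :=
  if st is q :: st' then
    if N.leb p.1 q.1 then p :: st else q :: insert p st'
  else [:: p].

Fixpoint extract (e : N) (st : state) : option (N * state) :=
  if st is p :: st' then
    if N.eqb e p.1 then Some (p.2, st')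
    else if N.eqb e p.2 then Some (p.1, st')
    else if extract e st' is Some (m, r) then Some (m, p :: r) else None
  else None.

(** A vertex has exactly two used edges, so the number of used edges from processed vertices fixes
    the number of used outgoing ones: a path starts, goes on, or two ends meet. If the two ends
    belong to one path, the cycle closes, which is acceptable only at the last vertex and with no
    other path open. *)
Definition step (last : bool) (ins : seq N * seq N) (st : state) : seq state :=
  match [seq e <- ins.1 | extract e st] with
  | [::] =>
    match ins.2 with
    | [:: a; b] => [:: insert (mkpair a b) st]
    | [:: a; b; c] => [:: insert (mkpair a b) st; insert (mkpair a c) st;
                          insert (mkpair b c) st]
    | _ => [::]
    end
  | [:: e] =>
    if extract e st is Some (m, r) then [seq insert (mkpair g m) r | g <- ins.2]
    else [::]
  | [:: e; f] =>
    if extract e st is Some (m, r) then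
      if N.eqb m f then if last && nilp r then [:: [::]] else [::]
      else if extract f r is Some (m', r') then [:: insert (mkpair m m') r']
      else [::]
    else [::]
  | _ => [::]
  end.

Lemma mem_insert p q st : (q \in insert p st) = (q == p) || (q \in st).
Proof.
elim: st => [|r st IH] //=; case: ifP => _; rewrite !inE // IH.
by rewrite orbCA.
Qed.

Lemma perm_flat_insert a b st : perm_eq (flat (insert (mkpair a b) st)) [:: a, b & flat st].
Proof.
elim: st => [|r st IH] /=.
  by rewrite /mkpair; case: ifP => _ //=; rewrite /flat /= (perm_catC [:: b] [:: a]).
case: ifP => _.
  rewrite {1}/mkpair; case: ifP => _ //=.
  by rewrite /flat /= (perm_catCA [:: b] [:: a]).
rewrite /flat /= -!/(flat _).
have := IH; rewrite -(perm_cat2l [:: r.1; r.2]) => /perm_trans -> //=.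
by rewrite (perm_catCA [:: r.1; r.2] [:: a; b]).
Qed.

Lemma extractP e st :
  if extract e st is Some (m, r) then
    [/\ perm_eq (flat st) [:: e, m & flat r], {subset r <= st}
      & (e, m) \in st \/ (m, e) \in st]
  else e \notin flat st.
Proof.
elim: st => [|p st IH] //=.
case: N.eqb_spec => [->|ne1].
  split=> //.
  - by move=> x; rewrite inE orbC => ->.
  - by left; rewrite inE -surjective_pairing eqxx.
case: N.eqb_spec => [->|ne2].
  split=> //; first by rewrite /flat /= (perm_catCA [:: p.1] [:: p.2]).
  - by move=> x; rewrite inE orbC => ->.
  - by right; rewrite inE -surjective_pairing eqxx.
case: extract IH => [[m r] [pst sub em]|nin].
  split.
  - rewrite /flat /= -!/(flat _).
    have := pst; rewrite -(perm_cat2l [:: p.1; p.2]) => /perm_trans -> //=.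
    by rewrite (perm_catCA [:: p.1; p.2] [:: e; m]).
  - by move=> x; rewrite !inE => /predU1P[->|/sub ->]; rewrite ?eqxx ?orbT.
  - by case: em => em; [left|right]; rewrite inE em orbT.
by rewrite /flat /= !inE -/(flat _) !negb_or nin andbT; apply/andP; split; apply/eqP.
Qed.

Lemma extract_mem e st : isSome (extract e st) = (e \in flat st).
Proof.
have := extractP e st; case: (extract e st) => [[m r] [/perm_mem -> _ _]|/negbTE -> //].
by rewrite inE eqxx.
Qed.

Lemma mem_flat p st : p \in st -> (p.1 \in flat st) && (p.2 \in flat st).
Proof.
move=> pst; rewrite /flat; apply/andP; split; apply/flattenP;
by exists [:: p.1; p.2]; rewrite ?map_f // !inE eqxx ?orbT.
Qed.

(** * Soundness of one transfer step for a fixed Hamiltonian cycle *)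

Section Soundness.
Variables (T : finType) (F : rel T).
Hypothesis Fsym : symmetric F.
(** Degree 2 is stated for any duplicate-free list containing the [F]-neighbours, since only local
    neighbour lists are at hand later. *)
Hypothesis Fdeg : forall x l, uniq l -> (forall y, F x y -> y \in l) -> count (F x) l = 2.
Hypothesis Fconn : forall W : {set T}, W != set0 ->
  (forall x y, x \in W -> F x y -> y \in W) -> W = setT.
Variables (src tgt : N -> T).
Let used e := F (src e) (tgt e).

(** [W] is the vertex set of the path with end edges [p.1] and [p.2]; only its boundary is recorded.
    The third clause describes the boundary by end points, the fourth by edge labels. *)
Definition linked (X : {set T}) (fr : seq N) (p : N * N) :=
  exists W : {set T},
    [/\ W \subset X,
        (src p.1 \in W) && (src p.2 \in W),
        forall x y, x \in W -> y \notin W -> F x y ->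
          exists2 e, e \in [:: p.1; p.2] & (x, y) = (src e, tgt e)
      & forall e, e \in fr -> used e -> src e \in W -> e \in [:: p.1; p.2]].

Definition inv (X : {set T}) (fr : seq N) (st : state) :=
  [/\ uniq (flat st), (forall e, (e \in flat st) = (e \in fr) && used e)
    & forall p, p \in st -> linked X fr p].

Lemma linkedC X fr a b : linked X fr (a, b) -> linked X fr (b, a).
Proof.
case=> W [sub /andP[aW bW] bd ot]; exists W; split=> //=.
- by rewrite bW aW.
- by move=> x y xW yW /(bd _ _ xW yW)[e eab ->]; exists e => //; move: eab; rewrite !inE orbC.
- by move=> e ef ue eW; have := ot e ef ue eW; rewrite !inE orbC.
Qed.

Lemma linked_mk X fr a b : linked X fr (a, b) -> linked X fr (mkpair a b).
Proof. by rewrite /mkpair; case: ifP => // _; apply: linkedC. Qed.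

Section Step.
Variables (X : {set T}) (fr : seq N) (v : T) (o n : seq N).
Hypothesis vX : v \notin X.
Hypothesis fr_uniq : uniq fr.
Hypothesis src_fr : forall e, e \in fr -> src e \in X.
Hypothesis o_uniq : uniq o.
Hypothesis o_fr : {subset o <= fr}.
Hypothesis o_tgt : forall e, e \in o -> tgt e = v.
Hypothesis n_uniq : uniq n.
Hypothesis n_fr : forall e, e \in n -> e \notin fr.
Hypothesis n_src : forall e, e \in n -> src e = v.
Hypothesis nb_uniq : uniq ([seq src e | e <- o] ++ [seq tgt e | e <- n]).
Hypothesis nbP : forall y, F v y -> y \in [seq src e | e <- o] ++ [seq tgt e | e <- n].

Definition frontier_step := [seq e <- fr | e \notin o] ++ n.
Let fr' := frontier_step.

Lemma count_used : count used o + count used n = 2.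
Proof.
rewrite -(Fdeg nb_uniq nbP) count_cat !count_map; congr (_ + _).
  by apply: eq_in_count => e eo /=; rewrite /used o_tgt // Fsym.
by apply: eq_in_count => e en /=; rewrite /used n_src.
Qed.

Lemma mem_fr' e : (e \in fr') = (e \notin o) && (e \in fr) || (e \in n).
Proof. by rewrite mem_cat mem_filter. Qed.

Lemma vF y : F v y -> (exists2 e, e \in o & used e /\ y = src e) \/
  (exists2 e, e \in n & used e /\ y = tgt e).
Proof.
move=> vy; have := nbP vy; rewrite mem_cat => /orP[] /mapP[e ei ye]; [left|right]; exists e => //.
  by split=> //; rewrite /used o_tgt // Fsym -ye.
by split=> //; rewrite /used n_src // -ye.
Qed.

Lemma linked_keep p : linked X fr p -> linked (v |: X) fr' p.
Proof.
case=> W [sub pW bd ot]; exists W; split=> //.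
  exact: subset_trans sub (subsetUr _ _).
move=> e; rewrite mem_fr' => /orP[/andP[_ ef]|en]; first exact: ot.
by move=> _ eW; case/negP: vX; rewrite -(n_src en) (subsetP sub).
Qed.

Lemma linked_new g h : g \in n -> h \in n ->
  (forall e, e \in o -> ~~ used e) ->
  (forall e, e \in n -> used e -> e \in [:: g; h]) -> linked (v |: X) fr' (g, h).
Proof.
move=> gn hn o0 ngh; exists [set v]; split=> /=.
- by rewrite sub1set setU11.
- by rewrite !inE !n_src // eqxx.
- move=> x y /set1P-> _ /vF[] [e ei [ue ->]]; first by case/negP: (o0 e ei).
  by exists e; [exact: ngh | rewrite n_src].
move=> e; rewrite mem_fr' => /orP[/andP[_ ef] _ /set1P ev|en ue _]; last exact: ngh.
by case/negP: vX; rewrite -ev src_fr.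
Qed.

(** The set grows by [v]: the end [e] becomes interior and [g] takes its place. *)
Lemma linked_extend e m g : linked X fr (e, m) -> e \in o -> g \in n -> used e ->
  (forall f, f \in o -> used f -> f = e) ->
  (forall f, f \in n -> used f -> f = g) -> linked (v |: X) fr' (g, m).
Proof.
case=> W [sub /andP[/= eW mW] bd ot] eo gn ue oe ng; exists (v |: W); split=> /=.
- by rewrite setUS.
- by rewrite (n_src gn) setU11 in_setU mW orbT.
- move=> x y /setU1P[->|xW]; rewrite in_setU1 negb_or => /andP[yv yW].
    case/vF => [] [f fi [uf yf]]; last first.
      by exists g; rewrite ?inE ?eqxx // yf (ng f fi uf) (n_src gn).
    by move: yW; rewrite yf (oe f) // eW.
  move=> /(bd x y xW yW)[f]; rewrite !inE => /orP[]/eqP-> [-> yf].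
    by rewrite yf o_tgt ?eqxx in yv.
  by exists m; rewrite ?inE ?eqxx ?orbT // yf.
move=> f; rewrite mem_fr' => /orP[/andP[fo ff] uf|fn uf _]; last by rewrite (ng f) // inE eqxx.
case/setU1P => [fv|fW]; first by case/negP: vX; rewrite -fv src_fr.
have := ot f ff uf fW; rewrite !inE => /orP[/eqP fe|->]; last by rewrite orbT.
by rewrite fe eo in fo.
Qed.

(** The union of both sets with [v]: the ends [e] and [f] become interior, [m] and [m'] remain. *)
Lemma linked_join e m f m' : linked X fr (e, m) -> linked X fr (f, m') ->
  e \in o -> f \in o -> used e -> used f ->
  (forall g, g \in o -> used g -> g \in [:: e; f]) ->
  (forall g, g \in n -> ~~ used g) -> linked (v |: X) fr' (m, m').
Proof.
case=> W [sub /andP[/= eW mW] bd ot] [W' [sub' /andP[/= fW' mW'] bd' ot']] eo fo ue uf oef n0.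
exists (v |: (W :|: W')); split=> /=.
- by rewrite setUS // subUset sub.
- by rewrite !in_setU mW mW' !orbT.
- move=> x y xW; rewrite !in_setU in_set1 !negb_or => /and3P[yv yW yW'].
  case/setU1P: xW => [->|/setUP[xW|xW']].
  + case/vF => [] [g gi [ug yg]]; last by case/negP: (n0 g gi).
    have := oef g gi ug; rewrite !inE => /orP[]/eqP gE.
      by rewrite yg gE eW in yW.
    by rewrite yg gE fW' in yW'.
  + case/(bd x y xW yW) => g; rewrite !inE => /orP[]/eqP-> [-> yg].
      by rewrite yg o_tgt ?eqxx in yv.
    by exists m; rewrite ?inE ?eqxx // yg.
  + case/(bd' x y xW' yW') => g; rewrite !inE => /orP[]/eqP-> [-> yg].
      by rewrite yg o_tgt ?eqxx in yv.
    by exists m'; rewrite ?inE ?eqxx ?orbT // yg.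
move=> g; rewrite mem_fr' => /orP[/andP[go gf] ug|gn ug]; last by case/negP: (n0 g gn).
case/setU1P => [gv|/setUP[gW|gW']]; first by case/negP: vX; rewrite -gv src_fr.
  have := ot g gf ug gW; rewrite !inE => /orP[/eqP ge|->] //.
  by rewrite ge eo in go.
have := ot' g gf ug gW'; rewrite !inE => /orP[/eqP ge|->]; last by rewrite orbT.
by rewrite ge fo in go.
Qed.

(** When both ends of one path meet at [v], no [F]-edge leaves the set together with [v], so by
    [Fconn] it is the whole host: a cycle cannot close before all vertices are visited. *)
Lemma linked_closed e f : linked X fr (e, f) -> e \in o -> f \in o ->
  (forall g, g \in o -> used g -> g \in [:: e; f]) ->
  (forall g, g \in n -> ~~ used g) ->
  exists W : {set T}, [/\ W \subset X, v |: W = setT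
    & forall g, g \in fr -> used g -> src g \in W -> g \in [:: e; f]].
Proof.
case=> W [sub /andP[/= eW fW] bd ot] eo fo oef n0.
exists W; split=> //; apply: Fconn; first by apply/set0Pn; exists v; rewrite setU11.
move=> x y /setU1P[->|xW] xy.
  case/vF: xy => [] [g gi [ug ->]]; last by case/negP: (n0 g gi).
  by have := oef g gi ug; rewrite !inE => /orP[]/eqP->; rewrite ?eW ?fW orbT.
case yW: (y \in v |: W) => //; move: yW; rewrite in_setU1 => /norP[yv yW].
case: (bd x y xW yW xy) => g; rewrite !inE => /orP[]/eqP-> [_ yg];
by rewrite yg o_tgt ?eqxx in yv.
Qed.

Hypothesis size_on : size o + size n <= 3.

Lemma filter_used l : {subset l <= fr} -> forall st, inv X fr st ->
  [seq e <- l | extract e st] = [seq e <- l | used e].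
Proof.
move=> lfr st [_ mst _]; apply: eq_in_filter => e el.
by rewrite -[LHS]/(isSome (extract e st)) extract_mem mst lfr.
Qed.

(** The proof splits on the used incoming edges [U]; the list [V] of used outgoing ones then has
    [2 - size U] members. The flag [last] may be false only while the host is not yet exhausted,
    which is what excludes a closed cycle. *)
Lemma step_sound last st : inv X fr st -> (last || (v |: X != setT)) ->
  exists2 st', st' \in step last (o, n) st & inv (v |: X) fr' st'.
Proof.
move=> ist lastP; have [ust mst lst] := ist.
rewrite /step /= (filter_used o_fr ist).
have cu := count_used; have szU := size_filter used o; have szV := size_filter used n.
have memU e : e \in o -> used e -> e \in [seq e <- o | used e] by move=> eo ue; rewrite mem_filter ue.
have memV e : e \in n -> used e -> e \in [seq e <- n | used e] by move=> en ue; rewrite mem_filter ue.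
have subU e : e \in [seq e <- o | used e] -> (e \in o) && used e by rewrite mem_filter andbC.
have subV e : e \in [seq e <- n | used e] -> (e \in n) && used e by rewrite mem_filter andbC.
have uU : uniq [seq e <- o | used e] by rewrite filter_uniq.
have uV : uniq [seq e <- n | used e] by rewrite filter_uniq.
move: memU memV subU subV uU uV szU szV.
set U := [seq e <- o | used e]; set V := [seq e <- n | used e].
move=> memU memV subU subV uU uV szU szV.
have nst e : e \in n -> e \notin flat st by move=> en; rewrite mst (negbTE (n_fr en)).
have nEF e : e \in n -> e \notin o by move=> en; apply: contra (n_fr en) => /o_fr.
(* Common end of all branches with a new pair: every other pair comes from the old state and
   persists by [linked_keep]. *)
have inew st' p s : perm_eq (flat st') s -> uniq s ->
    (forall e, (e \in s) = (e \in fr') && used e) ->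
    (forall q, q \in st' -> q = p \/ q \in st) -> linked (v |: X) fr' p ->
    inv (v |: X) fr' st'.
  move=> pst us ms stp lp; split; first by rewrite (perm_uniq pst).
    by move=> e; rewrite (perm_mem pst).
  by move=> q /stp[->|/lst/linked_keep].
have new2 g h : V =i [:: g; h] -> U = [::] -> g != h -> g \in n -> h \in n ->
    inv (v |: X) fr' (insert (mkpair g h) st).
  move=> VE U0 gh gn hn.
  have o0 e : e \in o -> ~~ used e by move=> eo; apply/negP => /(memU e eo); rewrite U0.
  apply: (inew _ (mkpair g h) _ (perm_flat_insert g h st)).
  - by rewrite /= inE negb_or gh !nst.
  - move=> e; rewrite !inE orbA -[_ || (e == h)]/(_ || _) mem_fr'.
    have -> : (e == g) || (e == h) = (e \in n) && used e.
      by have := VE e; rewrite !inE mem_filter andbC => ->.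
    rewrite mst; case: (boolP (e \in o)) => [eo|eo] /=.
      by rewrite (negbTE (o0 e eo)) !andbF.
    by rewrite andb_orl orbC.
  - by move=> q; rewrite mem_insert => /orP[/eqP|]; [left|right].
  - apply: linked_mk; apply: linked_new => // e en ue.
    by have := memV e en ue; rewrite VE.
case EU: U => [|e [|f [|? ?]]].
- have V2 : size V = 2 by rewrite szV -cu -szU EU.
  case En: n => [|a [|b [|c [|? ?]]]].
  + by move: V2; rewrite /V En.
  + by move: V2; rewrite /V En /=; case: (used a).
  + have VE : V = [:: a; b].
      by move: V2; rewrite /V En /=; case: (used a); case: (used b).
    exists (insert (mkpair a b) st); first by rewrite inE.
    move: n_uniq; rewrite En /= inE andbT => ab.
    by apply: new2; rewrite ?VE // En !inE eqxx ?orbT.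
  + move: n_uniq; rewrite En /= !inE !andbT => /andP[/norP[ab ac] bc].
    have := V2; rewrite {1}/V En /=; case ua: (used a); case ub: (used b); case uc: (used c) => // _.
    * exists (insert (mkpair a b) st); first by rewrite inE eqxx.
      by apply: new2; rewrite // ?En ?inE ?eqxx ?orbT // /V En /= ua ub uc.
    * exists (insert (mkpair a c) st); first by rewrite !inE eqxx orbT.
      by apply: new2; rewrite // ?En ?inE ?eqxx ?orbT // /V En /= ua ub uc.
    * exists (insert (mkpair b c) st); first by rewrite !inE eqxx !orbT.
      by apply: new2; rewrite // ?En ?inE ?eqxx ?orbT // /V En /= ua ub uc.
  + by move: size_on; rewrite En /= !addnS.
- have /andP[eo ue] : (e \in o) && used e by apply: subU; rewrite EU inE.
  have [g VE] : exists g, V = [:: g].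
    have : size V = 1 by apply/eqP; rewrite szV -(eqn_add2l 1) -[X in X + _ == _]/(size [:: e]) -EU szU cu.
    by case EV: V => [|g [|? ?]] // _; exists g.
  have /andP[gn ug] : (g \in n) && used g by apply: subV; rewrite VE inE.
  have est : e \in flat st by rewrite mst o_fr.
  have := extractP e st; case: (extract e st) => [[m r] [pst sub em]|]; last by rewrite est.
  exists (insert (mkpair g m) r); first by apply/mapP; exists g.
  have ur : uniq [:: e, m & flat r] by rewrite -(perm_uniq pst).
  have mE x : (x \in m :: flat r) = (x != e) && (x \in flat st).
    rewrite (perm_mem pst) [in RHS]inE; case: eqVneq => [->|] //=.
    by move: ur => /= /andP[/negbTE].
  have oe x : x \in o -> used x -> x = e.
    by move=> xo ux; have := memU x xo ux; rewrite EU inE => /eqP.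
  have ng x : x \in n -> used x -> x = g.
    by move=> xn ux; have := memV x xn ux; rewrite VE inE => /eqP.
  apply: (inew _ (mkpair g m) _ (perm_flat_insert g m r)).
  + rewrite cons_uniq mE negb_and nst // orbT.
    by move: ur; rewrite cons_uniq => /andP[].
  + move=> x; rewrite inE mE mst mem_fr'.
    case: (eqVneq x g) => [->|xg] /=; first by rewrite gn ug orbT.
    case xn: (x \in n); first by case ux: (used x); [rewrite (ng x) // eqxx in xg | rewrite !andbF].
    rewrite orbF; case ux: (used x); rewrite ?andbF // !andbT; congr (_ && _).
    apply/idP/idP; apply: contraNN; first by move=> xo; rewrite (oe x xo ux).
    by move=> /eqP->.
  + by move=> q; rewrite mem_insert => /orP[/eqP|/sub]; [left|right].
  apply: linked_mk; apply: (linked_extend _ eo) => //.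
  by case: em => /lst // /linkedC.
- have /andP[eo ue] : (e \in o) && used e by apply: subU; rewrite EU !inE eqxx.
  have /andP[fo uf] : (f \in o) && used f by apply: subU; rewrite EU !inE eqxx orbT.
  have ef : e != f by move: uU; rewrite EU /= inE andbT.
  have V0 : V = [::].
    by apply/eqP; rewrite -size_eq0 szV -(eqn_add2l 2) -[X in X + _ == _]/(size [:: e; f]) -EU szU cu.
  have n0 x : x \in n -> ~~ used x by move=> xn; apply/negP => /(memV x xn); rewrite V0.
  have oef x : x \in o -> used x -> x \in [:: e; f] by move=> xo ux; rewrite -EU memU.
  have est : e \in flat st by rewrite mst o_fr.
  have fst : f \in flat st by rewrite mst o_fr.
  have := extractP e st; case: (extract e st) => [[m r] [pst sub em]|]; last by rewrite est.
  have ur : uniq [:: e, m & flat r] by rewrite -(perm_uniq pst).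
  have lem : linked X fr (e, m) by case: em => /lst // /linkedC.
  case: N.eqb_spec => [mf|mf].
    move: lem; rewrite mf => lef.
    have [W [sW WT ot]] := linked_closed lef eo fo oef n0.
    (* [W] together with [v] is the host, so with a false flag [lastP] is contradicted. *)
    case: last lastP => /= [_|/negP[]]; last first.
      by rewrite eqEsubset subsetT -WT setUS.
    have xW x : x \in fr -> used x -> x \in [:: e; f].
      move=> xf ux; apply: ot => //; have : src x \in v |: W by rewrite WT inE.
      by case/setU1P => // xv; case/negP: vX; rewrite -xv src_fr.
    (* [e] and [f] are the only used frontier edges, so no other path is open and the new state is
       empty. *)
    have flr x : x \in flat r -> False.
      move=> xr; have : x \in flat st by rewrite (perm_mem pst) !inE xr !orbT.
      rewrite mst => /andP[xf ux]; have := xW x xf ux; rewrite !inE.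
      by case/orP => /eqP xE; move: ur; rewrite mf -xE /= ?inE xr ?orbT ?andbF.
    case: r {pst sub em ur} flr => [|p r] flr; last by case: (flr p.1); rewrite inE eqxx.
    exists [::]; first by rewrite inE.
    split=> // x; rewrite mem_fr'; apply/esym/negbTE/negP.
    case/andP => /orP[/andP[xo xf]|xn] ux; last by case/negP: (n0 x xn).
    have := xW x xf ux; rewrite !inE => /orP[]/eqP xE; by rewrite xE ?eo ?fo in xo.
  have fr0 : f \in flat r.
    move: fst; rewrite (perm_mem pst) !inE => /or3P[/eqP fe|/eqP fm|//].
      by rewrite fe eqxx in ef.
    by case: mf.
  have := extractP f r; case: (extract f r) => [[m' r'] [pr sub' fm]|]; last by rewrite fr0.
  exists (insert (mkpair m m') r'); first by rewrite inE.
  have pst' : perm_eq (flat st) [:: e, f, m, m' & flat r'].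
    apply: (perm_trans pst); rewrite perm_cons perm_sym (perm_catCA [:: f] [:: m]) /=.
    by rewrite perm_cons perm_sym.
  have ur' : uniq [:: e, f, m, m' & flat r'] by rewrite -(perm_uniq pst').
  have mE x : (x \in [:: m, m' & flat r']) = (x != e) && (x != f) && (x \in flat st).
    rewrite (perm_mem pst') [in RHS]inE [in RHS]inE; move: ur' => /= /and3P[].
    rewrite inE negb_or => /andP[_ /negbTE e1] /negbTE f1 _.
    by case: eqVneq => [->|_] //=; case: eqVneq => [->|_].
  apply: (inew _ (mkpair m m') _ (perm_flat_insert m m' r')).
  + by move: ur'; rewrite !cons_uniq => /and3P[_ _].
  + move=> x; rewrite mE mst mem_fr'.
    case xn: (x \in n); first by rewrite (negbTE (n0 x xn)) !andbF.
    rewrite orbF; case ux: (used x); rewrite ?andbF // !andbT; congr (_ && _).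
    apply/idP/idP; first by move=> /andP[xe xf]; apply/negP => xo; have := oef x xo ux; rewrite !inE (negbTE xe) (negbTE xf).
    by move=> xo; apply/andP; split; apply: contraNneq xo => ->.
  + by move=> q; rewrite mem_insert => /orP[/eqP|/sub'/sub]; [left|right].
  apply: linked_mk; apply: (linked_join lem _ eo fo) => //.
  by case: fm => /sub/lst // /linkedC.
- by have := leq_addr (count used n) (count used o); rewrite cu -szU EU.
Qed.

End Step.
End Soundness.

(** * Encoding of a piece and execution of the transfer *)

Record piece := Piece { adj : seq (seq nat); lft : seq nat; rgt : seq nat }.
Definition psize (D : piece) := size (adj D).

(* Code [k < 4] is the left half-edge [k], [4 + u] the vertex [u], [n + 4 + k] the right half-edge [k]. *)
Definition codes (D : piece) (u : nat) : seq nat :=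
  [seq k <- iota 0 (size (lft D)) | nth 0 (lft D) k == u] ++
  [seq 4 + w | w <- nth [::] (adj D) u] ++
  [seq psize D + 4 + k | k <- iota 0 4 & nth 0 (rgt D) k == u].

(** Base 256 has room for all codes, since [piece_ok] bounds [n + 8] by 256. *)
Definition eid (a b : nat) : N := (N.of_nat a * 256 + N.of_nat b)%num.

(** Vertices are processed by increasing code, so a neighbour with smaller code is already done.
    Left half-edges have the smallest codes and form the initial frontier; right ones have the
    largest and form the final frontier. *)
Definition darts (D : piece) (u : nat) : seq N * seq N :=
  ([seq eid c (4 + u) | c <- codes D u & c < 4 + u],
   [seq eid (4 + u) c | c <- codes D u & 4 + u < c]).

Definition program (D : piece) := [seq darts D u | u <- iota 0 (psize D)].

(** Serves to bring equal states next to each other before [dedup]; soundness uses only that sorting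
    and merging keep the members. *)
Fixpoint leS (s t : state) : bool :=
  match s, t with
  | [::], _ => true
  | _, [::] => false
  | p :: s', q :: t' =>
    match N.compare p.1 q.1 with
    | Lt => true
    | Gt => false
    | Eq => match N.compare p.2 q.2 with Lt => true | Gt => false | Eq => leS s' t' end
    end
  end.

Fixpoint eqS (s t : state) : bool :=
  match s, t with
  | [::], [::] => true
  | p :: s', q :: t' => if N.eqb p.1 q.1 then if N.eqb p.2 q.2 then eqS s' t' else false else false
  | _, _ => false
  end.

Fixpoint dedup (L : seq state) : seq state :=
  if L is s :: L' then
    if L' is t :: _ then if eqS s t then dedup L' else s :: dedup L' else L
  else [::].

(** The last vertex of a piece may be the last vertex of the host, so closing is allowed there; the
    empty state that could result is ruled out by the final check [closed_from]. *)
Fixpoint run (pr : seq (seq N * seq N)) (L : seq state) : seq state :=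
  if pr is d :: pr' then
    run pr' (dedup (sort leS (flatten [seq step (nilp pr') d st | st <- L])))
  else L.

Definition lid D k := eid k (4 + nth 0 (lft D) k).
Definition rid D k := eid (4 + nth 0 (rgt D) k) (psize D + 4 + k).
Definition rids D := [seq rid D k | k <- iota 0 4].
Definition normalize (st : state) : state := foldr (fun p s => insert (mkpair p.1 p.2) s) [::] st.
Definition tolabel D (st : state) : state :=
  normalize [seq (N.of_nat (index p.1 (rids D)), N.of_nat (index p.2 (rids D))) | p <- st].
Definition fromlabel D (st : state) : state :=
  [seq (lid D (N.to_nat p.1), lid D (N.to_nat p.2)) | p <- st].

Definition full_states : seq state :=
  [:: [:: (0, 2)]; [:: (0, 3)]; [:: (1, 2)]; [:: (1, 3)]; [:: (0, 1); (2, 3)]]%num.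

(** The empty state is not in [full_states], so this also excludes a cycle that closes inside the
    prefix. *)
Definition closed_from D (L : seq state) :=
  all (fun st => has (eqS (tolabel D st)) full_states) (run (program D) [seq fromlabel D st | st <- L]).

Lemma eqSP s t : eqS s t -> s = t.
Proof.
elim: s t => [|[a b] s IH] [|[c d] t] //=.
by case: N.eqb_spec => // ->; case: N.eqb_spec => // -> /IH ->.
Qed.

Lemma mem_dedup L s : (s \in dedup L) = (s \in L).
Proof.
elim: L => [|x [|y L] IH] //.
rewrite [dedup _]/=; case: ifP => [/eqSP xy|_]; last by rewrite inE IH -in_cons.
by rewrite -/(dedup (y :: L)) IH xy [RHS]inE orbC; case: eqVneq => [->|]; rewrite ?mem_head ?orbF.
Qed.

(** The side conditions of [step_sound] that concern labels only, checked once along the program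
    instead of for each state. *)
Fixpoint frontier_ok (fr : seq N) (pr : seq (seq N * seq N)) : bool :=
  if pr is d :: pr' then
    [&& all (mem fr) d.1, all [predC fr] d.2, uniq d.1, uniq d.2, size d.1 + size d.2 <= 3
      & frontier_ok (frontier_step fr d.1 d.2) pr']
  else true.

Fixpoint frontier_end (fr : seq N) (pr : seq (seq N * seq N)) : seq N :=
  if pr is d :: pr' then frontier_end (frontier_step fr d.1 d.2) pr' else fr.

Section Run.
Variables (T : finType) (F : rel T).
Hypothesis Fsym : symmetric F.
Hypothesis Fdeg : forall x l, uniq l -> (forall y, F x y -> y \in l) -> count (F x) l = 2.
Hypothesis Fconn : forall W : {set T}, W != set0 ->
  (forall x y, x \in W -> F x y -> y \in W) -> W = setT.

Lemma inv_eq_frontier (src tgt : N -> T) X fr fr' st :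
  fr =i fr' -> inv F src tgt X fr st -> inv F src tgt X fr' st.
Proof.
move=> ff [u m l]; split=> // [e|p /l[W [w1 w2 w3 w4]]]; first by rewrite m ff.
by exists W; split=> // e; rewrite -ff; apply: w4.
Qed.

(** Needed at both ends of a run: output labels 0 to 3 become left identifiers of the piece, and its
    right identifiers become output labels again. *)
Lemma inv_relabel (src tgt src' tgt' : N -> T) (r : N -> N) X fr st :
  {in fr &, injective r} -> {in fr, forall e, src' (r e) = src e} ->
  {in fr, forall e, tgt' (r e) = tgt e} -> inv F src tgt X fr st ->
  inv F src' tgt' X [seq r e | e <- fr] [seq (r p.1, r p.2) | p <- st].
Proof.
move=> rI rs rt [u m l].
have fl : flat [seq (r p.1, r p.2) | p <- st] = map r (flat st).
  by rewrite /flat map_flatten -!map_comp.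
have sub e : e \in flat st -> e \in fr by rewrite m => /andP[].
split.
- by rewrite fl map_inj_in_uniq // => x y /sub xf /sub yf; apply: rI.
- move=> e; rewrite fl; apply/mapP/andP.
    case=> e' e'st ->; have := e'st; rewrite m => /andP[ef ue].
    by rewrite map_f // rs // rt.
  case=> /mapP[e' ef ->]; rewrite rs // rt // => ue.
  by exists e' => //; rewrite m ef.
move=> _ /mapP[p pst ->]; case: (l p pst) => W [w1 w2 w3 w4]; exists W.
have /andP[p1 p2] := mem_flat pst; have f1 := sub _ p1; have f2 := sub _ p2.
split=> //=; first by rewrite !rs.
  move=> x y xW yW xy; case: (w3 x y xW yW xy) => e; rewrite !inE => /orP[]/eqP-> ->.
    by exists (r p.1); rewrite ?inE ?eqxx // rs // rt.
  by exists (r p.2); rewrite ?inE ?eqxx ?orbT // rs // rt.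
move=> _ /mapP[e ef ->]; rewrite rs // rt // => ue eW.
by have := w4 e ef ue eW; rewrite !inE => /orP[]/eqP->; rewrite eqxx ?orbT.
Qed.

Lemma inv_normalize (src tgt : N -> T) X fr st :
  inv F src tgt X fr st -> inv F src tgt X fr (normalize st).
Proof.
case=> u m l.
have pf : perm_eq (flat (normalize st)) (flat st).
  elim: st {u m l} => [|p st IH] //=; apply: (perm_trans (perm_flat_insert _ _ _)).
  by rewrite /flat /= -!/(flat _) !perm_cons.
split; first by rewrite (perm_uniq pf).
  by move=> e; rewrite (perm_mem pf).
elim: st {u m pf} l => [|p st IH] l //= q; rewrite mem_insert => /orP[/eqP->|].
  by apply/linked_mk; rewrite -surjective_pairing; apply: l; rewrite mem_head.
by apply: IH => q' q'st; apply: l; rewrite inE q'st orbT.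
Qed.

Variables (src tgt : N -> T).

(** Among the states listed at each stage, one is the state induced by [F]; it is followed through
    the run. The processed set grows by the vertices of the piece. *)
Lemma run_sound (vs : seq T) pr (X : {set T}) (fr : seq N) (L : seq state) (st : state) :
  size vs = size pr -> uniq vs -> (forall v, v \in vs -> v \notin X) ->
  uniq fr -> {in fr, forall e, src e \in X} -> frontier_ok fr pr ->
  (forall v d, (v, d) \in zip vs pr ->
    [/\ {in d.1, forall e, tgt e = v}, {in d.2, forall e, src e = v},
        uniq ([seq src e | e <- d.1] ++ [seq tgt e | e <- d.2])
      & forall y, F v y -> y \in [seq src e | e <- d.1] ++ [seq tgt e | e <- d.2]]) ->
  st \in L -> inv F src tgt X fr st ->
  exists2 st', st' \in run pr L &
    inv F src tgt (X :|: [set v | v \in vs]) (frontier_end fr pr) st'.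
Proof.
elim: pr vs X fr L st => [|d pr IH] [|v vs] //= X fr L st.
  move=> _ _ _ _ _ _ _ stL ist; exists st => //.
  by have -> : [set v | v \in [::]] = set0 :> {set T} by []; rewrite setU0.
case=> szE /andP[vvs uvs] vX ufr sfr /and5P[o_fr n_fr uo un /andP[szd ok]] H stL ist.
have [ot ns nu nP] : [/\ {in d.1, forall e, tgt e = v}, {in d.2, forall e, src e = v},
        uniq ([seq src e | e <- d.1] ++ [seq tgt e | e <- d.2])
      & forall y, F v y -> y \in [seq src e | e <- d.1] ++ [seq tgt e | e <- d.2]].
  by apply: H; rewrite mem_head.
have vX0 : v \notin X by apply: vX; rewrite mem_head.
(* If another vertex [w] is still to come, it lies outside the processed set. *)
have lastP : nilp pr || (v |: X != setT).
  case: vs szE vvs vX {IH H uvs} => [|w vs] szE; first by rewrite /nilp -szE.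
  rewrite inE negb_or => /andP[vw _] vX; apply/orP; right.
  apply: contraTneq (in_setT w) => <-; rewrite in_setU1 eq_sym negb_or vw.
  by apply: vX; rewrite !inE eqxx orbT.
have [] := @step_sound T F Fsym Fdeg Fconn src tgt X fr v d.1 d.2 vX0 sfr uo
  (allP o_fr) ot un _ ns nu nP szd (nilp pr) st ist lastP.
  by move=> e /(allP n_fr).
rewrite -surjective_pairing => st1 st1s ist1.
have -> : X :|: [set x | x \in v :: vs] = (v |: X) :|: [set x | x \in vs].
  by apply/setP => x; rewrite !inE orbA (orbC (x \in X)).
apply: (IH vs (v |: X) _ _ st1) => //.
- move=> w wvs; rewrite in_setU1 negb_or; apply/andP; split.
    by apply: contraNneq vvs => <-.
  by apply: vX; rewrite inE wvs orbT.
- rewrite cat_uniq filter_uniq // un andbT /=; apply/hasPn => e /(allP n_fr) /= ef.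
  by rewrite mem_filter (negbTE ef) andbF.
- move=> e; rewrite mem_cat mem_filter => /orP[/andP[_ /sfr eX]|/ns->]; rewrite !inE ?eqxx ?eX ?orbT //.
- by move=> w d' wd; apply: H; rewrite inE wd orbT.
- rewrite mem_dedup mem_sort; apply/flattenP; exists (step (nilp pr) d st) => //.
  by apply/mapP; exists st.
Qed.

End Run.

(** * Chains of poles *)

(** An open graph on the numbers below [order]; [out] lists, in order, the vertices carrying the
    outgoing half-edges. *)
Record pole := Pole { order : nat; nbr : nat -> seq nat; out : seq nat }.

(** [s] and [t] list the two ends of a family of half-edges; the result holds the far ends of those
    at [x]. *)
Definition link (s t : seq nat) (x : nat) : seq nat :=
  [seq nth 0 t k | k <- iota 0 (size s) & nth 0 s k == x].

Definition extend (P : pole) (D : piece) : pole :=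
  Pole (order P + psize D)
    (fun x => if x < order P then nbr P x ++ link (out P) [seq order P + w | w <- lft D] x
       else [seq order P + w | w <- nth [::] (adj D) (x - order P)]
              ++ link (lft D) (out P) (x - order P))
    [seq order P + w | w <- rgt D].

Definition piece_ok (D : piece) : bool :=
  let n := psize D in
  [&& n + 8 <= 256, all (all (fun w => w < n)) (adj D),
      all (fun u => u \notin nth [::] (adj D) u) (iota 0 n),
      all (fun w => w < n) (lft D), all (fun w => w < n) (rgt D), size (lft D) <= 4 & size (rgt D) == 4].

Definition lids D := [seq lid D k | k <- iota 0 (size (lft D))].

Definition program_ok (D : piece) : bool :=
  let fe := frontier_end (lids D) (program D) in
  [&& frontier_ok (lids D) (program D), all (mem (rids D)) fe & all (mem fe) (rids D)].

Lemma linkP s t x y : reflect (exists2 k, k < size s & nth 0 s k = x /\ y = nth 0 t k) (y \in link s t x).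
Proof.
apply: (iffP mapP) => [[k]|[k ks [sx ->]]].
  by rewrite mem_filter mem_iota => /andP[/eqP sk /= ks] ->; exists k.
by exists k => //; rewrite mem_filter mem_iota sx eqxx.
Qed.

Lemma link_nil s t x : x \notin s -> link s t x = [::].
Proof.
move=> xs; case E: (link s t x) => [|y l] //.
have /linkP[k ks [kx _]] : y \in link s t x by rewrite E mem_head.
by case/negP: xs; rewrite -kx mem_nth.
Qed.

Lemma eid_src a b : b < 256 -> N.to_nat (eid a b / 256) = a.
Proof.
move=> b256; rewrite /eid N.div_add_l //.
rewrite N.div_small; last by rewrite /N.lt; apply/N.compare_lt_iff; lia.
by rewrite N.add_0_r Nat2N.id.
Qed.

Lemma eid_tgt a b : b < 256 -> N.to_nat (N.modulo (eid a b) 256) = b.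
Proof.
move=> b256; rewrite /eid N.add_comm N.Div0.mod_add.
rewrite N.mod_small; last by apply/N.compare_lt_iff; lia.
by rewrite Nat2N.id.
Qed.

Lemma eid_inj a b c d : b < 256 -> d < 256 -> eid a b = eid c d -> a = c /\ b = d.
Proof.
move=> b6 d6 e; have := eid_src a b6; have := eid_tgt a b6.
by rewrite e eid_src // eid_tgt // => -> ->.
Qed.

Lemma zip_map2 (A B C : Type) (f : A -> B) (g : A -> C) s :
  zip (map f s) (map g s) = [seq (f x, g x) | x <- s].
Proof. by elim: s => //= x s ->. Qed.

(** * Transfer across one glued piece, inside an arbitrary host *)

Section Host.
Variables (T : finType) (F : rel T).
Hypothesis Fsym : symmetric F.
Hypothesis Fdeg : forall x l, uniq l -> (forall y, F x y -> y \in l) -> count (F x) l = 2.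
Hypothesis Fconn : forall W : {set T}, W != set0 ->
  (forall x y, x \in W -> F x y -> y \in W) -> W = setT.
Variables (h : nat -> T) (B : nat).
Hypothesis hI : {in [pred x | x < B] &, injective h}.

(** [l] gives the outer ends of the outgoing half-edges. The host graph itself does not occur: it is
    enough that [F] uses, at vertices of the pole, only edges of the pole or these half-edges. *)
Definition hosted (P : pole) (l : seq nat) :=
  order P <= B /\ forall x, x < order P ->
    uniq [seq h y | y <- nbr P x ++ link (out P) l x] /\
    forall t, F (h x) t -> t \in [seq h y | y <- nbr P x ++ link (out P) l x].

Definition span m : {set T} := [set t | t \in [seq h x | x <- iota 0 m]].

Definition realizes (P : pole) (l : seq nat) (st : state) :=
  inv F (fun e => h (nth 0 (out P) (N.to_nat e))) (fun e => h (nth 0 l (N.to_nat e)))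
    (span (order P)) [seq N.of_nat k | k <- iota 0 (size (out P))] st.

(** Seen from [P], the outer ends are the left attachments of [D]; the outputs of the extension all
    lie in [D], so [l] is invisible at old vertices. *)
Lemma hosted_extend P D l : hosted (extend P D) l ->
  hosted P [seq order P + w | w <- lft D].
Proof.
case=> /= le H; split=> [|x xP]; first exact: leq_trans (leq_addr _ _) le.
have := H x (ltn_addr _ xP); rewrite xP (@link_nil [seq order P + w | w <- rgt D]) ?cats0 //.
by apply/negP => /mapP[w _ xw]; rewrite xw ltnNge leq_addr in xP.
Qed.

(** Codes of the piece are decoded to host vertices, and [run_sound] is applied between two changes
    of labels. Only [hosted] connects the finite run to the host, so the same run serves for every
    host. *)
Lemma realizes_extend P D l S0 : piece_ok D -> program_ok D -> closed_from D S0 ->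
  size (out P) = size (lft D) -> all (fun x => x < order P) (out P) -> hosted (extend P D) l ->
  (exists2 st, st \in S0 & realizes P [seq order P + w | w <- lft D] st) ->
  exists2 st, st \in full_states & realizes (extend P D) l st.
Proof.
case/and5P => n256 /allP adjn /allP adju /allP lftn /and3P[/allP rgtn szl /eqP szr].
case/and3P => fok /allP fe1 /allP fe2 clo szo /allP outm [le host] [st stS0 ist].
set n := psize D in n256 adjn adju lftn rgtn *; set m := order P in le host ist *.
have le' : m + n <= B := le.
(* Decodes a code: a left half-edge to the old output it comes from, a right one to its outer end in
   [l]. *)
pose H c := if c < 4 then nth 0 (out P) c else if c < n + 4 then m + (c - 4) else nth 0 l (c - (n + 4)).
pose src e := h (H (N.to_nat (e / 256))); pose tgt e := h (H (N.to_nat (N.modulo e 256))).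
have lk k : k < size (lft D) -> nth 0 (lft D) k < n by move=> kl; apply: lftn; rewrite mem_nth.
have rk k : k < 4 -> nth 0 (rgt D) k < n by move=> k4; apply: rgtn; rewrite mem_nth // szr.
have Hv u : u < n -> H (4 + u) = m + u.
  by move=> un; rewrite /H ltnNge leq_addr /= addnC ltn_add2r un addnK.
have Hr k : H (n + 4 + k) = nth 0 l k.
  by rewrite /H; case: ifP => [|_]; [lia | case: ifP => [|_]; [lia | congr nth; lia]].
have Hl k : k < 4 -> H k = nth 0 (out P) k by rewrite /H => ->.
have ist1 : inv F src tgt (span m) (lids D) (fromlabel D st).
  pose r e := lid D (N.to_nat e).
  have -> : lids D = [seq r e | e <- [seq N.of_nat k | k <- iota 0 (size (out P))]].
    by rewrite -map_comp /lids szo; apply: eq_map => k; rewrite /r /= Nat2N.id.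
  apply: inv_relabel ist.
  - move=> _ _ /mapP[k + ->] /mapP[k' + ->]; rewrite !mem_iota /r !Nat2N.id /lid => kl kl'.
    by case/eid_inj => [||-> //]; have := lk k; have := lk k'; lia.
  - move=> _ /mapP[k + ->]; rewrite mem_iota /r Nat2N.id /src /lid => kl.
    by rewrite eid_src ?Hl //; have := lk k; lia.
  - move=> _ /mapP[k + ->]; rewrite mem_iota /r Nat2N.id /tgt /lid => kl.
    rewrite eid_tgt; last by have := lk k; lia.
    by rewrite Hv ?(nth_map 0) //; have := lk k; lia.
have codesn u c : u < n -> c \in codes D u -> c < n + 8 /\ c != 4 + u.
  move=> un; rewrite !mem_cat => /or3P[].
  - by rewrite mem_filter mem_iota => /andP[_ cl]; split; lia.
  - case/mapP=> w wa ->; have wn : w < n.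
      by apply: (allP (adjn _ (mem_nth [::] un))).
    split; first by lia.
    have /adju ua : u \in iota 0 n by rewrite mem_iota.
    by rewrite eqn_add2l; apply: contraNneq ua => wu; rewrite -{1}wu.
  - by case/mapP=> k; rewrite mem_filter mem_iota => /andP[_ k4] ->; split; lia.
have vsE : span (m + n) = span m :|: [set v | v \in [seq h (m + u) | u <- iota 0 n]].
  apply/setP => t; rewrite !inE iotaD map_cat mem_cat add0n; congr (_ || _).
  by rewrite -[X in iota X]addn0 iotaDl -map_comp.
have [] := @run_sound T F Fsym Fdeg Fconn src tgt [seq h (m + u) | u <- iota 0 n] (program D)
  (span m) (lids D) [seq fromlabel D st | st <- S0] (fromlabel D st).
- by rewrite !size_map.
- rewrite map_inj_in_uniq ?iota_uniq // => u w; rewrite !mem_iota !add0n /= => un wn.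
  by move=> hh; apply/(@addnI m)/hI => //; rewrite inE; lia.
- move=> _ /mapP[u + ->]; rewrite mem_iota inE => /= un.
  apply/mapP => [[x]]; rewrite mem_iota /= => xm hh.
  have : m + u = x by apply: hI hh; rewrite inE; lia.
  by lia.
- rewrite map_inj_in_uniq ?iota_uniq // => k k'; rewrite !mem_iota /lid => kl kl'.
  by case/eid_inj => [||-> //]; have := lk k; have := lk k'; lia.
- move=> _ /mapP[k + ->]; rewrite mem_iota => kl; rewrite /src /lid eid_src; last by have := lk k; lia.
  rewrite Hl; last by lia.
  by rewrite inE; apply/map_f; rewrite mem_iota add0n outm // mem_nth // szo; lia.
- exact: fok.
- move=> v d; rewrite zip_map2 => /mapP[u]; rewrite mem_iota => /= un [-> ->] /=.
  have Hvu := Hv u un; have cn c := codesn u c un.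
  have -> : [seq src e | e <- [seq eid c (4 + u) | c <- codes D u & c < 4 + u]] =
      [seq h (H c) | c <- codes D u & c < 4 + u].
    by rewrite -map_comp; apply: eq_map => c; rewrite /= /src eid_src //; lia.
  have -> : [seq tgt e | e <- [seq eid (4 + u) c | c <- codes D u & 4 + u < c]] =
      [seq h (H c) | c <- codes D u & predC (fun c => c < 4 + u) c].
    rewrite -map_comp; set s2 := [seq c <- _ | predC _ c].
    have -> : [seq c <- codes D u | 4 + u < c] = s2.
      by apply: eq_in_filter => c /cn[_ /=]; lia.
    apply/eq_in_map => c; rewrite mem_filter => /andP[_ /cn[c8 _]].
    by rewrite /= /tgt eid_tgt //; lia.
  (* The three blocks of [codes] decode to the neighbour list of the vertex, up to the order of the
     blocks. *)
  have pc : perm_eq [seq H c | c <- codes D u]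
      (nbr (extend P D) (m + u) ++ link (out (extend P D)) l (m + u)).
    rewrite /= ltnNge leq_addr /= addKn -/m /codes !map_cat -catA.
    rewrite perm_catCA.
    have -> : [seq H i | i <- [seq k <- iota 0 (size (lft D)) | nth 0 (lft D) k == u]] =
        link (lft D) (out P) u.
      rewrite /link.
      apply/eq_in_map => k; rewrite mem_filter mem_iota => /andP[_ kl].
      by rewrite Hl //; lia.
    have -> : [seq H i | i <- [seq 4 + w | w <- nth [::] (adj D) u]] =
        [seq m + w | w <- nth [::] (adj D) u].
      rewrite -map_comp; apply/eq_in_map => w wa; rewrite /= Hv //.
      exact: (allP (adjn _ (mem_nth [::] un))).
    suff -> : [seq H i | i <- [seq n + 4 + k | k <- iota 0 4 & nth 0 (rgt D) k == u]] =
        link [seq m + w | w <- rgt D] l (m + u) by [].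
    rewrite -map_comp /link size_map szr.
    have -> : [seq k <- iota 0 4 | nth 0 [seq m + w | w <- rgt D] k == m + u] =
        [seq k <- iota 0 4 | nth 0 (rgt D) k == u].
      apply: eq_in_filter => k; rewrite mem_iota => /= k4.
      by rewrite (nth_map 0) ?szr // eqn_add2l.
    by apply: eq_map => k; rewrite /= Hr.
  (* No code in the list is that of [u] itself, so smaller and larger codes exhaust it. *)
  have ph : perm_eq ([seq h (H c) | c <- codes D u & c < 4 + u] ++
      [seq h (H c) | c <- codes D u & predC (fun c => c < 4 + u) c])
      [seq h y | y <- nbr (extend P D) (m + u) ++ link (out (extend P D)) l (m + u)].
    rewrite -map_cat; apply: perm_trans (perm_map h pc); rewrite -map_comp.
    by apply: perm_map; rewrite perm_filterC.
  have [hu hF] := host (m + u) (etrans (ltn_add2l m u n) un).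
  split.
  + by move=> _ /mapP[c _ ->]; rewrite /tgt eid_tgt ?Hvu //; lia.
  + move=> _ /mapP[c + ->]; rewrite mem_filter => /andP[_ /cn[c8 _]].
    by rewrite /src eid_src ?Hvu //; lia.
  + by rewrite (perm_uniq ph).
  + by move=> y /hF; rewrite (perm_mem ph).
- by apply/mapP; exists st.
- exact: ist1.
move=> st' st'r ist'.
have rI k k' : k < 4 -> k' < 4 -> rid D k = rid D k' -> k = k'.
  by move=> k4 k4' /eid_inj[]; lia.
have ridn k : k < 4 -> nth 0%num (rids D) k = rid D k.
  by move=> k4; rewrite (nth_map 0) ?size_iota // nth_iota.
have urid : uniq (rids D).
  by rewrite map_inj_in_uniq ?iota_uniq // => k k'; rewrite !mem_iota; apply: rI.
have idx k : k < 4 -> index (rid D k) (rids D) = k.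
  by move=> k4; rewrite -{1}(ridn k k4) index_uniq // size_map size_iota.
exists (tolabel D st').
  have := allP clo _ st'r => /hasP[st'' st''f /eqSP E].
  by rewrite E.
apply: inv_normalize; rewrite -/m -/n vsE.
pose r e := N.of_nat (index e (rids D)).
have -> : [seq N.of_nat k | k <- iota 0 (size (out (extend P D)))] = [seq r e | e <- rids D].
  rewrite [out _]/= size_map szr [in RHS]/rids -[RHS]map_comp; apply/eq_in_map => k; rewrite mem_iota => /= k4.
  by rewrite /r idx.
have memr e : e \in rids D -> exists2 k, k < 4 & e = rid D k.
  by case/mapP=> k; rewrite mem_iota => /= k4 ->; exists k.
apply: (@inv_relabel T F src tgt _ _ r).
- move=> _ _ /memr[k k4 ->] /memr[k' k4' ->]; rewrite /r !idx // => /Nat2N.inj -> //.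
- move=> _ /memr[k k4 ->]; rewrite /r idx // Nat2N.id /src /rid eid_src; last by lia.
  by rewrite Hv ?rk //= (nth_map 0) ?szr.
- move=> _ /memr[k k4 ->]; rewrite /r idx // Nat2N.id /tgt /rid eid_tgt; last by lia.
  by rewrite Hr.
apply: inv_eq_frontier ist' => e; apply/idP/idP; [exact: fe1 | exact: fe2].
Qed.

End Host.

(** * Local structure of poles: degrees and short cycles *)

Record pole_graph (P : pole) : Prop := PoleGraph {
  out_lt : forall x, x \in out P -> x < order P;
  out_uniq : uniq (out P);
  nbr_lt : forall x y, x < order P -> y \in nbr P x -> y < order P;
  nbr_uniq : forall x, x < order P -> uniq (nbr P x);
  nbr_sym : forall x y, x < order P -> y \in nbr P x -> x \in nbr P y;
  nbr_size : forall x, x < order P -> size (nbr P x) + (x \in out P) = 3;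
  nbr_irr : forall x, x < order P -> x \notin nbr P x;
  nbr_no3 : forall x y z, x < order P -> y \in nbr P x -> z \in nbr P y -> x \in nbr P z -> False;
  nbr_no4 : forall x y z w, x < order P -> x <> z -> y <> w -> y \in nbr P x -> z \in nbr P y ->
    w \in nbr P z -> x \in nbr P w -> False;
  (* Excludes 4-cycles across a seam and, in the drawing, edges running along a side of the
     square. *)
  out_nadj : forall x y, x \in out P -> y \in out P -> y \notin nbr P x }.

(** The nested test follows walks [u v w x] that do not turn back: the clause on [w] excludes
    triangles through [u], the one on [x] 4-cycles. *)
Definition piece_graph (D : piece) : bool :=
  let n := psize D in let a u := nth [::] (adj D) u in
  [&& uniq (lft D), uniq (rgt D),
      all (fun u => [&& uniq (a u), size (a u) + (u \in lft D) + (u \in rgt D) == 3,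
        all (fun w => u \in a w) (a u)
        & all (fun v => all (fun w => (w == u) ||
            ((u \notin a w) && all (fun x => (x == v) || (u \notin a x)) (a w))) (a v)) (a u)]) (iota 0 n)
    & all (fun u => all (fun w => w \notin a u) (rgt D)) (rgt D)].

(** Paths of length 2 and 3 between outputs to be joined are excluded inside the piece. As no output
    is a left attachment, outputs have no older neighbours and such a path cannot leave the
    piece. *)
Definition far_ends (D : piece) : bool :=
  let a u := nth [::] (adj D) u in let b k := nth 0 (rgt D) (nth 0 [:: 1; 0; 3; 2] k) in
  all (fun k => all (fun z => (b k \notin a z) && all (fun w => b k \notin a w) (a z))
    (a (nth 0 (rgt D) k))) (iota 0 4) && all (fun w => w \notin lft D) (rgt D).

Lemma size_link s t x : uniq s -> size (link s t x) = (x \in s).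
Proof.
move=> us; rewrite size_map size_filter.
rewrite -[X in count _ (iota 0 X)]/(size s) -(count_map (nth 0 s) (pred1 x)).
by rewrite map_nth_iota0 // take_size count_uniq_mem.
Qed.

Lemma link_uniq s t x : uniq s -> uniq (link s t x).
Proof.
move=> us; have := size_link t x us; case: (link s t x) => [|y [|z l]] //.
by case: (x \in s).
Qed.

Section Extend.
Variables (P : pole) (D : piece).
Hypothesis gP : pole_graph P.
Hypothesis okD : piece_ok D.
Hypothesis gD : piece_graph D.
Hypothesis szo : size (out P) = size (lft D).
Let m := order P.
Let a u := nth [::] (adj D) u.

Lemma adj_lt u w : w \in a u -> w < psize D.
Proof.
case/and5P: okD => _ /allP H _ _ _; rewrite /a.
case: (ltnP u (psize D)) => un; last by rewrite nth_default.
by apply: (allP (H _ (mem_nth [::] un))).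
Qed.

Lemma adj_dom u w : w \in a u -> u < psize D.
Proof. by rewrite ltnNge => wa; apply/negP => un; rewrite /a nth_default in wa. Qed.

Lemma lft_lt w : w \in lft D -> w < psize D.
Proof. by case/and5P: okD => _ _ _ /allP H _ /H. Qed.

Lemma rgt_lt w : w \in rgt D -> w < psize D.
Proof. by case/and5P: okD => _ _ _ _ /and3P[/allP H _ _] /H. Qed.

Lemma nth_out_lt k : k < size (lft D) -> nth 0 (out P) k < m.
Proof. by move=> kl; apply: (out_lt gP); rewrite mem_nth // szo. Qed.

Lemma extend_old x y : x < m -> y < m -> (y \in nbr (extend P D) x) = (y \in nbr P x).
Proof.
move=> xm ym; rewrite /= -/m xm mem_cat orbC; case: linkP => // [[k ks [_ yk]]].
by move: ks ym; rewrite yk szo => ks; rewrite (nth_map 0) // ltnNge leq_addr.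
Qed.

Lemma extend_new u w : (m + w \in nbr (extend P D) (m + u)) = (w \in a u).
Proof.
rewrite /= -/m ltnNge leq_addr /= addKn mem_cat orbC; case: linkP => [[k ks [_ yk]]|_].
  by have := nth_out_lt ks; rewrite -yk ltnNge leq_addr.
by rewrite /= mem_map //; apply: addnI.
Qed.

Lemma extend_up x u : x < m -> reflect (exists2 k, k < size (lft D) & x = nth 0 (out P) k /\ u = nth 0 (lft D) k)
  (m + u \in nbr (extend P D) x).
Proof.
move=> xm; rewrite /= -/m xm mem_cat; case Ex: (_ \in nbr P x).
  by have := nbr_lt gP xm Ex; rewrite -/m ltnNge leq_addr.
apply: (iffP (linkP _ _ _ _)) => [[k ks [sx E]]|[k ks [-> ->]]].
  exists k; rewrite -?szo //; split=> //; move: E; rewrite (nth_map 0) -?szo //.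
  exact: addnI.
by exists k; rewrite ?szo //; split=> //; rewrite (nth_map 0).
Qed.

Lemma extend_down x u : x < m -> (x \in nbr (extend P D) (m + u)) = (m + u \in nbr (extend P D) x).
Proof.
move=> xm; apply/idP/(extend_up _ xm).
  rewrite /= -/m ltnNge leq_addr /= addKn mem_cat => /orP[/mapP[w _ E]|/linkP[k ks [kx kE]]].
    by rewrite E ltnNge leq_addr in xm.
  by exists k.
case=> k ks [-> ->]; rewrite /= -/m ltnNge leq_addr /= addKn mem_cat; apply/orP; right.
by apply/linkP; exists k.
Qed.

Lemma split_vtx y : (exists2 u, y = m + u & y >= m) \/ y < m.
Proof. by case: (ltnP y m) => ym; [right|left; exists (y - m); rewrite ?subnKC]. Qed.

Let lft_uniq : uniq (lft D). Proof. by case/and4P: gD. Qed.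

(** The edges across a seam form a matching: here because the outputs of [P] are distinct, in
    [cross_old] because the left attachments of [D] are. *)
Lemma cross_new x u v : x < m -> m + u \in nbr (extend P D) x -> m + v \in nbr (extend P D) x -> u = v.
Proof.
move=> xm /(extend_up _ xm)[k ks [xk ->]] /(extend_up _ xm)[k' ks' [xk' ->]].
suff -> : k = k' by [].
by apply/eqP; rewrite -(nth_uniq 0 _ _ (out_uniq gP)) ?szo // -xk xk'.
Qed.

Lemma cross_old x y u : x < m -> y < m -> m + u \in nbr (extend P D) x -> m + u \in nbr (extend P D) y -> x = y.
Proof.
move=> xm ym /(extend_up _ xm)[k ks [-> uk]] /(extend_up _ ym)[k' ks' [-> uk']].
suff -> : k = k' by [].
by apply/eqP; rewrite -(nth_uniq 0 _ _ lft_uniq) // -uk uk'.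
Qed.

Lemma cross_out x u : x < m -> m + u \in nbr (extend P D) x -> x \in out P.
Proof. by move=> xm /(extend_up _ xm)[k ks [-> _]]; rewrite mem_nth // szo. Qed.

Lemma gDu u : u < psize D -> [/\ uniq (a u), size (a u) + (u \in lft D) + (u \in rgt D) = 3,
   forall w, w \in a u -> u \in a w
  & forall v w, v \in a u -> w \in a v -> w <> u -> u \notin a w /\
      forall x, x \in a w -> x <> v -> u \notin a x].
Proof.
case/and4P: gD => _ _ /allP H _ un; have /H/and4P[h1 /eqP h2 /allP h3 /allP h4] : u \in iota 0 (psize D).
  by rewrite mem_iota.
split=> // v w va wa wu; have := allP (h4 v va) w wa => /orP[/eqP//|/andP[h5 /allP h6]].
by split=> // x xa xv; case/orP: (h6 x xa) => [/eqP|].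
Qed.

Lemma extend_sym x y : x < m + psize D -> y \in nbr (extend P D) x -> x \in nbr (extend P D) y.
Proof.
move=> xn; case: (split_vtx x) => [[u xu _]|xm]; case: (split_vtx y) => [[v yv _]|ym]; subst.
- rewrite !extend_new => va; rewrite ltn_add2l in xn.
  by have [_ _ H _] := gDu xn; apply: H.
- by rewrite extend_down.
- by rewrite extend_down.
- rewrite !extend_old //; exact: nbr_sym.
Qed.

Lemma extend_lt x y : x < m + psize D -> y \in nbr (extend P D) x -> y < m + psize D.
Proof.
move=> xn; case: (split_vtx x) => [[u xu _]|xm]; case: (split_vtx y) => [[v yv _]|ym]; subst.
- by rewrite extend_new ltn_add2l => /adj_lt.
- by move=> _; apply: ltn_addr.
- by case/(extend_up _ xm) => k ks [_ ->]; rewrite ltn_add2l lft_lt // mem_nth.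
- by move=> _; apply: ltn_addr.
Qed.

(** A short cycle meeting both sides crosses the seam at least twice. Since crossing edges form a
    matching, the only possibility is a 4-cycle with two adjacent vertices on each side; its old
    vertices would be adjacent outputs, against [out_nadj]. *)
Lemma pole_graph_extend : pole_graph (extend P D).
Proof.
have [_ ur _ rn] := and4P gD.
split=> /=; rewrite -/m.
- by move=> _ /mapP[w wr ->]; rewrite ltn_add2l rgt_lt.
- by rewrite map_inj_uniq //; apply: addnI.
- exact: extend_lt.
- move=> x xn; case: ifP => xm.
    rewrite cat_uniq (nbr_uniq gP) // link_uniq ?(out_uniq gP) // andbT.
    apply/hasPn => y /linkP[k ks [_ ->]]; apply/negP; rewrite szo in ks; rewrite (nth_map 0) //.
    by move/(nbr_lt gP xm); rewrite -/m ltnNge leq_addr.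
  have un : x - m < psize D by lia.
  have [ua _ _ _] := gDu un.
  rewrite cat_uniq map_inj_uniq ?ua; last exact: addnI.
  rewrite link_uniq // andbT; apply/hasPn => y /linkP[k ks [_ ->]].
  by apply/mapP => [[w _ E]]; have := nth_out_lt ks; rewrite E ltnNge leq_addr.
- exact: extend_sym.
- move=> x xn; case: ifP => xm.
    rewrite size_cat size_link ?(out_uniq gP) // (nbr_size gP) //.
    suff -> : (x \in [seq m + w | w <- rgt D]) = false by rewrite addn0.
    by apply/mapP => [[w _ E]]; rewrite E ltnNge leq_addr in xm.
  have un : x - m < psize D by lia.
  have [_ <- _ _] := gDu un; rewrite size_cat size_map size_link //; congr (_ + _ + _).
  have {1}-> : x = m + (x - m) by lia.
  by rewrite mem_map //; apply: addnI.
- move=> x xn; case: (split_vtx x) => [[u xu _]|xm]; last first.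
    by rewrite -/(nbr (extend P D) x) extend_old // (nbr_irr gP).
  rewrite -/(nbr (extend P D) x) xu extend_new; case/and5P: okD => _ _ /allP H _ _.
  by apply: H; rewrite mem_iota; lia.
- move=> x y z xn; rewrite -!/(nbr (extend P D) _) => xy yz zx.
  have yn := extend_lt xn xy; have zn := extend_lt yn yz.
  have yx := extend_sym xn xy; have zy := extend_sym yn yz; have xz := extend_sym zn zx.
  case: (split_vtx x) => [[u xu _]|xm]; case: (split_vtx y) => [[v yv _]|ym];
    case: (split_vtx z) => [[w zw _]|zm]; subst.
  + rewrite !extend_new in xy yz zx; have un := adj_dom xy.
    have [_ _ _ H] := gDu un; have [|+ _] := H v w xy yz; last by rewrite zx.
    by move=> wu; have := zx; rewrite wu; apply/negP; case/and5P: okD => _ _ /allP I _ _; apply: I; rewrite mem_iota.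
  + have E := cross_new zm zx zy; subst v; move: xy; rewrite extend_new; apply/negP.
    by case/and5P: okD => _ _ /allP I _ _; apply: I; rewrite mem_iota; lia.
  + have E := cross_new ym yx yz; subst w; move: xz; rewrite extend_new; apply/negP.
    by case/and5P: okD => _ _ /allP I _ _; apply: I; rewrite mem_iota; lia.
  + have E := cross_old ym zm yx zx; subst z; move: yz; rewrite extend_old //; apply/negP; exact: (nbr_irr gP).
  + have E := cross_new xm xy xz; subst w; move: yz; rewrite extend_new; apply/negP.
    by case/and5P: okD => _ _ /allP I _ _; apply: I; rewrite mem_iota; lia.
  + have E := cross_old xm zm xy zy; subst z; move: zx; rewrite extend_old //; apply/negP; exact: (nbr_irr gP).
  + have E := cross_old xm ym xz yz; subst y; move: xy; rewrite extend_old //; apply/negP; exact: (nbr_irr gP).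
  + by rewrite !extend_old // in xy yz zx; apply: (nbr_no3 gP xm xy yz zx).
- move=> x y z t xn; rewrite -!/(nbr (extend P D) _) => nxz nyt xy yz zt tx.
  have yn := extend_lt xn xy; have zn := extend_lt yn yz; have tn := extend_lt zn zt.
  have yx := extend_sym xn xy; have zy := extend_sym yn yz; have tz := extend_sym zn zt; have xt := extend_sym tn tx.
  have oo p q u v : p < m -> q < m -> m + u \in nbr (extend P D) p -> m + v \in nbr (extend P D) q ->
      q \in nbr (extend P D) p -> False.
    move=> pm qm up vq; rewrite extend_old //; apply/negP; by apply: (out_nadj gP); [exact: cross_out pm up | exact: cross_out qm vq].
  case: (split_vtx x) => [[u xu _]|xm]; case: (split_vtx y) => [[v yv _]|ym];
    case: (split_vtx z) => [[w zw _]|zm]; case: (split_vtx t) => [[r tr _]|tm]; subst.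
  + rewrite !extend_new in xy yz zt tx; have un := adj_dom xy.
    have [_ _ _ H] := gDu un; have [|_ K] := H v w xy yz; first by move=> E; subst.
    by have := K r zt; rewrite tx => /(_ _)/negP; case=> // E; subst.
  + by have E := cross_new tm tx tz; subst.
  + by have E := cross_new zm zy zt; subst.
  + exact: (oo z t v u).
  + by have E := cross_new ym yx yz; subst.
  + by have E := cross_new ym yx yz; subst.
  + exact: (oo y z u r).
  + by have E := cross_old ym tm yx tx; subst.
  + by have E := cross_new xm xy xt; subst.
  + exact: (oo x t v w).
  + by have E := cross_new xm xy xt; subst.
  + by have E := cross_old xm zm xy zy; subst.
  + exact: (oo x y r w).
  + by have E := cross_old ym tm yz tz; subst.
  + by have E := cross_old xm zm xt zt; subst.
  + by rewrite !extend_old // in xy yz zt tx; apply: (nbr_no4 gP xm nxz nyt xy yz zt tx).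
- move=> _ _ /mapP[u ur' ->] /mapP[v vr ->]; rewrite -/(nbr (extend P D) _) extend_new.
  exact: (allP (allP rn u ur') v vr).
Qed.

End Extend.

(** * Closing a chain *)

Definition partner (k : nat) : nat := nth 0 [:: 1; 0; 3; 2] k.
Definition partners (P : pole) : seq nat := [seq nth 0 (out P) (partner k) | k <- iota 0 4].
Definition cnbr (P : pole) (x : nat) : seq nat := nbr P x ++ link (out P) (partners P) x.
Definition edge (P : pole) : rel 'I_(order P) := fun x y => val y \in cnbr P (val x).

(** No path of length 2 or 3 in the pole joins the ends of a closing edge, so no cycle of length 3
    or 4 has exactly one closing edge. *)
Definition far (P : pole) := forall x y z, y \in link (out P) (partners P) x -> z \in nbr P x ->
  y \notin nbr P z /\ forall w, w \in nbr P z -> y \notin nbr P w.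

Lemma partnerP k : k < 4 -> [/\ partner k < 4, partner (partner k) = k & partner k != k].
Proof. by case: k => [|[|[|[|k]]]]. Qed.

Section Closed.
Variable P : pole.
Hypothesis gP : pole_graph P.
Hypothesis sz4 : size (out P) = 4.

Lemma partner_linkP x y : reflect (exists2 k, k < 4 & x = nth 0 (out P) k /\ y = nth 0 (out P) (partner k))
  (y \in link (out P) (partners P) x).
Proof.
apply: (iffP (linkP _ _ _ _)) => [[k ks [<- ->]]|[k ks [-> ->]]]; exists k; rewrite ?sz4 // ?sz4 in ks *;
by split=> //; rewrite (nth_map 0) ?size_iota // nth_iota.
Qed.

Lemma partner_sym x y : y \in link (out P) (partners P) x -> x \in link (out P) (partners P) y.
Proof.
case/partner_linkP => k ks [-> ->]; have [p4 pp _] := partnerP ks.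
by apply/partner_linkP; exists (partner k); rewrite ?pp.
Qed.

Lemma partner_out x y : y \in link (out P) (partners P) x -> (x \in out P) && (y \in out P).
Proof. by case/partner_linkP => k ks [-> ->]; have [p4 _ _] := partnerP ks; rewrite !mem_nth // sz4. Qed.

Lemma partner_fun x y z : y \in link (out P) (partners P) x -> z \in link (out P) (partners P) x -> y = z.
Proof.
case/partner_linkP => k ks [-> ->] /partner_linkP[k' ks' [E ->]].
by move/eqP: E; rewrite nth_uniq ?sz4 ?(out_uniq gP) // => /eqP->.
Qed.

Lemma partner_neq x y : y \in link (out P) (partners P) x -> y != x.
Proof.
case/partner_linkP => k ks [-> ->]; have [p4 _ pk] := partnerP ks.
by rewrite nth_uniq ?sz4 ?(out_uniq gP).
Qed.

Lemma cnbr_lt x y : x < order P -> y \in cnbr P x -> y < order P.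
Proof.
move=> xP; rewrite mem_cat => /orP[|/partner_out/andP[_]]; [exact: (nbr_lt gP) | exact: (out_lt gP)].
Qed.

Lemma cnbr_sym x y : x < order P -> y \in cnbr P x -> x \in cnbr P y.
Proof.
move=> xP; rewrite !mem_cat => /orP[/(nbr_sym gP xP)->//|/partner_sym->]; exact: orbT.
Qed.

Lemma cnbr_irr x : x < order P -> x \notin cnbr P x.
Proof.
move=> xP; rewrite mem_cat negb_or (nbr_irr gP) //=; apply/negP => /partner_neq.
by rewrite eqxx.
Qed.

Lemma cnbr_uniq x : x < order P -> uniq (cnbr P x).
Proof.
move=> xP; rewrite cat_uniq (nbr_uniq gP) // link_uniq ?(out_uniq gP) // andbT.
by apply/hasPn => y /partner_out/andP[xo yo]; apply: (out_nadj gP).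
Qed.

Lemma cnbr_size x : x < order P -> size (cnbr P x) = 3.
Proof. by move=> xP; rewrite size_cat size_link ?(out_uniq gP) // (nbr_size gP). Qed.

Lemma edge_simple : simple_graph (@edge P).
Proof.
split=> [x y|x]; last by apply/negbTE; apply: (cnbr_irr (ltn_ord x)).
by apply/idP/idP => H; apply: (cnbr_sym (ltn_ord _) H).
Qed.

Lemma edge_cubic : cubic (@edge P).
Proof.
move=> x; rewrite -(cnbr_size (ltn_ord x)) cardE -(size_map val).
apply/perm_size/uniq_perm.
- by rewrite (map_inj_uniq val_inj) enum_uniq.
- exact: cnbr_uniq.
move=> y; apply/mapP/idP => [[z] + ->|yc].
  by rewrite mem_enum inE.
by exists (Ordinal (cnbr_lt (ltn_ord x) yc)); rewrite // mem_enum inE.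
Qed.

Hypothesis farP : far P.

Lemma cnbr_no3 x y z : x < order P -> y \in cnbr P x -> z \in cnbr P y -> x \in cnbr P z -> False.
Proof.
move=> xP xy yz zx.
have yP := cnbr_lt xP xy; have zP := cnbr_lt yP yz.
have loop p : p < order P -> p \in cnbr P p -> False by move=> /cnbr_irr/negP.
move: xy yz zx; rewrite /cnbr !mem_cat => /orP[xy|xy] /orP[yz|yz] /orP[zx|zx].
- exact: (nbr_no3 gP xP xy yz zx).
- have [+ _] := farP (partner_sym zx) xy; by rewrite yz.
- have [+ _] := farP (partner_sym yz) zx; by rewrite xy.
- have E := partner_fun (partner_sym yz) zx; subst y.
  by apply: (loop x) => //; rewrite mem_cat xy.
- have [+ _] := farP (partner_sym xy) yz; by rewrite zx.
- have E := partner_fun (partner_sym zx) xy; subst z.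
  by apply: (loop y) => //; rewrite mem_cat yz.
- have E := partner_fun (partner_sym xy) yz; subst z.
  by apply: (loop x) => //; rewrite mem_cat zx.
- have E := partner_fun (partner_sym xy) yz; subst z.
  by apply: (loop x) => //; rewrite mem_cat zx orbT.
Qed.

(** By the position of the closing edges: none is the case of the pole, one contradicts [far], two
    opposite ones make two outputs adjacent, and two consecutive ones are equal because [partner] is
    an involution. *)
Lemma cnbr_no4 x y z w : x < order P -> x <> z -> y <> w -> y \in cnbr P x -> z \in cnbr P y ->
  w \in cnbr P z -> x \in cnbr P w -> False.
Proof.
move=> xP nxz nyw xy yz zw wx.
have yP := cnbr_lt xP xy; have zP := cnbr_lt yP yz; have wP := cnbr_lt zP zw.
have far3 p q r t : q \in link (out P) (partners P) p -> r \in nbr P q -> t \in nbr P r ->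
   p \in nbr P t -> False.
  by move=> pq qr rt; have [_ /(_ t rt)/negP] := farP (partner_sym pq) qr.
have oo p q r t : q \in link (out P) (partners P) p -> r \in nbr P q ->
    t \in link (out P) (partners P) r -> False.
  move=> /partner_out/andP[_ qo] qr /partner_out/andP[ro _].
  by have := out_nadj gP qo ro; rewrite qr.
have pf p q r : q \in link (out P) (partners P) p -> r \in link (out P) (partners P) q -> p = r.
  by move=> pq qr; apply: partner_fun (partner_sym pq) qr.
move: xy yz zw wx; rewrite /cnbr !mem_cat => /orP[xy|xy] /orP[yz|yz] /orP[zw|zw] /orP[wx|wx].
- exact: (nbr_no4 gP xP nxz nyw xy yz zw wx).
- exact: (far3 w x y z).
- exact: (far3 z w x y).
- by case: nxz; rewrite (pf z w x).
- exact: (far3 y z w x).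
- exact: (oo y z w x).
- by case: nyw; rewrite (pf y z w).
- by case: nyw; rewrite (pf y z w).
- exact: (far3 x y z w).
- by case: nyw; rewrite (pf w x y).
- exact: (oo x y z w).
- by case: nyw; rewrite (pf w x y).
- by case: nxz; rewrite (pf x y z).
- by case: nxz; rewrite (pf x y z).
- by case: nxz; rewrite (pf x y z).
- by case: nxz; rewrite (pf x y z).
Qed.

Lemma edge_girth : (exists s, [/\ uniq s, size s = 5, all (fun x => x < order P) s
    & cycle (fun x y => y \in nbr P x) s]) -> girth (@edge P) 5.
Proof.
move=> five; split.
  case: five => s [us s5 /allP sP cs].
  have sE : [seq val x | x <- pmap insub s : seq 'I_(order P)] = s.
    by rewrite pmap_filter; [apply/all_filterP/allP => x /sP xP; rewrite insubT | exact: insubK].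
  exists (pmap insub s); rewrite -(size_map val) sE; split=> //.
  split; first by rewrite -(map_inj_uniq val_inj) sE.
    by rewrite -(size_map val) sE s5.
  have : cycle (fun x y => y \in nbr P x) [seq val x | x <- pmap insub s : seq 'I_(order P)] by rewrite sE.
  rewrite cycle_map; apply: sub_cycle => x y /= xy.
  by rewrite /edge mem_cat xy.
move=> s [us s3 cs]; rewrite leqNgt; apply/negP => s5.
move: us cs; case: s s3 s5 => [|x [|y [|z [|w [|? ?]]]]] //= _ _.
  move=> _ /and4P[xy yz zx _]; exact: (cnbr_no3 (ltn_ord x) xy yz zx).
rewrite !inE !negb_or -!andbA => /and5P[xy' xz _ _ /andP[yw _]] /and5P[xy yz zw wx _].
apply: (cnbr_no4 (ltn_ord x) _ _ xy yz zw wx) => /val_inj/eqP; exact/negP.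
Qed.

End Closed.

(** * A Hamiltonian cycle as a connected 2-regular relation *)

Section HamCycle.
Variables (T : finType) (s : seq T).
Hypothesis us : uniq s.
Hypothesis s3 : 3 <= size s.
Hypothesis sT : forall x, x \in s.

Definition cycle_rel : rel T := fun x y => (y == next s x) || (y == prev s x).

Lemma cycle_rel_sym : symmetric cycle_rel.
Proof.
move=> x y; rewrite /cycle_rel; apply/orP/orP => [] [] /eqP->.
- by right; rewrite prev_next.
- by left; rewrite next_prev.
- by right; rewrite prev_next.
- by left; rewrite next_prev.
Qed.

(** Otherwise [next s] has an orbit of at most two points, while its only orbit is [s], of size at
    least 3. *)
Lemma next_neq_prev x : next s x != prev s x.
Proof.
apply/eqP => E; have fc : fcycle (next s) s := cycle_next us.
have n2 : next s (next s x) = x by rewrite E next_prev.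
have sz l : fcycle (next s) l -> uniq l -> x \in l -> 2 < size l.
  by move=> fl ul xl; rewrite -(order_cycle fl ul xl) (order_cycle fc us (sT x)).
have nx : x != next s x.
  apply/eqP => E1; have := sz [:: x]; rewrite /= -E1 eqxx inE eqxx.
  by move=> /(_ isT isT isT).
by have := sz [:: x; next s x]; rewrite /= n2 !eqxx !inE eqxx nx => /(_ isT isT isT).
Qed.

Lemma cycle_rel_deg x l : uniq l -> (forall y, cycle_rel x y -> y \in l) -> count (cycle_rel x) l = 2.
Proof.
move=> ul H; have h1 : next s x \in l by apply: H; rewrite /cycle_rel eqxx.
have h2 : prev s x \in l by apply: H; rewrite /cycle_rel eqxx orbT.
have I0 : count (predI (pred1 (next s x)) (pred1 (prev s x))) l = 0.
  apply/eqP; rewrite -leqn0 leqNgt -has_count; apply/hasPn => y _ /=.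
  by apply/negP => /andP[/eqP->]; apply/negP/next_neq_prev.
have := count_predUI (pred1 (next s x)) (pred1 (prev s x)) l.
rewrite I0 addn0 !(count_uniq_mem _ ul) h1 h2 => E.
by rewrite -[RHS]/(true + true) -E; apply: eq_count.
Qed.

Lemma cycle_rel_conn (W : {set T}) : W != set0 ->
  (forall x y, x \in W -> cycle_rel x y -> y \in W) -> W = setT.
Proof.
case/set0Pn => x xW clo; apply/setP => y; rewrite [RHS]inE.
have : fconnect (next s) x y by rewrite (fconnect_cycle (cycle_next us) (sT x)).
move/iter_findex <-; elim: findex => //= n IH.
by apply: clo IH _; rewrite /cycle_rel eqxx.
Qed.

End HamCycle.

Definition nonham_pole (P : pole) := forall (T : finType) (F : rel T), symmetric F ->
  (forall x l, uniq l -> (forall y, F x y -> y \in l) -> count (F x) l = 2) ->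
  (forall W : {set T}, W != set0 -> (forall x y, x \in W -> F x y -> y \in W) -> W = setT) ->
  forall (h : nat -> T) B, {in [pred x | x < B] &, injective h} -> forall l, hosted F h B P l ->
  exists2 st, st \in full_states & realizes F h P l st.

Lemma nonham_extend P D : pole_graph P -> piece_ok D -> program_ok D -> closed_from D full_states ->
  size (out P) = size (lft D) -> nonham_pole P -> nonham_pole (extend P D).
Proof.
move=> gP ok pok clo szo nP T F Fs Fd Fc h B hI l hl.
apply: (realizes_extend Fs Fd Fc hI ok pok clo szo _ hl); first by apply/allP => x; apply: out_lt.
by apply: (nP T F Fs Fd Fc h B hI); apply: hosted_extend hl.
Qed.

(** The empty prefix, so that the first piece is added like any other. *)
Definition void_pole : pole := Pole 0 (fun=> [::]) [::].

Lemma nonham_void D : piece_ok D -> program_ok D -> closed_from D [:: [::]] -> size (lft D) = 0 ->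
  nonham_pole (extend void_pole D).
Proof.
move=> ok pok clo szl T F Fs Fd Fc h B hI l hl.
apply: (realizes_extend Fs Fd Fc hI ok pok clo _ _ hl) => //.
by exists [::].
Qed.

(** The closed graph is its own host, with [partners] as outer ends. Both halves of a closing edge
    are used or neither is, which excludes the pairings with one path. In the remaining one, the
    edge from 0 to 1 leads back into the first path, whose vertex set is then the whole host,
    although half-edge 2 is used as well. *)
Lemma edge_nonham P : pole_graph P -> size (out P) = 4 -> nonham_pole P -> ~ hamiltonian (@edge P).
Proof.
move=> gP sz4 nP [s [[us s3 cs] sT]].
have {}sT x : x \in s by rewrite sT inE.
pose T := 'I_(order P); pose F : rel T := cycle_rel s.
have [x0 _] : exists x0 : T, x0 \in s.
  by move: s3; case: (s) => [|x l] // _; exists x; rewrite mem_head.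
pose h (x : nat) : T := insubd x0 x.
have hK x : x < order P -> val (h x) = x by move=> xP; rewrite val_insubd xP.
have hI : {in [pred x | x < order P] &, injective h}.
  by move=> x y; rewrite !inE => xP yP /(congr1 val); rewrite !hK.
have hv (t : T) : h (val t) = t := val_inj (hK _ (ltn_ord t)).
have Fe x y : F x y -> edge x y.
  case/orP => /eqP->; first exact: next_cycle cs (sT x).
  by have [sym _] := edge_simple gP sz4; rewrite sym; apply: prev_cycle cs (sT x).
have Fs := cycle_rel_sym us.
have Fc := cycle_rel_conn us sT.
have [] := nP T F Fs (cycle_rel_deg us s3 sT) Fc h (order P) hI (partners P).
  split=> // x xP; split.
    rewrite map_inj_in_uniq; first exact: cnbr_uniq.
    by move=> y z yc zc; apply: hI; rewrite inE; apply: (cnbr_lt gP sz4 xP).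
  move=> t /Fe; rewrite /edge hK // => tc; apply/mapP; exists (val t) => //.
rewrite /realizes sz4.
set src := (fun e => h (nth 0 (out P) (N.to_nat e))); set tgt := (fun e => _).
move=> st stf [ust mst lst].
(* The source of half-edge [k] is the target of half-edge [partner k], and [F] is symmetric. *)
have sw k : k < 4 -> F (src (N.of_nat k)) (tgt (N.of_nat k)) =
    F (src (N.of_nat (partner k))) (tgt (N.of_nat (partner k))).
  move=> k4; have [p4 pp _] := partnerP k4; rewrite /src /tgt !Nat2N.id /partners !(nth_map 0) ?size_iota //.
  by rewrite !nth_iota // !add0n pp; apply: Fs.
have mk k : k < 4 -> (N.of_nat k \in flat st) = (N.of_nat (partner k) \in flat st).
  move=> k4; have [p4 _ _] := partnerP k4; rewrite !mst sw //; congr (_ && _).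
  by rewrite !map_f // mem_iota.
have m0 := mk 0 isT; have m2 := mk 2 isT.
move: stf; rewrite !inE => /or4P[||| /orP[]] /eqP E; rewrite E // in m0 m2 *.
have /lst[W [_ /andP[/= s0 s1] bd ot]] : (0, 1)%num \in st by rewrite E.
have WT : W = setT.
  apply: Fc => [|x y xW xy]; first by apply/set0Pn; exists (src 0%num).
  case: (boolP (y \in W)) => // yW; case: (bd x y xW yW xy) => e; rewrite !inE => /orP[]/eqP-> [_ yE];
  by case/negP: yW; rewrite yE; (exact: s1 || exact: s0).
have : 2%num \in flat st by rewrite E.
rewrite mst => /andP[f2 u2]; have := ot 2%num f2 u2; rewrite WT inE => /(_ isT).
by rewrite !inE.
Qed.

(** * Path covers *)

Definition config := seq (nat * nat).

Definition is_path (P : pole) (x y : nat) (p : seq nat) : bool :=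
  if p is a :: q then [&& a == x, last a q == y & path (fun u v => v \in nbr P u) a q] else false.

Definition covered (P : pole) (c : config) (A : pred nat) :=
  exists ps : seq (seq nat),
    [/\ all2 (fun ij p => is_path P (nth 0 (out P) ij.1) (nth 0 (out P) ij.2) p) c ps,
        uniq (flatten ps) & forall x, (x \in flatten ps) = (x < order P) && A x].

(** [Jump i j] stands for a whole path of the older prefix, entered at output [i] and left at output
    [j]. *)
Inductive token := Vtx of nat | Jump of nat & nat.

Definition vtx_of t := if t is Vtx u then [:: u] else [::].
(** Puts the smaller label first, so that a path traversed backwards counts as the same pair. *)
Definition jump_of t := if t is Jump i j then [:: if i <= j then (i, j) else (j, i)] else [::].

Definition joined (D : piece) (t t' : token) : bool :=
  match t, t' with
  | Vtx u, Vtx w => w \in nth [::] (adj D) u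
  | Vtx u, Jump i _ => (i < size (lft D)) && (nth 0 (lft D) i == u)
  | Jump _ j, Vtx w => (j < size (lft D)) && (nth 0 (lft D) j == w)
  | Jump _ _, Jump _ _ => false
  end.

Definition at_end (D : piece) (i : nat) (t : token) : bool :=
  if t is Vtx u then (u == nth 0 (rgt D) i) && (i < size (rgt D)) else false.

(** Each path of the old cover is used exactly once, and so is each vertex outside [del]: comparing
    the sorted list with an increasing one also excludes repetitions. *)
Definition template_ok (D : piece) (c c' : config) (del : seq nat) (ts : seq (seq token)) : bool :=
  [&& all2 (fun ij t => if t is a :: s then
        [&& at_end D ij.1 a, at_end D ij.2 (last a s) & path (joined D) a s] else false) c' ts,
      uniq c, perm_eq (flatten [seq jump_of t | t <- flatten ts]) c
    & sort leq (flatten [seq vtx_of t | t <- flatten ts]) == [seq u <- iota 0 (psize D) | u \notin del]].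

Lemma all_flatten (A : Type) (p : pred A) ss : all p (flatten ss) = all (all p) ss.
Proof. by elim: ss => //= s ss IH; rewrite all_cat IH. Qed.

(** * Gluing path covers along templates *)

Section Template.
Variables (P : pole) (D : piece) (c : config) (A : pred nat).
Hypothesis gP : pole_graph P.
Hypothesis szo : size (out P) = size (lft D).
Hypothesis cov : covered P c A.
Let m := order P.

(** Tokens are expanded to vertex lists: a jump becomes the old path of its pair, reversed when it
    runs from the larger to the smaller label. *)
Lemma covered_template c' del ts : template_ok D c c' del ts ->
  covered (extend P D) c' (fun x => if x < m then A x else x - m \notin del).
Proof.
case/and4P => okc uc pj /eqP sv; case: cov => ps [okps ups mps].
pose pathof ij := nth [::] ps (index ij c).
pose expand t := match t with Vtx u => [:: m + u]
  | Jump i j => if i <= j then pathof (i, j) else rev (pathof (j, i)) end.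
have szps : size c = size ps by move: okps; rewrite all2E => /andP[/eqP].
have pathP i j : (i, j) \in c -> is_path P (nth 0 (out P) i) (nth 0 (out P) j) (pathof (i, j)).
  move=> ijc; move: okps; rewrite all2E szps eqxx /= => /allP H.
  have := H ((i, j), pathof (i, j)) => /=; apply.
  have -> : ((i, j), pathof (i, j)) = nth ((0, 0), [::]) (zip c ps) (index (i, j) c).
    by rewrite nth_zip // nth_index.
  by apply: mem_nth; rewrite size_zip -szps minnn index_mem.
have subm p : p \in ps -> forall x, x \in p -> x < m.
  move=> pp x xp; have : x \in flatten ps by apply/flattenP; exists p.
  by rewrite mps => /andP[].
pose E := fun u v => v \in nbr (extend P D) u.
have liftP a q : (forall x, x \in a :: q -> x < m) ->
    path (fun u v => v \in nbr P u) a q -> path E a q.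
  elim: q a => [|b q IH] a //= lt /andP[ab bq].
  have am : a < m by apply: lt; rewrite mem_head.
  have bm : b < m by apply: lt; rewrite !inE eqxx orbT.
  rewrite /E extend_old // ab /=; apply: IH => // x xq; apply: lt; by rewrite inE xq orbT.
have revP a q : (forall x, x \in a :: q -> x < m) -> path E a q ->
    path E (last a q) (rev (belast a q)).
  move=> lt pq; rewrite rev_path; move: lt pq.
  elim: q a => [|b q IH] a //= lt /andP[ab bq].
  have am : a < m by apply: lt; rewrite mem_head.
  have bm : b < m by apply: lt; rewrite !inE eqxx orbT.
  rewrite IH //; last by move=> x xq; apply: lt; rewrite inE xq orbT.
  rewrite andbT /E; move: ab; rewrite /E !extend_old //; exact: nbr_sym.
pose entry t := match t with Vtx u => m + u | Jump i _ => nth 0 (out P) i end.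
pose exit t := match t with Vtx u => m + u | Jump _ j => nth 0 (out P) j end.
pose good t := all (mem c) (jump_of t).
have goodts : all good (flatten ts).
  have : all (mem c) (flatten [seq jump_of t | t <- flatten ts]) by apply/allP => q; rewrite (perm_mem pj).
  by rewrite (all_flatten (mem c)) all_map.
have expP t : good t -> exists2 a, exists2 q, expand t = a :: q & path E a q /\ last a q = exit t & a = entry t.
  case: t => [u|i j] /=; first by move=> _; exists (m + u) => //; exists [::].
  rewrite /good /= andbT; case: (leqP i j) => ij ijc; have := pathP _ _ ijc.
    have : forall x, x \in pathof (i, j) -> x < m by apply/subm/mem_nth; rewrite -szps index_mem.
    case: (pathof (i, j)) => [|a q] //= lt /and3P[/eqP aE /eqP lE pq].
    by exists a => //; exists q => //; split=> //; apply: liftP.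
  have : forall x, x \in pathof (j, i) -> x < m by apply/subm/mem_nth; rewrite -szps index_mem.
  case: (pathof (j, i)) => [|a q] //= lt /and3P[/eqP aE /eqP lE pq].
  exists (last a q) => //; exists (rev (belast a q)); first by rewrite lastI rev_rcons.
  split; first by apply: revP => //; apply: liftP.
  have : last 0 (rev (a :: q)) = a by rewrite rev_cons last_rcons.
  by rewrite lastI rev_rcons /= => ->.
have joinP t t' : joined D t t' -> E (exit t) (entry t').
  case: t t' => [u|i j] [w|i' j'] //=; rewrite /E.
  - by rewrite (extend_new gP szo).
  - case/andP => il /eqP <-; have im := nth_out_lt gP szo il.
    by rewrite (extend_down gP szo) //; apply/(extend_up gP szo _ im); exists i'.
  - case/andP => jl /eqP <-; have jm := nth_out_lt gP szo jl.
    by apply/(extend_up gP szo _ jm); exists j.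
have catP a s : all good (a :: s) -> path (joined D) a s ->
    exists2 b, exists2 r, flatten [seq expand t | t <- a :: s] = b :: r
      & path E b r /\ last b r = exit (last a s) & b = entry a.
  elim: s a => [|a' s IH] a /=.
    rewrite andbT => /expP[b [q eq pq] be] _; exists b => //; exists q => //.
    by rewrite eq cats0.
  case/andP => /expP[b [q eq [pq lq]] be] ga /andP[aa' as'].
  have [b' [r fr [pr lr]] be'] := IH a' ga as'.
  exists b => //; exists (q ++ b' :: r); first by rewrite -fr eq.
  by rewrite cat_path last_cat /= pq lq pr lr be' joinP.
pose ps' := [seq flatten [seq expand t | t <- s] | s <- ts].
have flE : flatten ps' = flatten [seq expand t | t <- flatten ts].
  by rewrite /ps'; elim: (ts) => //= s l ->; rewrite map_cat flatten_cat.
(* Disjointness and coverage reduce to this permutation: the expanded lists consist of the shifted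
   vertex tokens and the old paths. *)
have permE l : all good l -> perm_eq (flatten [seq expand t | t <- l])
    ([seq m + u | u <- flatten [seq vtx_of t | t <- l]] ++
     flatten [seq pathof q | q <- flatten [seq jump_of t | t <- l]]).
  elim: l => [|[u|i j] l IH] //=; first by move=> gl; rewrite perm_cons IH.
  case/andP => gt gl.
  rewrite perm_sym perm_catCA; apply: perm_cat; last by rewrite perm_sym IH.
  by case: ifP => _ //; rewrite perm_sym perm_rev.
have mapc : [seq pathof q | q <- c] = ps.
  apply: (@eq_from_nth _ [::]); first by rewrite size_map.
  move=> k; rewrite size_map => kc; rewrite (nth_map (0, 0)) // /pathof index_uniq //.
set vs := flatten [seq vtx_of t | t <- flatten ts] in sv.
have pvs : perm_eq vs [seq u <- iota 0 (psize D) | u \notin del].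
  by rewrite -sv perm_sym perm_sort.
have pall : perm_eq (flatten ps') ([seq m + u | u <- vs] ++ flatten ps).
  rewrite flE; apply: (perm_trans (permE _ goodts)); rewrite perm_cat2l -mapc.
  exact/perm_flatten/perm_map.
exists ps'; split.
- rewrite /ps'; move: goodts okc; rewrite all_flatten.
  elim: (ts) c' => [|t ts' IH] [|ij c''] //= /andP[gt gts] /andP[ok oks].
  rewrite IH // andbT; case: t ok gt => [|a s] // /and3P[ea el pas] gt.
  have [b [r -> [pr lr]] be] := catP a s gt pas; rewrite /= pr lr be andbT.
  move: ea el; case: (a) (last a s) => [u|? ?] [w|? ?] //=.
  by move=> /andP[/eqP-> i1] /andP[/eqP-> i2]; rewrite !(nth_map 0) // !eqxx.
- rewrite (perm_uniq pall) cat_uniq ups andbT map_inj_uniq; last exact: addnI.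
  rewrite (perm_uniq pvs) filter_uniq ?iota_uniq //=; apply/hasPn => x xps.
  apply/mapP => [[u _ xu]]; move: xps; rewrite mps xu.
  by rewrite -/m ltnNge leq_addr.
move=> x; rewrite (perm_mem pall) mem_cat mps /= -/m; case: ltnP => xm /=.
  rewrite ltn_addr //=; suff -> : (x \in [seq m + u | u <- vs]) = false by [].
  by apply/mapP => [[u _ xu]]; rewrite xu ltnNge leq_addr in xm.
rewrite orbF -{1 2}(subnKC xm) mem_map; last exact: addnI.
by rewrite (perm_mem pvs) mem_filter mem_iota add0n /= andbC ltn_add2l.
Qed.

End Template.

(* Each bit selects one of the two ways out of a vertex; the result is checked by [template_ok]. *)
Fixpoint walk (D : piece) (C : seq (seq nat)) (mate : nat -> nat) (bs : seq bool) (u prev : nat) :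
    seq token * seq bool :=
  if bs is b :: bs' then
    let w := nth 0 [seq w <- nth [::] C u | w != prev] b in
    if psize D + 4 <= w then ([:: Vtx u], bs')
    else if w < 4 then
      let r := walk D C mate bs' (nth 0 (lft D) (mate w)) (mate w) in
      (Vtx u :: Jump w (mate w) :: r.1, r.2)
    else let r := walk D C mate bs' (w - 4) (4 + u) in (Vtx u :: r.1, r.2)
  else ([::], [::]).

Fixpoint walks (D : piece) (C : seq (seq nat)) (mate : nat -> nat) (c' : config) (bs : seq bool) :
    seq (seq token) :=
  if c' is ij :: c'' then
    let r := walk D C mate bs (nth 0 (rgt D) ij.1) (psize D + 4 + ij.1) in
    r.1 :: walks D C mate c'' r.2
  else [::].

(** Digits from the lowest up; the leading one only marks the end of the string, so that final zeros
    are kept. *)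
Fixpoint bits (p : positive) : seq bool :=
  match p with xI q => true :: bits q | xO q => false :: bits q | xH => [::] end.

Definition mate_of (c : config) (k : nat) : nat :=
  foldr (fun ij r => if ij.1 == k then ij.2 else if ij.2 == k then ij.1 else r) 0 c.

Definition walk_ok (D : piece) (C : seq (seq nat)) (c c' : config) (del : seq nat) (p : positive) : bool :=
  template_ok D c c' del (walks D C (mate_of c) c' (bits p)).

Definition code_table (D : piece) := [seq codes D u | u <- iota 0 (psize D)].

Definition cover_configs : seq config := [:: [:: (0, 3)]; [:: (1, 2)]; [:: (0, 1); (2, 3)]].
Definition closing_configs : seq config := [:: [:: (0, 1)]; [:: (2, 3)]].

(** First components index [route_src], the configurations available on the older prefix; the second
    component in [route_del] selects a closing configuration. [route_thru] carries a cover that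
    misses an older vertex across the piece. *)
Record routes := Routes {
  route_src : seq config;
  route_full : seq (nat * positive);
  route_del : seq (nat * nat * positive);
  route_thru : seq positive }.

Definition routes_ok (D : piece) (r : routes) : bool :=
  let C := code_table D in
  [&& all2 (fun c' ip => (ip.1 < size (route_src r)) &&
        walk_ok D C (nth [::] (route_src r) ip.1) c' [::] ip.2) cover_configs (route_full r),
      all2 (fun u ijp => [&& ijp.1.1 < size (route_src r), ijp.1.2 < 2 &
        walk_ok D C (nth [::] (route_src r) ijp.1.1) (nth [::] closing_configs ijp.1.2) [:: u] ijp.2])
        (iota 0 (psize D)) (route_del r)
    & nilp (lft D) || all2 (fun c p => walk_ok D C c c [::] p) closing_configs (route_thru r)].

Definition hypo_pole (P : pole) :=
  (forall c, c \in cover_configs -> covered P c predT) /\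
  (forall v, v < order P -> exists2 c, c \in closing_configs & covered P c (predC1 v)).

Lemma covered_ext P c A B : (forall x, x < order P -> A x = B x) -> covered P c A -> covered P c B.
Proof.
move=> AB [ps [h1 h2 h3]]; exists ps; split=> // x; rewrite h3.
by case: ltnP => //= /AB.
Qed.

(** Forgets the list of witnesses in a check by [all2] and keeps, for each entry of [s], what its
    witness proves. *)
Lemma all2_ex (A B : Type) (p : A -> B -> bool) (Q : A -> Prop) s t :
  all2 p s t -> (forall x y, p x y -> Q x) -> foldr (fun x R => Q x /\ R) True s.
Proof. by elim: s t => [|x s IH] [|y t] //= /andP[xy /IH H] K; split; [exact: K xy | exact: H]. Qed.

Lemma foldr_allP (A : eqType) (Q : A -> Prop) s : foldr (fun x R => Q x /\ R) True s ->
  forall x, x \in s -> Q x.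
Proof. by elim: s => //= a s IH [qa /IH H] x; rewrite inE => /predU1P[->|/H]. Qed.

Lemma hypo_extend P D r : pole_graph P -> size (out P) = size (lft D) -> routes_ok D r ->
  (forall c, c \in route_src r -> covered P c predT) ->
  (forall v, v < order P -> ~~ nilp (lft D) /\ exists2 c, c \in closing_configs & covered P c (predC1 v)) ->
  hypo_pole (extend P D).
Proof.
move=> gP szo /and3P[okf okd okt] cs cv; split.
  apply: foldr_allP; apply: (all2_ex okf) => c [i p] /andP[/= iS ok].
  have := covered_template gP szo (cs _ (mem_nth [::] iS)) ok.
  by apply: covered_ext => x _; case: ifP.
move=> v; case: (ltnP v (order P)) => [vP _|vP vn].
  (* An old vertex is deleted: its cover crosses the new piece and keeps its type. *)
  case: (cv v vP) => nl [c cc covc]; exists c => //; move: okt; rewrite (negbTE nl) orFb => okt.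
  pose Q c := covered P c (predC1 v) -> covered (extend P D) c (predC1 v).
  have HQ : forall c, c \in closing_configs -> Q c.
    apply: foldr_allP; apply: (all2_ex okt) => c0 p ok cov0.
    have := covered_template gP szo cov0 ok.
    apply: covered_ext => x _; case: ltnP => //= xP.
    by apply/esym/eqP => xv; rewrite -xv ltnNge xP in vP.
  exact: HQ.
(* A vertex of the new piece is deleted: a full cover of the older prefix is used. *)
have un : v - order P \in iota 0 (psize D) by rewrite mem_iota /=; move: vn => /=; lia.
move: un; move: (v - order P) (subnKC vP) => u vu un.
suff : forall u, u \in iota 0 (psize D) ->
    exists2 c, c \in closing_configs & covered (extend P D) c (predC1 (order P + u)).
  by move=> /(_ u un); rewrite vu.
apply: foldr_allP; apply: (all2_ex okd) => u0 [[i j] p] /and3P[/= iS j2 ok].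
exists (nth [::] closing_configs j); first exact: mem_nth.
have := covered_template gP szo (cs _ (mem_nth [::] iS)) ok.
apply: covered_ext => x _; rewrite inE /=; case: ltnP => xP.
  by apply/esym/eqP => xu; rewrite xu ltnNge leq_addr in xP.
congr (~~ _); rewrite ?inE; apply/eqP/eqP; lia.
Qed.

Lemma edge_hypo P : pole_graph P -> size (out P) = 4 -> 5 <= order P -> hypo_pole P ->
  forall v, hamiltonian_on (@edge P) [set~ v].
Proof.
move=> gP sz4 o5 [_ H] v; have [c cc [ps [okp ups mps]]] := H v (ltn_ord v).
have [k [k4 [p pE [pk up mp]]]] : exists k, k < 4 /\ exists2 p, ps = [:: p] &
    [/\ is_path P (nth 0 (out P) k) (nth 0 (out P) (partner k)) p, uniq p
      & forall x, (x \in p) = (x < order P) && (x != v)].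
  move: cc; rewrite !inE => /orP[]/eqP cE; move: okp; rewrite cE; [exists 0|exists 2]; split=> //;
  case: ps ups mps okp => [|p [|? ?]] //= ups mps; rewrite ?andbT ?andbF // => ok;
  by exists p => //; split=> //; [move: ups|move=> x; have := mps x]; rewrite cats0.
case: p pE pk up mp => [|a q] // pE /= /and3P[/eqP aE /eqP lE pq] up mp.
have lt x : x \in a :: q -> x < order P by rewrite mp => /andP[].
have sE : [seq val x | x <- pmap insub (a :: q) : seq 'I_(order P)] = a :: q.
  rewrite pmap_filter; [apply/all_filterP/allP => x /lt xP; by rewrite insubT | exact: insubK].
exists (pmap insub (a :: q)); split; last first.
  by move=> x; rewrite -(mem_map val_inj) sE mp ltn_ord !inE.
split.
- by rewrite -(map_inj_uniq val_inj) sE.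
(* At least three of the vertices 0, 1, 2, 3 survive the deletion of [v], so the cycle is long
   enough. *)
- rewrite -(size_map val) sE; apply: leq_trans (_ : size [seq x <- iota 0 4 | x != v :> nat] <= _).
    by case: (val v) => [|[|[|[|?]]]].
  apply: uniq_leq_size; first by rewrite filter_uniq ?iota_uniq.
  by move=> x; rewrite mem_filter mem_iota mp => /andP[-> /=]; lia.
have : cycle (fun x y => y \in cnbr P x) [seq val x | x <- pmap insub (a :: q) : seq 'I_(order P)].
  rewrite sE /= rcons_path (sub_path _ pq); last by move=> x y xy; rewrite mem_cat xy.
  rewrite lE mem_cat; apply/orP; right; apply: partner_sym => //.
  by apply/(partner_linkP sz4); exists k.
by rewrite cycle_map.
Qed.

(** * Straight-line drawings *)

Definition lerp (t : R) (a b : R * R) : R * R :=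
  ((1 - t) * a.1 + t * b.1, (1 - t) * a.2 + t * b.2)%R.

Section StraightLine.
Import all_order all_algebra all_classical all_reals all_analysis Rstruct Rstruct_topology.
Import GRing.Theory Num.Theory numFieldNormedType.Exports.
Local Open Scope ring_scope.
Local Open Scope classical_set_scope.
Local Notation RR := Rdefinitions.R.

Lemma affine_continuous (K : realType) (c d : K) : continuous (fun t : K => (1 - t) * c + t * d).
Proof.
move=> t; apply: (@cvgD K K^o); apply: cvgM; try exact: cvg_cst; try exact: cvg_id.
by apply: (@cvgB K K^o); [exact: cvg_cst | exact: cvg_id].
Qed.

Lemma lerp_continuous (a b : RR * RR) :
  {within `[0, 1], continuous (fun t : RR => ((1 - t) * a.1 + t * b.1, (1 - t) * a.2 + t * b.2))}.
Proof.
apply: continuous_subspaceT => t.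
exact: (cvg_pair (@affine_continuous RR a.1 b.1 t) (@affine_continuous RR a.2 b.2 t)).
Qed.

Lemma open_unit_interval (t : RR) : 0 < t < 1 -> (Rlt R0 t /\ Rlt t R1)%type.
Proof. by case/andP => /RltP h1 /RltP h2; split; [exact: h1 | exact: h2]. Qed.

End StraightLine.

Lemma straight_line_planar (T : finType) (e : rel T) (p : T -> R * R) :
  irreflexive e -> injective p ->
  (forall x y z t, e x y -> (0 < t < 1)%R -> lerp t (p x) (p y) <> p z) ->
  (forall x y u v t s, e x y -> e u v -> (0 < t < 1)%R -> (0 < s < 1)%R ->
     lerp t (p x) (p y) = lerp s (p u) (p v) -> (u = x /\ v = y) \/ (u = y /\ v = x)) ->
  planar e.
Proof.
move=> irr pI vtx edg.
have lt01 := open_unit_interval.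
exists p, (fun x y t => lerp t (p x) (p y)); split=> //; split; last split.
- move=> x y xy; split.
  + by rewrite [RHS]surjective_pairing; congr pair; apply: (_ : (1 - 0) * _ + 0 * _ = _)%R; ring.
  + by rewrite [RHS]surjective_pairing; congr pair; apply: (_ : (1 - 1) * _ + 1 * _ = _)%R; ring.
  + exact: lerp_continuous.
  (* The end points differ in some coordinate, and that coordinate determines the parameter. *)
  + move=> t s _ _ [E1 E2]; apply: Rminus_diag_uniq.
    have nxy : x <> y by move=> E; rewrite E irr in xy.
    have F1 : ((t - s) * ((p y).1 - (p x).1) = 0)%R.
      have -> : ((t - s) * ((p y).1 - (p x).1) = ((1 - t) * (p x).1 + t * (p y).1) -
        ((1 - s) * (p x).1 + s * (p y).1))%R by ring.
      by rewrite E1; ring.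
    have F2 : ((t - s) * ((p y).2 - (p x).2) = 0)%R.
      have -> : ((t - s) * ((p y).2 - (p x).2) = ((1 - t) * (p x).2 + t * (p y).2) -
        ((1 - s) * (p x).2 + s * (p y).2))%R by ring.
      by rewrite E2; ring.
    case: (Rmult_integral _ _ F1) => // G1; case: (Rmult_integral _ _ F2) => // G2.
    by case: nxy; apply: pI; rewrite [LHS]surjective_pairing [RHS]surjective_pairing;
      congr pair; apply/esym/Rminus_diag_uniq.
  + move=> t _; rewrite /lerp; congr pair;
    by apply: (_ : (1 - t) * _ + t * _ = (1 - (1 - t)) * _ + (1 - t) * _)%R; ring.
- by move=> x y z t xy /lt01 t01; apply: vtx.
- by move=> x y u v t s xy uv /lt01 t01 /lt01 s01; apply: edg.
Qed.

(** * Orientation of point triples and disjoint open segments *)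

Definition det (a b p : R * R) : R :=
  ((b.1 - a.1) * (p.2 - a.2) - (b.2 - a.2) * (p.1 - a.1))%R.
Definition orient (a b p : Z * Z) : Z :=
  ((b.1 - a.1) * (p.2 - a.2) - (b.2 - a.2) * (p.1 - a.1))%Z.
Definition real_pt (p : Z * Z) : R * R := (IZR p.1, IZR p.2).

Lemma det_orient a b p : det (real_pt a) (real_pt b) (real_pt p) = IZR (orient a b p).
Proof. by rewrite /det /orient /= !minus_IZR !mult_IZR !minus_IZR. Qed.

(** The signed double area is affine in its last point, so its values at two ends locate a whole
    segment relative to the line through [a] and [b]. *)
Lemma det_lerp a b t p q : det a b (lerp t p q) = ((1 - t) * det a b p + t * det a b q)%R.
Proof. rewrite /det /lerp /=; ring. Qed.

Lemma det_left a b : det a b a = 0%R. Proof. rewrite /det; ring. Qed.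
Lemma det_right a b : det a b b = 0%R. Proof. rewrite /det; ring. Qed.

Lemma lerpC t a b : lerp t a b = lerp (1 - t) b a.
Proof. by rewrite /lerp; congr pair; ring. Qed.

Lemma lerp_end t a b : (0 < t < 1)%R -> lerp t a b = a -> a = b.
Proof.
case: a b => [a1 a2] [b1 b2] t01 [/= E1 E2]; congr pair; apply: (Rmult_eq_reg_l t); lra.
Qed.

(** One end may lie on the line, as happens for edges with a common vertex; the open segment is
    still strictly on one side. *)
Definition same_side (a b c d : Z * Z) : bool :=
  let s := orient a b c in let t := orient a b d in
  [&& Z.leb 0 s, Z.leb 0 t & Z.ltb 0 (s + t)] || [&& Z.leb s 0, Z.leb t 0 & Z.ltb (s + t) 0].

(** If the four points are not all on one line and both tests fail, each segment has its ends
    strictly on either side of the other's line, and the segments cross. *)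
Definition separated (a b c d : Z * Z) : bool := same_side a b c d || same_side c d a b.

Definition open_disjoint (a b c d : R * R) :=
  forall t s, (0 < t < 1)%R -> (0 < s < 1)%R -> lerp t a b <> lerp s c d.

Lemma lerp_pos C D s : (0 <= C)%R -> (0 <= D)%R -> (0 < C + D)%R -> (0 < s < 1)%R ->
  (0 < (1 - s) * C + s * D)%R.
Proof.
move=> c0 d0 cd s01.
have c1 : (0 <= (1 - s) * C)%R by apply: Rmult_le_pos; lra.
have d1 : (0 <= s * D)%R by apply: Rmult_le_pos; lra.
case: (Rlt_dec 0 C) => h.
  by have : (0 < (1 - s) * C)%R by [apply: Rmult_lt_0_compat; lra]; lra.
by have : (0 < s * D)%R by [apply: Rmult_lt_0_compat; lra]; lra.
Qed.

Lemma lerp_nonneg C D s : (0 <= C)%R -> (0 <= D)%R -> (0 < s < 1)%R -> (0 <= (1 - s) * C + s * D)%R.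
Proof.
move=> c0 d0 s01.
have c1 : (0 <= (1 - s) * C)%R by apply: Rmult_le_pos; lra.
have d1 : (0 <= s * D)%R by apply: Rmult_le_pos; lra.
lra.
Qed.

Lemma same_side_disjoint a b c d : same_side a b c d ->
  open_disjoint (real_pt a) (real_pt b) (real_pt c) (real_pt d).
Proof.
move=> ss t s t01 s01 /(congr1 (det (real_pt a) (real_pt b))).
rewrite !det_lerp det_left det_right !det_orient.
case/orP: ss => /and3P[/Z.leb_le/IZR_le h1 /Z.leb_le/IZR_le h2 /Z.ltb_lt/IZR_lt]; rewrite plus_IZR => h3.
  by have := lerp_pos h1 h2 h3 s01; lra.
move: h1 h2 h3; set C := IZR (orient a b c); set D := IZR (orient a b d) => h1 h2 h3.
have : (0 < (1 - s) * (- C) + s * (- D))%R by apply: lerp_pos => //; lra.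
lra.
Qed.

Lemma separated_disjoint a b c d : separated a b c d ->
  open_disjoint (real_pt a) (real_pt b) (real_pt c) (real_pt d).
Proof.
case/orP => /same_side_disjoint H t s t01 s01; first exact: H.
by move=> /esym; apply: H.
Qed.

(* The last two candidates test the segment's own supporting line. *)
Definition misses_hole (hs : seq (Z * Z)) (u v : Z * Z) : bool :=
  let h k := nth (Z0, Z0) hs k in
  has (fun ab => let f p := orient ab.1 ab.2 p in
    [&& all (fun p => Z.leb (f p) 0) hs, Z.leb 0 (f u), Z.leb 0 (f v) & Z.ltb 0 (f u + f v)] ||
    [&& all (fun p => Z.ltb (f p) 0) hs, Z.leb 0 (f u) & Z.leb 0 (f v)])
  [:: (h 0, h 1); (h 1, h 0); (h 1, h 2); (h 2, h 1); (h 2, h 3); (h 3, h 2); (h 3, h 0); (h 0, h 3);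
      (u, v); (v, u)].

(** * The square and its affine image in a hole *)

Definition side : R := IZR 24000.
(** Corners 0 and 1 bound the lower side, 2 and 3 the upper one, so both closing edges are
    horizontal sides. *)
Definition corner (k : nat) : R * R := nth (0, 0)%R [:: (0, 0); (side, 0); (side, side); (0, side)]%R k.
Definition in_square (p : R * R) := (0 <= p.1 <= side /\ 0 <= p.2 <= side)%R.

(** The affine map taking corners 0, 1, 3 of the square to [h0], [h1], [h3]. *)
Definition frame (h0 h1 h3 p : R * R) : R * R :=
  (h0.1 + p.1 / side * (h1.1 - h0.1) + p.2 / side * (h3.1 - h0.1),
   h0.2 + p.1 / side * (h1.2 - h0.2) + p.2 / side * (h3.2 - h0.2))%R.

Lemma side_gt0 : (0 < side)%R. Proof. rewrite /side; lra. Qed.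

Lemma frame_lerp h0 h1 h3 t p q : frame h0 h1 h3 (lerp t p q) =
  lerp t (frame h0 h1 h3 p) (frame h0 h1 h3 q).
Proof. by rewrite /frame /lerp /=; congr pair; rewrite /Rdiv; ring. Qed.

Lemma frame_inj h0 h1 h3 : det h0 h1 h3 <> 0%R -> injective (frame h0 h1 h3).
Proof.
move=> d0 [p1 p2] [q1 q2] [/= E1 E2]; have s0 := side_gt0; have si : (/ side <> 0)%R by apply: Rinv_neq_0_compat; lra.
move: E1 E2; set v1 := (h1.1 - h0.1)%R; set v2 := (h1.2 - h0.2)%R; set w1 := (h3.1 - h0.1)%R.
set w2 := (h3.2 - h0.2)%R; set a := (p1 / side)%R; set b := (p2 / side)%R; set a' := (q1 / side)%R.
set b' := (q2 / side)%R => E1 E2.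
have g1 : ((a - a') * v1 + (b - b') * w1 = 0)%R by lra.
have g2 : ((a - a') * v2 + (b - b') * w2 = 0)%R by lra.
(* Cramer's rule: [det h0 h1 h3] is the determinant of the system [g1], [g2] in the unknowns
   [a - a'] and [b - b']. *)
have e1 : ((a - a') * det h0 h1 h3 = 0)%R.
  have -> : ((a - a') * det h0 h1 h3 =
    ((a - a') * v1 + (b - b') * w1) * w2 - ((a - a') * v2 + (b - b') * w2) * w1)%R.
    by rewrite /det -/v1 -/v2 -/w1 -/w2; ring.
  by rewrite g1 g2; ring.
have e2 : ((b - b') * det h0 h1 h3 = 0)%R.
  have -> : ((b - b') * det h0 h1 h3 =
    ((a - a') * v2 + (b - b') * w2) * v1 - ((a - a') * v1 + (b - b') * w1) * v2)%R.
    by rewrite /det -/v1 -/v2 -/w1 -/w2; ring.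
  by rewrite g1 g2; ring.
case: (Rmult_integral _ _ e1) => // {}e1; case: (Rmult_integral _ _ e2) => // {}e2.
by congr pair; apply: (Rmult_eq_reg_r (/ side)) => //; move: e1 e2; rewrite /a /b /a' /b' /Rdiv; lra.
Qed.

(** The diagonal [mu + nu = 1] cuts the unit square into two triangles, in each of which the point
    is a convex combination of three corners. *)
Lemma affine_square_le f0 f1 f2 f3 m mu nu : f2 = (f1 + f3 - f0)%R ->
  (f0 <= m)%R -> (f1 <= m)%R -> (f2 <= m)%R -> (f3 <= m)%R -> (0 <= mu <= 1)%R -> (0 <= nu <= 1)%R ->
  (f0 + mu * (f1 - f0) + nu * (f3 - f0) <= m)%R.
Proof.
move=> E l0 l1 l2 l3 hm hn; case: (Rle_dec (mu + nu) 1) => c.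
  have a1 : (0 <= (1 - mu - nu) * (m - f0))%R by apply: Rmult_le_pos; lra.
  have a2 : (0 <= mu * (m - f1))%R by apply: Rmult_le_pos; lra.
  have a3 : (0 <= nu * (m - f3))%R by apply: Rmult_le_pos; lra.
  by lra.
have a1 : (0 <= (mu + nu - 1) * (m - f2))%R by apply: Rmult_le_pos; lra.
have a2 : (0 <= (1 - nu) * (m - f1))%R by apply: Rmult_le_pos; lra.
have a3 : (0 <= (1 - mu) * (m - f3))%R by apply: Rmult_le_pos; lra.
by rewrite E in a1; lra.
Qed.

Lemma square_unit p : in_square p -> (0 <= p.1 / side <= 1)%R /\ (0 <= p.2 / side <= 1)%R.
Proof.
have s0 := side_gt0; have si : (0 < / side)%R by apply: Rinv_0_lt_compat.
have ss : (side * / side = 1)%R by apply: Rinv_r; lra.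
case=> h1 h2; rewrite /Rdiv; split; split; try (by apply: Rmult_le_pos; lra);
by rewrite -ss; apply: Rmult_le_compat_r; lra.
Qed.

Lemma lerp_square t p q : (0 < t < 1)%R -> in_square p -> in_square q -> in_square (lerp t p q).
Proof.
move=> t01 [h1 h2] [h3 h4]; rewrite /in_square /lerp /=; split; split;
  try (by apply: lerp_nonneg; lra).
- by have := @lerp_nonneg (side - p.1) (side - q.1) t; lra.
- by have := @lerp_nonneg (side - p.2) (side - q.2) t; lra.
Qed.

Section Hole.
Variables h0 h1 h2 h3 : Z * Z.
Hypothesis parallelogram : [&& Z.eqb h2.1 (h1.1 + h3.1 - h0.1) & Z.eqb h2.2 (h1.2 + h3.2 - h0.2)].
Let A := frame (real_pt h0) (real_pt h1) (real_pt h3).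

Lemma h2E : h2 = (h1.1 + h3.1 - h0.1, h1.2 + h3.2 - h0.2)%Z.
Proof. by case/andP: parallelogram => /Z.eqb_eq <- /Z.eqb_eq <-; case: h2. Qed.

(** Composed with the frame, [det a b] is affine on the square, so a bound at the four corners of
    the hole holds on the whole image. *)
Lemma frame_det_le a b p m : in_square p ->
  (forall h : Z * Z, h \in [:: h0; h1; h2; h3] -> (det a b (real_pt h) <= m)%R) -> (det a b (A p) <= m)%R.
Proof.
move=> /square_unit[m1 m2] H.
have -> : det a b (A p) = (det a b (real_pt h0) + p.1 / side * (det a b (real_pt h1) - det a b (real_pt h0))
    + p.2 / side * (det a b (real_pt h3) - det a b (real_pt h0)))%R.
  by rewrite /det /A /frame /=; ring.
apply: (@affine_square_le _ _ (det a b (real_pt h2))) => //; try by apply: H; rewrite !inE eqxx ?orbT.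
by rewrite h2E /det /= !minus_IZR !plus_IZR; ring.
Qed.

(** Coordinates are, up to sign, special cases of [det], so [frame_det_le] applies. Integer corners
    turn the strict inequalities into a margin of 1, which survives as a weak bound. *)
Lemma frame_snd p : in_square p -> all (fun h => Z.ltb 0 h.2 && Z.ltb h.2 24000) [:: h0; h1; h2; h3] ->
  (0 < (A p).2 < side)%R.
Proof.
move=> pin /allP H.
have b (h : Z * Z) : h \in [:: h0; h1; h2; h3] -> (1 <= IZR h.2 <= 23999)%R.
  move=> /H/andP[/Z.ltb_lt l1 /Z.ltb_lt l2].
  by split; apply: IZR_le; [exact: Zlt_le_succ l1 | exact: (proj1 (Z.lt_le_pred _ _) l2)].
have e p' : det (0, 0)%R (1, 0)%R p' = p'.2 by rewrite /det /=; ring.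
have e' p' : det (1, 0)%R (0, 0)%R p' = (- p'.2)%R by rewrite /det /=; ring.
have u2 : ((A p).2 <= 23999)%R.
  by rewrite -e; apply: frame_det_le => // h hin; rewrite e; exact: (proj2 (b h hin)).
have u1 : (- (A p).2 <= -1)%R.
  rewrite -e'; apply: frame_det_le => // h hin; rewrite e'.
  by apply: Ropp_le_contravar; exact: (proj1 (b h hin)).
by rewrite /side; lra.
Qed.

Lemma frame_fst p : in_square p -> all (fun h => Z.leb 0 h.1 && Z.leb h.1 24000) [:: h0; h1; h2; h3] ->
  (0 <= (A p).1 <= side)%R.
Proof.
move=> pin /allP H.
have b (h : Z * Z) : h \in [:: h0; h1; h2; h3] -> (0 <= IZR h.1 <= side)%R.
  by move=> /H/andP[/Z.leb_le l1 /Z.leb_le l2]; split; apply: IZR_le.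
have e p' : det (0, 0)%R (0, -1)%R p' = p'.1 by rewrite /det /=; ring.
have e' p' : det (0, 0)%R (0, 1)%R p' = (- p'.1)%R by rewrite /det /=; ring.
have u2 : ((A p).1 <= side)%R.
  by rewrite -e; apply: frame_det_le => // h hin; rewrite e; exact: (proj2 (b h hin)).
have u1 : (- (A p).1 <= 0)%R.
  rewrite -e'; apply: frame_det_le => // h hin; rewrite e' -Ropp_0.
  by apply: Ropp_le_contravar; exact: (proj1 (b h hin)).
lra.
Qed.

(** A line has the hole on one closed side and the segment on the other. Strictness comes either
    from the segment, whose ends are not both on the line, or from the hole, where integrality gives
    a margin of 1. The first way admits edges that end at a corner of the hole. *)
Lemma misses_holeP u v p : misses_hole [:: h0; h1; h2; h3] u v -> in_square p ->
  (forall t, (0 < t < 1)%R -> lerp t (real_pt u) (real_pt v) <> A p) /\ (u = v -> real_pt u <> A p).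
Proof.
move=> /hasP[[a b] _ ok] pin; set hs := [:: h0; h1; h2; h3] in ok.
have {}ok : [&& all (fun p => Z.leb (orient a b p) 0) hs, Z.leb 0 (orient a b u), Z.leb 0 (orient a b v)
      & Z.ltb 0 (orient a b u + orient a b v)] ||
    [&& all (fun p => Z.ltb (orient a b p) 0) hs, Z.leb 0 (orient a b u) & Z.leb 0 (orient a b v)] by [].
have key q : (0 <= det (real_pt a) (real_pt b) q)%R ->
    ((forall h : Z * Z, h \in [:: h0; h1; h2; h3] -> (det (real_pt a) (real_pt b) (real_pt h) <= 0)%R) /\
      (0 < det (real_pt a) (real_pt b) q)%R) \/
    (forall h : Z * Z, h \in [:: h0; h1; h2; h3] -> (det (real_pt a) (real_pt b) (real_pt h) <= -1)%R) ->
    q <> A p.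
  move=> q0 [[H qp]|H] E; rewrite E in q0.
    by have := frame_det_le pin H; rewrite E in qp; lra.
  by have := frame_det_le pin H; lra.
case/orP: ok.
  case/and4P=> /allP H /Z.leb_le/IZR_le fu /Z.leb_le/IZR_le fv /Z.ltb_lt/IZR_lt.
  rewrite plus_IZR -!det_orient => fs; rewrite -!det_orient in fu fv.
  have H' (h : Z * Z) : h \in [:: h0; h1; h2; h3] -> (det (real_pt a) (real_pt b) (real_pt h) <= 0)%R.
    by move=> /H/Z.leb_le/IZR_le; rewrite det_orient.
  split=> [t t01|uv]; apply: key; rewrite ?det_lerp.
  - exact: lerp_nonneg.
  - by left; split=> //; apply: lerp_pos.
  - exact: fu.
  - by left; split=> //; rewrite uv in fs *; lra.
case/and3P=> /allP H /Z.leb_le/IZR_le fu /Z.leb_le/IZR_le fv.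
rewrite -!det_orient in fu fv.
have H' (h : Z * Z) : h \in [:: h0; h1; h2; h3] -> (det (real_pt a) (real_pt b) (real_pt h) <= -1)%R.
  by move=> /H/Z.ltb_lt l; rewrite det_orient; apply: IZR_le; exact: (proj1 (Z.lt_le_pred _ _) l).
by split=> [t t01|uv]; apply: key; rewrite ?det_lerp; try (exact: lerp_nonneg); try (exact: fu); right.
Qed.

End Hole.

(** * Drawings of prefixes *)

Record drawn (P : pole) (q : nat -> R * R) : Prop := Drawn {
  drawn_square : forall x, x < order P -> in_square (q x);
  drawn_out : forall k, k < size (out P) -> q (nth 0 (out P) k) = corner k;
  (* Keeps both horizontal sides of the square free for the closing edges. *)
  drawn_inside : forall x, x < order P -> x \notin out P -> (0 < (q x).2 < side)%R;
  drawn_inj : forall x y, x < order P -> y < order P -> q x = q y -> x = y;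
  drawn_vtx : forall x y z t, x < order P -> z < order P -> y \in nbr P x -> (0 < t < 1)%R ->
    lerp t (q x) (q y) <> q z;
  drawn_edge : forall x y u v t s, x < order P -> u < order P -> y \in nbr P x -> v \in nbr P u ->
    (0 < t < 1)%R -> (0 < s < 1)%R -> lerp t (q x) (q y) = lerp s (q u) (q v) ->
    (u = x /\ v = y) \/ (u = y /\ v = x) }.

Definition eq_pt (a b : Z * Z) : bool := Z.eqb a.1 b.1 && Z.eqb a.2 b.2.

(** The index [psize D + k] denotes corner [k] of the hole, where output [k] of the older prefix is
    placed. *)
Definition piece_edges (D : piece) : seq (nat * nat) :=
  flatten [seq [seq (u, w) | w <- nth [::] (adj D) u & u < w] | u <- iota 0 (psize D)] ++
  [seq (psize D + k, nth 0 (lft D) k) | k <- iota 0 (size (lft D))].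

Definition hole_ok (hs : seq (Z * Z)) : bool :=
  if hs is [:: h0; h1; h2; h3] then
    [&& [&& Z.eqb h2.1 (h1.1 + h3.1 - h0.1) & Z.eqb h2.2 (h1.2 + h3.2 - h0.2)],
        ~~ Z.eqb (orient h0 h1 h3) 0,
        all (fun h => Z.ltb 0 h.2 && Z.ltb h.2 24000) [:: h0; h1; h2; h3]
      & all (fun h => Z.leb 0 h.1 && Z.leb h.1 24000) [:: h0; h1; h2; h3]]
  else false.

(* The points of the vertices come first, then the corners of the hole. *)
Definition drawing_ok (D : piece) (pts : seq (Z * Z)) : bool :=
  let n := psize D in let g i := nth (Z0, Z0) pts i in let hs := drop n pts in
  let E := [seq (e, (g e.1, g e.2)) | e <- piece_edges D] in
  [&& all (fun e => all (fun f => separated e.2.1 e.2.2 f.2.1 f.2.2 || (e.1 == f.1)) E) E,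
      all (fun e => all (fun i => [|| i == e.1.1, i == e.1.2 | ~~ Z.eqb (orient e.2.1 e.2.2 (g i)) 0])
        (iota 0 n)) E,
      all (fun e => misses_hole hs e.2.1 e.2.2 && ~~ eq_pt e.2.1 e.2.2) E,
      all (fun i => misses_hole hs (g i) (g i)) (iota 0 n),
      all (fun i => all (fun j => (i == j) || ~~ eq_pt (g i) (g j)) (iota 0 n)) (iota 0 n),
      all (fun i => [&& Z.leb 0 (g i).1, Z.leb (g i).1 24000, Z.leb 0 (g i).2, Z.leb (g i).2 24000 &
        (i \in rgt D) || Z.ltb 0 (g i).2 && Z.ltb (g i).2 24000]) (iota 0 n),
      all (fun k => eq_pt (g (nth 0 (rgt D) k))
        (nth (Z0, Z0) [:: (0, 0); (24000, 0); (24000, 24000); (0, 24000)]%Z k)) (iota 0 4)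
    & nilp (lft D) || (hole_ok hs && (size (lft D) == 4))].

Lemma eq_ptP a b : eq_pt a b = true <-> a = b.
Proof.
case: a b => [a1 a2] [b1 b2]; split=> [/andP[/Z.eqb_eq /= -> /Z.eqb_eq /= ->] //|[-> ->]].
by apply/andP; split; apply/Z.eqb_eq.
Qed.

Lemma real_pt_inj : injective real_pt.
Proof. by move=> [a b] [c d] [/eq_IZR -> /eq_IZR ->]. Qed.

Lemma open_disjointC a b c d : open_disjoint a b c d -> open_disjoint b a c d.
Proof. by move=> H t s t01 s01; rewrite lerpC; apply: H => //; lra. Qed.

Lemma open_disjoint_sym a b c d : open_disjoint a b c d -> open_disjoint c d a b.
Proof. by move=> H t s t01 s01 /esym; apply: H. Qed.

Section DrawExtend.
Variables (P : pole) (D : piece) (q : nat -> R * R) (pts : seq (Z * Z)).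
Hypothesis gP : pole_graph P.
Hypothesis okD : piece_ok D.
Hypothesis gD : piece_graph D.
Hypothesis szo : size (out P) = size (lft D).
(** A piece without left attachments is put on the empty pole. With no points listed after its
    vertices, missing corners default to the origin, and [misses_hole] then holds trivially. *)
Hypothesis P0 : lft D = [::] -> order P = 0.
Hypothesis dP : drawn P q.
Hypothesis okp : drawing_ok D pts.
Let m := order P.
Let n := psize D.
Let g i := nth (Z0, Z0) pts i.
Let G i := real_pt (g i).
Let A := frame (G n) (G (n + 1)) (G (n + 3)).

Definition place (x : nat) : R * R := if x < m then A (q x) else G (x - m).

Let idv i := if i < n then m + i else nth 0 (out P) (i - n).
Let PE i j := (i, j) \in piece_edges D \/ (j, i) \in piece_edges D.

Lemma hole_facts : 0 < m -> exists h0 h1 h2 h3,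
  [/\ drop n pts = [:: h0; h1; h2; h3], hole_ok [:: h0; h1; h2; h3], size (lft D) = 4,
      [/\ G n = real_pt h0, G (n + 1) = real_pt h1, G (n + 2) = real_pt h2 & G (n + 3) = real_pt h3]
    & A = frame (real_pt h0) (real_pt h1) (real_pt h3)].
Proof.
move=> m0; have [_ _ _ _ /and4P[_ _ _]] := and5P okp.
case/orP=> [/nilP El|/andP[hok /eqP sl]]; first by rewrite /m P0 in m0.
have nthd k : nth (Z0, Z0) (drop n pts) k = g (n + k) by rewrite nth_drop.
move: hok nthd; rewrite -/n; case: (drop n pts) => [|h0 [|h1 [|h2 [|h3 [|? ?]]]]] // hok nthd.
have e0 := nthd 0; have e1 := nthd 1; have e2 := nthd 2; have e3 := nthd 3; rewrite /= addn0 in e0 e1 e2 e3.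
exists h0, h1, h2, h3; split=> //; last by rewrite /A /G -e0 -e1 -e3.
by rewrite /G e0 e1 e2 e3.
Qed.

Lemma old_miss i j p : (i, j) \in piece_edges D \/ (i = j /\ i < n) -> 0 < m -> in_square p ->
  (forall t, (0 < t < 1)%R -> lerp t (G i) (G j) <> A p) /\ (i = j -> G i <> A p).
Proof.
move=> ij m0 pin; have [h0 [h1 [h2 [h3 [dE hok _ _ ->]]]]] := hole_facts m0.
have [par _ _ _] := and4P hok.
have miss : misses_hole (drop n pts) (g i) (g j).
  have [_ _ /allP H1 /allP H2 _] := and5P okp.
  case: ij => [ijE|[<- ilt]].
    by have /H1/andP[] : ((i, j), (g i, g j)) \in [seq (e, (g e.1, g e.2)) | e <- piece_edges D]
      by apply/mapP; exists (i, j).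
  by apply: H2; rewrite mem_iota.
rewrite dE in miss; have [h h'] := misses_holeP par miss pin.
by split=> // ij'; apply: h'; rewrite ij'.
Qed.

Lemma place_new u : place (m + u) = G u.
Proof. by rewrite /place ltnNge leq_addr /= addKn. Qed.

Lemma place_old x : x < m -> place x = A (q x).
Proof. by rewrite /place => ->. Qed.

(** The frame puts old outputs exactly at the corners of the hole, so seam edges are segments of the
    drawn piece. *)
Lemma place_corner k : k < size (lft D) -> place (nth 0 (out P) k) = G (n + k).
Proof.
move=> kl; have km := nth_out_lt gP szo kl; rewrite place_old // (drawn_out dP) ?szo //.
have m0 : 0 < m by apply: leq_ltn_trans km.
have [h0 [h1 [h2 [h3 [_ hok sl [E0 E1 E2 E3] ->]]]]] := hole_facts m0.
have [par _ _ _] := and4P hok; have s0 := side_gt0.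
have ss : (side / side = 1)%R by rewrite /Rdiv; apply: Rinv_r; lra.
have z0 : (0 / side = 0)%R by rewrite /Rdiv; ring.
rewrite sl in kl; case: k kl {km} => [|[|[|[|k]]]] // _; rewrite ?addn0 ?E0 ?E1 ?E2 ?E3 /frame /corner /= ?ss ?z0.
- by rewrite /real_pt; congr pair; ring.
- by rewrite /real_pt; congr pair; ring.
- by rewrite (h2E par) /real_pt /= !minus_IZR !plus_IZR; congr pair; ring.
- by rewrite /real_pt; congr pair; ring.
Qed.

Lemma idv_place i j : PE i j -> place (idv i) = G i.
Proof.
have H u v : (u, v) \in piece_edges D -> (u < n \/ exists2 k, k < size (lft D) & u = n + k) /\ v < n.
  rewrite mem_cat => /orP[/flattenP[s /mapP[w wn ->] /mapP[z + [-> ->]]]|/mapP[k + [-> ->]]].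
    rewrite mem_filter => /andP[_ zw]; move: wn; rewrite mem_iota => /= wn.
    by split; [left | apply: adj_lt zw].
  rewrite mem_iota => /= kl; split; first by right; exists k.
  by apply: lft_lt; rewrite // mem_nth.
move=> ij; have : i < n \/ exists2 k, k < size (lft D) & i = n + k.
  by case: ij => /H[] //; left.
rewrite /idv; case=> [->|[k kl ->]]; first by rewrite place_new.
by rewrite ltnNge leq_addr /= addKn place_corner.
Qed.

(** Either the edge is old and drawn inside the hole, or it is in [piece_edges], which includes the
    edges across the seam. *)
Lemma edge_cases x y : x < m + n -> y \in nbr (extend P D) x ->
  [/\ x < m, y < m & y \in nbr P x] \/ exists i j, [/\ PE i j, x = idv i & y = idv j].
Proof.
have cross k : k < size (lft D) -> PE (n + k) (nth 0 (lft D) k) /\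
    idv (n + k) = nth 0 (out P) k /\ idv (nth 0 (lft D) k) = m + nth 0 (lft D) k.
  move=> kl; split; first by left; rewrite mem_cat; apply/orP; right; apply/mapP; exists k; rewrite // mem_iota.
  rewrite /idv ltnNge leq_addr /= addKn; split=> //.
  by rewrite (_ : nth 0 (lft D) k < n) //; apply: lft_lt; rewrite // mem_nth.
move=> xn; case: (split_vtx P x) => [[u xu _]|xm]; case: (split_vtx P y) => [[w yw _]|ym]; subst.
- rewrite (extend_new gP szo) => wa; right; have un := adj_dom wa; have wn := adj_lt okD wa.
  exists u, w; rewrite /idv un wn; split=> //.
  have [_ _ sy _] := gDu gD un.
  case: (ltngtP u w) => uw.
  + left; rewrite mem_cat; apply/orP; left; apply/flattenP.
    exists [seq (u, w') | w' <- nth [::] (adj D) u & u < w']; first by apply/map_f; rewrite mem_iota.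
    by apply/map_f; rewrite mem_filter uw.
  + right; rewrite mem_cat; apply/orP; left; apply/flattenP.
    exists [seq (w, w') | w' <- nth [::] (adj D) w & w < w']; first by apply/map_f; rewrite mem_iota.
    by apply/map_f; rewrite mem_filter uw; apply: sy.
  + have [_ _ /allP H _ _] := and5P okD; have := H u; rewrite mem_iota => /(_ un).
    by case/negP; move: wa; rewrite -uw.
- rewrite (extend_down gP szo) // => /(extend_up gP szo _ ym)[k kl [-> ->]]; right.
  have [pe [e1 e2]] := cross k kl; exists (nth 0 (lft D) k), (n + k); split=> //.
  by case: pe; [right|left].
- move=> /(extend_up gP szo _ xm)[k kl [-> ->]]; right.
  by have [pe [e1 e2]] := cross k kl; exists (n + k), (nth 0 (lft D) k).
- by rewrite (extend_old szo) // => yx; left.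
Qed.

Lemma PE_disjoint i j k l : PE i j -> PE k l ->
  ((k = i /\ l = j) \/ (k = j /\ l = i)) \/ open_disjoint (G i) (G j) (G k) (G l).
Proof.
have [/allP H _ _ _ _] := and5P okp.
have K a b c d : (a, b) \in piece_edges D -> (c, d) \in piece_edges D ->
    (c = a /\ d = b) \/ open_disjoint (G a) (G b) (G c) (G d).
  move=> ab cd.
  have abE : ((a, b), (g a, g b)) \in [seq (e, (g e.1, g e.2)) | e <- piece_edges D].
    by apply/mapP; exists (a, b).
  have cdE : ((c, d), (g c, g d)) \in [seq (e, (g e.1, g e.2)) | e <- piece_edges D].
    by apply/mapP; exists (c, d).
  case/orP: (allP (H _ abE) _ cdE) => [/separated_disjoint|/eqP[-> ->]]; by [right | left].
case=> ij [] kl; case: (K _ _ _ _ ij kl) => [[-> ->]|dj]; try (by left; auto); right.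
- exact: dj.
- by apply/open_disjoint_sym/open_disjointC/open_disjoint_sym.
- exact: open_disjointC.
- by apply/open_disjointC/open_disjoint_sym/open_disjointC/open_disjoint_sym.
Qed.

Lemma PE_miss i j p t : PE i j -> 0 < m -> in_square p -> (0 < t < 1)%R -> lerp t (G i) (G j) <> A p.
Proof.
case=> ij m0 pin t01; first by have [H _] := old_miss (or_introl ij) m0 pin; apply: H.
by rewrite lerpC; have [H _] := old_miss (or_introl ij) m0 pin; apply: H; lra.
Qed.

Lemma new_miss u p : u < n -> 0 < m -> in_square p -> G u <> A p.
Proof. by move=> un m0 pin; have [_ H] := @old_miss u u p (or_intror (conj erefl un)) m0 pin; apply: H. Qed.

(** The integer check keeps every vertex that is not an end of the edge off its whole supporting
    line, where [det] vanishes. *)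
Lemma PE_vtx i j u t : PE i j -> u < n -> (0 < t < 1)%R -> lerp t (G i) (G j) <> G u.
Proof.
have [_ /allP H1 /allP H2 _ _] := and5P okp.
have K a b s : (a, b) \in piece_edges D -> u < n -> (0 < s < 1)%R -> lerp s (G a) (G b) <> G u.
  move=> ab un s01; have abE : ((a, b), (g a, g b)) \in [seq (e, (g e.1, g e.2)) | e <- piece_edges D].
    by apply/mapP; exists (a, b).
  have /andP[_ /negP nab] := H2 _ abE.
  have ne : G a <> G b by move=> /real_pt_inj/eq_ptP.
  have := allP (H1 _ abE) u; rewrite mem_iota => /(_ un) /or3P[/eqP->|/eqP->|o0] E.
  - by apply: ne; apply: lerp_end s01 E.
  - by apply/ne/esym; apply: (@lerp_end (1 - s)); [lra | rewrite -lerpC].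
  - case/negP: o0; apply/Z.eqb_eq/eq_IZR; rewrite -det_orient -/(G u) -E det_lerp det_left det_right.
    by ring.
case=> ij un t01; first exact: K.
by rewrite lerpC; apply: K => //; lra.
Qed.

Lemma A_inj : 0 < m -> injective A.
Proof.
move=> m0; have [h0 [h1 [h2 [h3 [_ /and4P[_ /negP o0 _ _] _ _ ->]]]]] := hole_facts m0.
by apply: frame_inj; rewrite det_orient => E; apply: o0; apply/Z.eqb_eq/eq_IZR.
Qed.

(** Old items meet only if they met before, since the frame is injective; old and new items are kept
    apart by the hole; new items by the integer checks. *)
Lemma drawn_extend : drawn (extend P D) place.
Proof.
have [_ _ _ _ /and4P[/allP H1 /allP H2 /allP H3 _]] := and5P okp.
have sq x : x < m -> in_square (q x) by apply: (drawn_square dP).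
have ps x : x < m -> 0 < m by move=> xm; apply: leq_ltn_trans xm.
have gu u : u < n -> (0 <= (G u).1 <= side /\ 0 <= (G u).2 <= side)%R /\
    (u \notin rgt D -> (0 < (G u).2 < side)%R).
  move=> un; have := H2 u; rewrite mem_iota => /(_ un).
  case/and5P => /Z.leb_le/IZR_le a1 /Z.leb_le/IZR_le a2 /Z.leb_le/IZR_le a3 /Z.leb_le/IZR_le a4 a5.
  split; first by split; split.
  move=> ur; move: a5; rewrite (negbTE ur) /= => /andP[/Z.ltb_lt/IZR_lt b1 /Z.ltb_lt/IZR_lt b2].
  by split.
have inh x : x < m -> (0 <= (A (q x)).1 <= side)%R /\ (0 < (A (q x)).2 < side)%R.
  move=> xm; have [h0 [h1 [h2 [h3 [_ /and4P[par _ y1 x1] _ _ ->]]]]] := hole_facts (ps x xm).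
  by split; [apply: (frame_fst par) | apply: (frame_snd par)] => //; apply: sq.
split=> /=; rewrite -/m -/n.
- move=> x xn; case: (split_vtx P x) => [[u xu _]|xm].
    by subst; rewrite place_new; case: (gu u); [rewrite ltn_add2l in xn | case].
  by rewrite place_old //; case: (inh x xm) => i1 i2; split=> //; lra.
- move=> k; rewrite size_map => kr; have [_ _ _ _ /and3P[_ _ /eqP sr]] := and5P okD.
  rewrite (nth_map 0) // place_new; rewrite sr in kr.
  have := H3 k; rewrite mem_iota => /(_ kr) /eq_ptP; rewrite /G /g => ->.
  by case: k kr => [|[|[|[|k]]]].
- move=> x xn xr; case: (split_vtx P x) => [[u xu _]|xm].
    subst; rewrite place_new; have [|_] := gu u; first by rewrite ltn_add2l in xn.
    by apply; apply: contra xr => ur; apply: map_f.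
  by rewrite place_old //; case: (inh x xm).
- move=> x y xn yn; case: (split_vtx P x) => [[u xu _]|xm]; case: (split_vtx P y) => [[w yw _]|ym]; subst.
  + rewrite !place_new; rewrite !ltn_add2l in xn yn => /real_pt_inj/eq_ptP E.
    have := allP (H1 u _) w; rewrite !mem_iota => /(_ xn yn).
    by rewrite E orbF => /eqP->.
  + rewrite place_new place_old // => E; rewrite ltn_add2l in xn.
    by case: (new_miss xn (ps y ym) (sq y ym)).
  + rewrite place_new place_old // => E; rewrite ltn_add2l in yn.
    by case: (new_miss yn (ps x xm) (sq x xm)).
  + rewrite !place_old // => /(A_inj (ps x xm)); exact: (drawn_inj dP).
- move=> x y z t xn zn xy t01; rewrite -/(nbr (extend P D) x) in xy.
  case: (edge_cases xn xy) => [[xm ym {}xy]|[i [j [ij -> ->]]]]; case: (split_vtx P z) => [[w zw _]|zm]; subst.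
  + rewrite place_new !place_old // -frame_lerp -/A => /esym; rewrite ltn_add2l in zn.
    by apply: new_miss (ps x xm) _ => //; apply: lerp_square => //; apply: sq.
  + rewrite !place_old // -frame_lerp -/A => /(A_inj (ps x xm)).
    by apply: (drawn_vtx dP).
  + have ji : PE j i by case: ij; [right|left].
    rewrite (idv_place ij) (idv_place ji) place_new; apply: PE_vtx => //.
    by rewrite ltn_add2l in zn.
  + have ji : PE j i by case: ij; [right|left].
    rewrite (idv_place ij) (idv_place ji) place_old //.
    by apply: PE_miss (ps z zm) (sq z zm) t01.
- move=> x y u v t s xn un xy uv t01 s01; rewrite -!/(nbr (extend P D) _) in xy uv.
  case: (edge_cases xn xy) => [[xm ym {}xy]|[i [j [ij -> ->]]]];
  case: (edge_cases un uv) => [[um vm {}uv]|[k [l [kl -> ->]]]].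
  + rewrite !place_old // -!frame_lerp -/A => /(A_inj (ps x xm)).
    exact: (drawn_edge dP).
  + have lk : PE l k by case: kl; [right|left].
    rewrite (idv_place kl) (idv_place lk) !place_old // -frame_lerp -/A => /esym E; exfalso.
    by apply: PE_miss kl (ps x xm) _ s01 E; apply: lerp_square => //; apply: sq.
  + have ji : PE j i by case: ij; [right|left].
    rewrite (idv_place ij) (idv_place ji) !place_old // -frame_lerp -/A => E; exfalso.
    by apply: PE_miss ij (ps u um) _ t01 E; apply: lerp_square => //; apply: sq.
  + have ji : PE j i by case: ij; [right|left].
    have lk : PE l k by case: kl; [right|left].
    rewrite (idv_place ij) (idv_place ji) (idv_place kl) (idv_place lk) => E.
    case: (PE_disjoint ij kl) => [[[-> ->]|[-> ->]]|dj]; [by left|by right|].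
    by case: (dj t s t01 s01).
Qed.

End DrawExtend.

(** * Drawing the closing edges *)

Section ClosedDrawing.
Variables (P : pole) (q : nat -> R * R).
Hypothesis gP : pole_graph P.
Hypothesis sz4 : size (out P) = 4.
Hypothesis dP : drawn P q.

Lemma closing_lerp k t : k < 4 -> (0 < t < 1)%R ->
  (0 < (lerp t (corner k) (corner (partner k))).1 < side)%R /\
  (lerp t (corner k) (corner (partner k))).2 = (corner k).2.
Proof.
move=> k4 t01; have s0 := side_gt0.
have a1 : (0 < t * side)%R by apply: Rmult_lt_0_compat; lra.
have a2 : (0 < (1 - t) * side)%R by apply: Rmult_lt_0_compat; lra.
by case: k k4 => [|[|[|[|k]]]] // _; rewrite /lerp /corner /partner /=; split; lra.
Qed.

Lemma corner_fst k : k < 4 -> (corner k).1 = 0%R \/ (corner k).1 = side.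
Proof. by case: k => [|[|[|[|k]]]] // _; [left|right|right|left]. Qed.

Lemma corner_snd k : k < 4 -> (corner k).2 = 0%R \/ (corner k).2 = side.
Proof. by case: k => [|[|[|[|k]]]] // _; [left|left|right|right]. Qed.

Lemma corner_snd_eq k l : k < 4 -> l < 4 -> (corner k).2 = (corner l).2 -> l = k \/ l = partner k.
Proof.
have s0 := side_gt0; case: k => [|[|[|[|k]]]] // _; case: l => [|[|[|[|l]]]] // _;
by rewrite /corner /= => E; first [by left | by right | exfalso; lra].
Qed.

(** Outputs are pairwise non-adjacent, so every edge of the pole has an end strictly between the
    horizontal sides. *)
Lemma nbr_lerp_inside u v s : u < order P -> v \in nbr P u -> (0 < s < 1)%R ->
  (0 < (lerp s (q u) (q v)).2 < side)%R.
Proof.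
move=> uP uv s01; have vP := nbr_lt gP uP uv.
have [_ su] := drawn_square dP uP; have [_ sv] := drawn_square dP vP.
have h : ((0 < (q u).2 < side) \/ (0 < (q v).2 < side))%R.
  case: (boolP (u \in out P)) => uo; last by left; apply: (drawn_inside dP).
  right; apply: (drawn_inside dP) => //; apply/negP => vo.
  by case/negP: (out_nadj gP uo vo).
have h1 : (0 < (1 - s) * (q u).2 + s * (q v).2)%R by apply: lerp_pos => //; lra.
have h2 : (0 < (1 - s) * (side - (q u).2) + s * (side - (q v).2))%R by apply: lerp_pos => //; lra.
by rewrite /lerp /=; lra.
Qed.

(** A closing edge fills a horizontal side of the square, which no edge of the pole meets in an
    interior point and where the only vertices are its two corners. *)
Lemma edge_planar : planar (@edge P).
Proof.
have qo k : k < 4 -> q (nth 0 (out P) k) = corner k by move=> k4; apply: (drawn_out dP); rewrite sz4.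
have [_ irr] := edge_simple gP sz4.
apply: (straight_line_planar irr (p := fun x => q (val x))).
- by move=> x y E; apply/val_inj/(drawn_inj dP) => //; apply: ltn_ord.
- move=> x y z t; rewrite /edge mem_cat => /orP[xy|/(partner_linkP sz4)[k k4 [-> ->]]] t01.
    by apply: (drawn_vtx dP) => //; apply: ltn_ord.
  have [p4 _ _] := partnerP k4; rewrite !qo //; have [h1 h2] := closing_lerp k4 t01 => E.
  case: (boolP (val z \in out P)) => zo.
    have z4 : index (val z) (out P) < 4 by rewrite -sz4 index_mem.
    have := qo _ z4; rewrite nth_index // -E => E'.
    by case: (corner_fst z4); rewrite -E'; lra.
  have := drawn_inside dP (ltn_ord z) zo; rewrite -E h2.
  by case: (corner_snd k4) => ->; lra.
- move=> x y u v t s; rewrite /edge !mem_cat.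
  move=> /orP[xy|/(partner_linkP sz4)[k k4 [xk yk]]] /orP[uv|/(partner_linkP sz4)[l l4 [ul vl]]] t01 s01 E.
  + by case: (drawn_edge dP (ltn_ord x) (ltn_ord u) xy uv t01 s01 E) => [] [/val_inj-> /val_inj->]; [left|right].
  + exfalso; have := nbr_lerp_inside (ltn_ord x) xy t01; have [p4 _ _] := partnerP l4.
    rewrite E ul vl !qo //; have [_ ->] := closing_lerp l4 s01.
    by case: (corner_snd l4) => ->; lra.
  + exfalso; have := nbr_lerp_inside (ltn_ord u) uv s01; have [p4 _ _] := partnerP k4.
    rewrite -E xk yk !qo //; have [_ ->] := closing_lerp k4 t01.
    by case: (corner_snd k4) => ->; lra.
  + have [p4 pp _] := partnerP k4; have [p4' _ _] := partnerP l4.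
    move: E; rewrite xk yk ul vl !qo // => E.
    have [_ e1] := closing_lerp k4 t01; have [_ e2] := closing_lerp l4 s01.
    have e3 : (corner k).2 = (corner l).2 by rewrite -e1 -e2 E.
    case: (corner_snd_eq k4 l4 e3) => lk; [left|right]; split; apply: val_inj; rewrite /= ?ul ?vl ?xk ?yk lk ?pp //.
Qed.

End ClosedDrawing.

(** The neighbours of outputs lie in the last piece, so a path of length at most 3 between two
    outputs stays there, and the finite test [far_ends] decides. *)
Lemma far_extend P D : pole_graph P -> piece_ok D -> piece_graph D -> far_ends D ->
  size (out P) = size (lft D) -> far (extend P D).
Proof.
move=> gP ok gD /andP[/allP fe /allP dis] szo x y z.
have [_ _ _ _ /and3P[_ _ /eqP sr]] := and5P ok.
have sz4 : size (out (extend P D)) = 4 by rewrite size_map.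
have rl k : k < 4 -> nth 0 (rgt D) k \in rgt D by move=> k4; rewrite mem_nth ?sr.
have onew k : k < 4 -> nth 0 (out (extend P D)) k = order P + nth 0 (rgt D) k.
  by move=> k4; rewrite (nth_map 0) ?sr.
have notold p k : k < 4 -> p < order P -> order P + nth 0 (rgt D) k \in nbr (extend P D) p -> False.
  move=> k4 pm /(extend_up gP szo _ pm)[i il [_ E]].
  by case/negP: (dis _ (rl k k4)); rewrite E mem_nth.
case/(partner_linkP sz4) => k k4 [-> ->]; have [p4 _ _] := partnerP k4; rewrite !onew // => xz.
have /fe/allP F : k \in iota 0 4 by rewrite mem_iota.
case: (split_vtx P z) => [[w zw _]|zm]; last first.
  by exfalso; apply: (notold z k) => //; rewrite -(extend_down gP szo).
subst z; move: xz; rewrite (extend_new gP szo) => /F/andP[f1 /allP f2].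
split; first by rewrite (extend_new gP szo).
move=> v; case: (split_vtx P v) => [[r vr _]|vm] wv; last by apply/negP; apply: notold.
by subst v; rewrite (extend_new gP szo) in wv; rewrite (extend_new gP szo); exact: (f2 r wv).
Qed.

Definition has_pentagon (P : pole) := exists s, [/\ uniq s, size s = 5, all (fun x => x < order P) s
    & cycle (fun x y => y \in nbr P x) s].

Lemma pentagon_extend P D : has_pentagon P -> has_pentagon (extend P D).
Proof.
case=> s [us s5 /allP sP cs]; exists s; split=> //.
  by apply/allP => x /sP xP; apply: ltn_addr.
apply: (@sub_in_cycle _ (fun x => x < order P) (fun x y => y \in nbr P x)) cs; last exact/allP.
by move=> x y xP _ xy; rewrite /= (xP : x < order P) mem_cat xy.
Qed.

Lemma pole_graph_void : pole_graph void_pole.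
Proof. by []. Qed.

Lemma drawn_void q : drawn void_pole q.
Proof. by []. Qed.

(** * Assembling the invariant of the chain *)

Definition sound_piece (D : piece) (r : routes) (pts : seq (Z * Z)) : bool :=
  [&& piece_ok D, program_ok D, piece_graph D, routes_ok D r & drawing_ok D pts].

(** The distance condition [far] is not part of the invariant: it concerns the last piece and is
    supplied when the chain is closed. *)
Record prefix (P : pole) (N : nat) : Prop := Prefix {
  prefix_order : order P = N;
  prefix_size : size (out P) = 4;
  prefix_graph : pole_graph P;
  prefix_nonham : nonham_pole P;
  prefix_hypo : hypo_pole P;
  prefix_drawn : exists q, drawn P q;
  prefix_pentagon : has_pentagon P }.

Lemma prefix_start D r pts : sound_piece D r pts -> closed_from D [:: [::]] -> lft D = [::] ->
  route_src r = [:: [::]] -> has_pentagon (extend void_pole D) ->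
  prefix (extend void_pole D) (psize D).
Proof.
move=> /and5P[ok pok gD rok dok] clo l0 src pent.
have szo : size (out void_pole) = size (lft D) by rewrite l0.
split=> //.
- by have [_ _ _ _ /and3P[_ _ /eqP sr]] := and5P ok; rewrite size_map.
- exact: pole_graph_extend pole_graph_void ok gD szo.
- by apply: nonham_void => //; rewrite l0.
- apply: (hypo_extend pole_graph_void szo rok) => // c; rewrite src inE => /eqP->.
  by exists [::].
- by exists (place void_pole D (fun=> corner 0) pts); apply: drawn_extend => //; apply: drawn_void.
Qed.

Lemma prefix_step D r pts P N : sound_piece D r pts -> closed_from D full_states -> size (lft D) = 4 ->
  route_src r = cover_configs -> prefix P N -> prefix (extend P D) (N + psize D).
Proof.
move=> /and5P[ok pok gD rok dok] clo l4 src [oP sP gP nP hP [q dP] pent].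
have szo : size (out P) = size (lft D) by rewrite sP l4.
split.
- by rewrite /= oP.
- by have [_ _ _ _ /and3P[_ _ /eqP sr]] := and5P ok; rewrite size_map.
- exact: pole_graph_extend.
- exact: nonham_extend.
- case: hP => h1 h2; apply: (hypo_extend gP szo rok); first by rewrite src.
  by move=> v vP; split; [rewrite /nilp l4 | apply: h2].
- exists (place P D q pts); apply: drawn_extend => //.
  by move=> l0; rewrite l0 in l4.
- exact: pentagon_extend.
Qed.

Lemma prefix_final P N : prefix P N -> far P -> 5 <= N ->
  exists (T : finType) (e : rel T), simple_graph e /\ #|T| = N /\ planar e /\ cubic e /\
    hypohamiltonian e /\ girth e 5.
Proof.
move=> [oP sP gP nP hP [q dP] pent] fP N5; exists ('I_(order P) : finType), (@edge P).
split; first exact: edge_simple. split; first by rewrite card_ord.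
split; first exact: edge_planar dP. split; first exact: edge_cubic.
split; last exact: edge_girth.
by split; [exact: edge_nonham | apply: edge_hypo; rewrite ?oP].
Qed.

(** * The three pieces *)

(** Vertices with two listed neighbours carry a half-edge. Neighbours tend to have nearby numbers,
    which keeps the frontier of the run short. *)
Definition piece76 : piece := Piece [::
  [:: 1; 3; 6]; [:: 0; 2; 9]; [:: 1; 4; 5]; [:: 0; 4; 7]; [:: 2; 3; 11]; [:: 2; 10; 12];
  [:: 0; 8; 14]; [:: 3; 8; 13]; [:: 6; 7; 15]; [:: 1; 10; 17]; [:: 5; 9; 18]; [:: 4; 12; 13];
  [:: 5; 11; 21]; [:: 7; 11; 20]; [:: 6; 16; 22]; [:: 8; 16; 24]; [:: 14; 15; 28];
  [:: 9; 19; 23]; [:: 10; 19; 31]; [:: 17; 18; 26]; [:: 13; 21; 25]; [:: 12; 20; 33];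
  [:: 14; 23; 29]; [:: 17; 22; 27]; [:: 15; 25; 35]; [:: 20; 24; 36]; [:: 19; 27; 32];
  [:: 23; 26; 30]; [:: 16; 29; 37]; [:: 22; 28; 30]; [:: 27; 29; 44]; [:: 18; 32; 34];
  [:: 26; 31; 39]; [:: 21; 34; 41]; [:: 31; 33; 40]; [:: 24; 38]; [:: 25; 42]; [:: 28; 38; 45];
  [:: 35; 37; 48]; [:: 32; 40; 46]; [:: 34; 39; 43]; [:: 33; 42; 43]; [:: 36; 41; 52];
  [:: 40; 41; 53]; [:: 30; 47; 51]; [:: 37; 49; 50]; [:: 39; 47; 56]; [:: 44; 46; 54];
  [:: 38; 49; 61]; [:: 45; 48; 58]; [:: 45; 51; 59]; [:: 44; 50; 55]; [:: 42; 53; 66];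
  [:: 43; 52; 64]; [:: 47; 55; 57]; [:: 51; 54; 60]; [:: 46; 57; 65]; [:: 54; 56; 68];
  [:: 49; 59; 62]; [:: 50; 58; 60]; [:: 55; 59; 63]; [:: 48; 62; 71]; [:: 58; 61; 63];
  [:: 60; 62; 72]; [:: 53; 65; 67]; [:: 56; 64; 69]; [:: 52; 67]; [:: 64; 66; 70];
  [:: 57; 69; 73]; [:: 65; 68; 70]; [:: 67; 69; 74]; [:: 61; 72; 75]; [:: 63; 71; 73];
  [:: 68; 72; 74]; [:: 70; 73; 75]; [:: 71; 74]]
  [::] [:: 66; 75; 35; 36].

Definition piece74 : piece := Piece [::
  [:: 1; 4]; [:: 0; 2; 6]; [:: 1; 3; 13]; [:: 2; 16]; [:: 0; 5; 20]; [:: 4; 6; 10];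
  [:: 1; 5; 12]; [:: 9; 19]; [:: 9; 21]; [:: 7; 8; 38]; [:: 5; 11; 18]; [:: 10; 12; 14];
  [:: 6; 11; 13]; [:: 2; 12; 15]; [:: 11; 15; 17]; [:: 13; 14; 16]; [:: 3; 15; 22];
  [:: 14; 18; 25]; [:: 10; 17; 28]; [:: 7; 20; 26]; [:: 4; 19; 34]; [:: 8; 22; 33];
  [:: 16; 21; 23]; [:: 22; 24; 32]; [:: 23; 25; 27]; [:: 17; 24; 29]; [:: 19; 36; 37];
  [:: 24; 30; 31]; [:: 18; 29; 35]; [:: 25; 28; 30]; [:: 27; 29; 40]; [:: 27; 32; 41];
  [:: 23; 31; 33]; [:: 21; 32; 44]; [:: 20; 35; 36]; [:: 28; 34; 50]; [:: 26; 34; 49];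
  [:: 26; 39; 48]; [:: 9; 39; 45]; [:: 37; 38; 43]; [:: 30; 41; 42]; [:: 31; 40; 54];
  [:: 40; 51]; [:: 39; 46; 47]; [:: 33; 45; 56]; [:: 38; 44; 46]; [:: 43; 45; 55];
  [:: 43; 48; 58]; [:: 37; 47; 59]; [:: 36; 50; 53]; [:: 35; 49; 51]; [:: 42; 50; 52];
  [:: 51; 53; 63]; [:: 49; 52; 61]; [:: 41; 57; 65]; [:: 46; 56; 66]; [:: 44; 55; 57];
  [:: 54; 56; 67]; [:: 47; 60; 70]; [:: 48; 60; 61]; [:: 58; 59; 64]; [:: 53; 59; 62];
  [:: 61; 63; 64]; [:: 52; 62]; [:: 60; 62; 69]; [:: 54; 68]; [:: 55; 67; 71]; [:: 57; 66; 68];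
  [:: 65; 67; 72]; [:: 64; 70; 73]; [:: 58; 69; 71]; [:: 66; 70; 72]; [:: 68; 71; 73];
  [:: 69; 72]]
  [:: 7; 8; 3; 0] [:: 73; 63; 42; 65].

Definition piece152 : piece := Piece [::
  [:: 1; 2; 4]; [:: 0; 3; 6]; [:: 0; 7; 10]; [:: 1; 5; 8]; [:: 0; 5; 12]; [:: 3; 4; 11];
  [:: 1; 7; 9]; [:: 2; 6; 15]; [:: 3; 9; 14]; [:: 6; 8; 16]; [:: 2; 17; 19]; [:: 5; 13; 20];
  [:: 4; 13; 23]; [:: 11; 12; 21]; [:: 8; 18; 27]; [:: 7; 16; 17]; [:: 9; 15; 18];
  [:: 10; 15; 25]; [:: 14; 16; 32]; [:: 10; 24; 26]; [:: 11; 22; 28]; [:: 13; 22; 31];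
  [:: 20; 21; 29]; [:: 12; 24; 37]; [:: 19; 23; 35]; [:: 17; 26; 38]; [:: 19; 25; 36];
  [:: 14; 28; 33]; [:: 20; 27; 30]; [:: 22; 30; 43]; [:: 28; 29; 34]; [:: 21; 41; 45];
  [:: 18; 33; 39]; [:: 27; 32; 34]; [:: 30; 33; 44]; [:: 24; 36; 46]; [:: 26; 35; 40];
  [:: 23; 42; 49]; [:: 25; 39; 40]; [:: 32; 38; 48]; [:: 36; 38; 47]; [:: 31; 42; 50];
  [:: 37; 41; 52]; [:: 29; 44; 55]; [:: 34; 43; 57]; [:: 31; 51; 56]; [:: 35; 47; 61];
  [:: 40; 46; 48]; [:: 39; 47; 58]; [:: 37; 53; 60]; [:: 41; 51; 54]; [:: 45; 50; 62];
  [:: 42; 53; 54]; [:: 49; 52; 66]; [:: 50; 52; 65]; [:: 43; 56; 59]; [:: 45; 55; 63];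
  [:: 44; 58; 59]; [:: 48; 57; 67]; [:: 55; 57; 64]; [:: 49; 68; 72]; [:: 46; 69; 73];
  [:: 51; 63; 70]; [:: 56; 62; 64]; [:: 59; 63; 71]; [:: 54; 66; 78]; [:: 53; 65; 76];
  [:: 58; 74; 84]; [:: 60; 69; 85]; [:: 61; 68; 87]; [:: 62; 71; 79]; [:: 64; 70; 75];
  [:: 60; 77; 86]; [:: 61; 88; 90]; [:: 67; 75; 83]; [:: 71; 74; 81]; [:: 66; 77; 80];
  [:: 72; 76; 92]; [:: 65; 79; 80]; [:: 70; 78; 81]; [:: 76; 78; 82]; [:: 75; 79; 82];
  [:: 80; 81; 83]; [:: 74; 82; 95]; [:: 67; 91; 94]; [:: 68; 86; 89]; [:: 72; 85; 93];
  [:: 69; 88; 89]; [:: 73; 87; 98]; [:: 85; 87; 97]; [:: 73; 91; 99]; [:: 84; 90; 100];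
  [:: 77; 93; 96]; [:: 86; 92; 105]; [:: 84; 101; 103]; [:: 83; 96; 104]; [:: 92; 95; 106];
  [:: 89; 98; 110]; [:: 88; 97; 99]; [:: 90; 98; 102]; [:: 91; 101; 102]; [:: 94; 100; 108];
  [:: 99; 100; 113]; [:: 94; 104; 109]; [:: 95; 103; 107]; [:: 93; 106; 111];
  [:: 96; 105; 107]; [:: 104; 106; 112]; [:: 101; 109; 114]; [:: 103; 108; 115];
  [:: 97; 111; 117]; [:: 105; 110; 112]; [:: 107; 111; 118]; [:: 102; 116; 121];
  [:: 108; 120; 122]; [:: 109; 119; 125]; [:: 113; 117; 123]; [:: 110; 116; 118];
  [:: 112; 117; 119]; [:: 115; 118; 126]; [:: 114; 128; 130]; [:: 113; 122; 124];
  [:: 114; 121; 131]; [:: 116; 124; 133]; [:: 121; 123; 132]; [:: 115; 127; 129];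
  [:: 119; 127]; [:: 125; 126; 137]; [:: 120; 129; 135]; [:: 125; 128; 138];
  [:: 120; 136; 140]; [:: 122; 132; 141]; [:: 124; 131; 134]; [:: 123; 134; 148];
  [:: 132; 133; 142]; [:: 128; 136; 139]; [:: 130; 135; 144]; [:: 127; 138; 147];
  [:: 129; 137; 139]; [:: 135; 138; 146]; [:: 130; 143; 145]; [:: 131; 142; 143];
  [:: 134; 141; 149]; [:: 140; 141; 150]; [:: 136; 145; 146]; [:: 140; 144; 151];
  [:: 139; 144; 147]; [:: 137; 146]; [:: 133; 149]; [:: 142; 148; 150]; [:: 143; 149; 151];
  [:: 145; 150]]
  [::] [:: 151; 147; 126; 148].

(** The empty prefix has only the empty configuration, so every source index is 0 and there is
    nothing to carry through. *)
Definition routes76 : routes := Routes [:: [::]]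
  [::
  (0%N, 0x1e49617ed6525202a0fc); (0%N, 0x195a381284d7cb44aa72); (0%N, 0x18fd21ac8236525dda3d)]%positive
  [::
  (0%N, 0%N, 0xfeaef007a4f2c944b1a); (0%N, 0%N, 0xef2aa4ff471aa4925a0); (0%N, 0%N, 0xef2aa4ff472a8cac120);
  (0%N, 1%N, 0xc5abcaa9f47a4a4ec01); (0%N, 0%N, 0xfeaec904a07a4da5e1a); (0%N, 0%N, 0xfeaef007a4f2c96801a);
  (0%N, 1%N, 0xc5abd3f3ac124b49525); (0%N, 0%N, 0xfeaef007a4f2c978a1a); (0%N, 0%N, 0xfeaecc4a940f49b4b1a);
  (0%N, 0%N, 0xfd64c3dc08995a4a9d5); (0%N, 0%N, 0xfeaecab0140f49b4b1a); (0%N, 1%N, 0xc5abd3fc12686b49525);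
  (0%N, 0%N, 0xfeaecac0940f49b4b1a); (0%N, 0%N, 0xfeaec902940f49b4b1a); (0%N, 0%N, 0xfeaee03d27964bc1a1a);
  (0%N, 0%N, 0xef2aa4ff47a4a381030); (0%N, 1%N, 0xda56d39d256c40714d9); (0%N, 0%N, 0xfeaef007a4f34b6201a);
  (0%N, 0%N, 0xef2aa4ffd091e8c9040); (0%N, 0%N, 0xef2aa4ff47394656020); (0%N, 0%N, 0xfd64c3f8c4995a4a9d5);
  (0%N, 1%N, 0xc5abcaa9f47a4a401c1); (0%N, 0%N, 0xefa49e307b43d8802a7); (0%N, 0%N, 0xfdada692ae0526f219a);
  (0%N, 1%N, 0xfe0912d5e9fa6561525); (0%N, 1%N, 0xc46e2be5a254ab47024); (0%N, 0%N, 0xefa49ceac1201e3c2a7);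
  (0%N, 0%N, 0xefa49d83f0fa32082a7); (0%N, 0%N, 0xfd64c3de6047d24a9d5); (0%N, 0%N, 0xfeaee03d26d2e8c821a);
  (0%N, 0%N, 0xfdada692ba4b464821a); (0%N, 0%N, 0xfeaecab04a81e938b1a); (0%N, 0%N, 0xfd64c3dc0a32ac4a9d5);
  (0%N, 0%N, 0xfdada692da9380f219a); (0%N, 0%N, 0xef2a936afa5192082a7); (0%N, 0%N, 0xf72da9568e04a1e5a25);
  (0%N, 0%N, 0xef2a925e091a6565aa7); (0%N, 0%N, 0xf72f2d5c0a4acb0a59a); (0%N, 1%N, 0xfe043d096af4fe0a93c);
  (0%N, 0%N, 0xef2a93f48ef302462a7); (0%N, 0%N, 0xfdada693e2e050f219a); (0%N, 0%N, 0xfd64c3ae0519568a9d5);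
  (0%N, 1%N, 0xe9209a505da6a69b697); (0%N, 1%N, 0xcec4924b4d6adb61f02); (0%N, 0%N, 0xfbb80f2f87d0f20826b);
  (0%N, 0%N, 0xfeae3d26d2e9464821a); (0%N, 0%N, 0xefa49d849ffa4359040); (0%N, 0%N, 0xfeac9d94e6ba4ac821a);
  (0%N, 0%N, 0xfeadb526d2e9464821a); (0%N, 0%N, 0xef365ae050d0f90a93e); (0%N, 0%N, 0xf72f2cf6974a164821a);
  (0%N, 0%N, 0xfead2726d2e9464821a); (0%N, 0%N, 0xef2a936974a32410ca7); (0%N, 0%N, 0xfdada693e1dc0a1e430);
  (0%N, 0%N, 0xfa9abca6d2e9464821a); (0%N, 0%N, 0xef29f90cb5c0a1a493e); (0%N, 0%N, 0xfbceab81495960b399a);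
  (0%N, 0%N, 0xfdbad34ed2e9464821a); (0%N, 0%N, 0xfeade936974a164821a); (0%N, 0%N, 0xfeae3b3b06ba4ac821a);
  (0%N, 0%N, 0xfa55e59ed2e9464821a); (0%N, 0%N, 0xfbcb4d76974a164821a); (0%N, 0%N, 0xfd9796ae0525658599a);
  (0%N, 0%N, 0xfbcb594ed2e9464821a); (0%N, 1%N, 0xdabeba4ac8236057d25); (0%N, 0%N, 0xfbb2410b74a0796d15e);
  (0%N, 1%N, 0xfe04689a0d6cb8536ac); (0%N, 0%N, 0xeed1df70290d6594930); (0%N, 0%N, 0xfbdbe1f4016739c8209);
  (0%N, 0%N, 0xef2a8766d2e9464821a); (0%N, 0%N, 0xfb261ee0521acb29b4d); (0%N, 0%N, 0xfebe5526d2e9464821a);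
  (0%N, 0%N, 0xf930f70290d6594da3d); (0%N, 0%N, 0xfe5ad34ed2e9464821a); (0%N, 0%N, 0xf6d6ab81495960b399a);
  (0%N, 1%N, 0xe9209a503cb6897d26f)]%positive
  [::].

Definition routes74 : routes := Routes cover_configs
  [::
  (0%N, 0x66b2dab04147514d35a); (1%N, 0x751f8504aa24d694d53); (2%N, 0x672b4ad60d49602b5e4)]%positive
  [::
  (1%N, 0%N, 0x3db2d90b449572510f3); (0%N, 0%N, 0x3c92aea5125c624e0f3); (1%N, 0%N, 0x3c92ad653f0228498f3);
  (0%N, 0%N, 0x3acab63d200f369498e); (0%N, 0%N, 0x3cab61a6b282f846261); (0%N, 0%N, 0x3acab63e03cd269498e);
  (0%N, 0%N, 0x3db2b34d156c34e0841); (1%N, 0%N, 0x3b68b5825f2125a63b4); (0%N, 0%N, 0x3b2da553496025a63b4);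
  (2%N, 0%N, 0x3b36a938a4b0106da9a); (0%N, 0%N, 0x3cab61a6b2815e46261); (0%N, 0%N, 0x3daa0361e9a2ad869c1);
  (0%N, 0%N, 0x3acab63c8079c69498e); (0%N, 0%N, 0x3daa0b0ca9a2ad869c1); (0%N, 0%N, 0x3c92ad650aea2c498f3);
  (0%N, 0%N, 0x3db2da68ab61a701841); (1%N, 0%N, 0x3743a5a094d1ab25870); (0%N, 0%N, 0x3db31d4d156c34e0841);
  (0%N, 0%N, 0x3acab63c300f391498e); (0%N, 0%N, 0x3743a5d4d1c12b25870); (1%N, 0%N, 0x3b2d89507e2625a63b4);
  (1%N, 0%N, 0x3b935607e415186da9a); (0%N, 0%N, 0x3b62f48b582725a63b4); (0%N, 0%N, 0x3db2b88069a2ad869c1);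
  (0%N, 0%N, 0x3acab7e0f52007a498e); (0%N, 0%N, 0x3dd5c4034d156c34e01); (0%N, 0%N, 0x3caafda0e85192b80f3);
  (0%N, 0%N, 0x3dd81417a9a2ad869c1); (0%N, 0%N, 0x3df47488c5a24ab80f3); (0%N, 0%N, 0x3c92ae6d0a14624e0f3);
  (0%N, 0%N, 0x3b60645e570725a63b4); (0%N, 0%N, 0x3c92ae3da1428c498f3); (0%N, 0%N, 0x3acab63d4d1c00f098e);
  (0%N, 1%N, 0x35ca8b611a0bd4d2b77); (0%N, 0%N, 0x3acab630f302a69498e); (0%N, 0%N, 0x3c92ad581638bd298f3);
  (1%N, 0%N, 0x37856ae1d2da9114b81); (0%N, 0%N, 0x37856b3560505ea6961); (0%N, 0%N, 0x3c92daa68e095b4c7e3);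
  (0%N, 0%N, 0x3b2da8bcc0a9a5263b4); (0%N, 1%N, 0x36a96d26f0426a9a9b5); (0%N, 0%N, 0x3acaf1ea6a3c00f098e);
  (0%N, 0%N, 0x3f156c34e08351d4ba1); (1%N, 0%N, 0x37856dd2da9110b4b81); (0%N, 0%N, 0x3c92b354d1c12b698f3);
  (1%N, 0%N, 0x3743f4b6a4442d2e070); (0%N, 0%N, 0x3c92d27ed0a146380f3); (0%N, 0%N, 0x3c93d534704ada63d83);
  (1%N, 0%N, 0x371d74b6a4442d2e0f3); (0%N, 0%N, 0x3cab61a6ac0a0bd4c61); (0%N, 0%N, 0x3743a6a9a38256c5870);
  (0%N, 1%N, 0x31e57d1f34490a57b44); (0%N, 0%N, 0x3d5acd581417a897c61); (0%N, 1%N, 0x3ab473e7588c728e8d2);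
  (0%N, 1%N, 0x37952f35728e9118ad2); (0%N, 0%N, 0x3c92b354d4da578209b); (0%N, 0%N, 0x3b2da8d981534ac63b4);
  (0%N, 0%N, 0x3c928a6a9a38256d31b); (0%N, 0%N, 0x3c543a6a9a38256d30e); (0%N, 0%N, 0x3d86d94d581417a9a1a);
  (0%N, 0%N, 0x3bc61fd1f560505ea14); (0%N, 0%N, 0x3d5b0d3560505ea6961); (0%N, 0%N, 0x3da1d354d1c12b69870);
  (0%N, 1%N, 0x31f6dab04147514d256); (0%N, 0%N, 0x365b4281ed095ba698e); (0%N, 0%N, 0x37a6ac0a0bd4d2cb05d);
  (0%N, 0%N, 0x37a6ac0a0bd4d2c760f); (0%N, 0%N, 0x3cafc1ea9a9b4af0411); (0%N, 1%N, 0x38b2ccae054d2a4df2d);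
  (0%N, 0%N, 0x3c5ea9a9b4af041e0b1); (0%N, 0%N, 0x37a6ac0a0bd4d2c36c0); (0%N, 0%N, 0x3c92874d534704ada61);
  (0%N, 0%N, 0x3bc63f560505ea1d1b4); (0%N, 1%N, 0x3b732b81534a81b6d2d)]%positive
  [::
  0x75956c783864a69498e; 0x63cab5a52580aa5352d]%positive.

Definition routes152 : routes := Routes [:: [::]]
  [::
  (0%N, 0x1dacab749556c369ac814d21b492e3735a0f278);
  (0%N, 0x1e145bb59f8eb2d86965024a7d0495525da9359);
  (0%N, 0x1db49558771f1fe3acb61a5940929f41255481e)]%positive
  [::
  (0%N, 0%N, 0xecade4acfa94754da492426d2d1f84d496d838);
  (0%N, 0%N, 0xecadcafd4be816a44a2b240fa10d491496d838);
  (0%N, 0%N, 0xecade4acf4b25aa7dda2456ca01284d496d838);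
  (0%N, 0%N, 0xecade4acf4b25aa7dd0448ad961284d496d838);
  (0%N, 0%N, 0xecadcafb69c5a3d523905343510d491496d838);
  (0%N, 0%N, 0xf6ab05b7ea5e5b50930a6a816a89525ea61a9d);
  (0%N, 0%N, 0xecadcafb69b4b47db2092464a10d491496d838);
  (0%N, 0%N, 0xf6ab05b7ea5e5b5092986a816a89525ea61a9d);
  (0%N, 0%N, 0xecadcd8bb4ab2b0243252f0fa12a469496d838);
  (0%N, 0%N, 0xecade4acff0d5694b1c1e9f4534484d496d838);
  (0%N, 0%N, 0xecade4acff0d5694b1c1e9fca04484d496d838);
  (0%N, 0%N, 0xecadcaf2f056e7465940a54fa10d491496d838);
  (0%N, 0%N, 0xecade4acfa94754d65948809ad1f84d496d838);
  (0%N, 0%N, 0xecadcafd4be816a44e15800fa10d491496d838);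
  (0%N, 0%N, 0xecadcaf2f056e747c29b2025b10d491496d838);
  (0%N, 0%N, 0xecade4acf4b25aa7df0048ad961284d496d838);
  (0%N, 0%N, 0xecade4acfa94754d6212426d2d1f84d496d838);
  (0%N, 0%N, 0xecadcd8bb4ab3090c94bed8fa12a469496d838);
  (0%N, 0%N, 0xecade4acfc956d27da58f09c250d44d496d838);
  (0%N, 0%N, 0xecade4acfa9476542484d6db2d1f44d496d838);
  (0%N, 0%N, 0xecade4acf4b25aa715795856003e84d496d838);
  (0%N, 0%N, 0xecade4acfc956d26b12ca0483d3e84d496d838);
  (0%N, 0%N, 0xecadcafb69c5a3d611e05343510d491496d838);
  (0%N, 0%N, 0xe8c3f6d46d24b759029a1a8951374ab8a3caa6);
  (0%N, 0%N, 0xf6ab05b7ea5f4b6d94081c016a89525ea61a9d);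
  (0%N, 0%N, 0xe8c3f6d73bb2b40924aaf44a89e74ab8a3caa6);
  (0%N, 0%N, 0xe8c3f6d46d8607a2a492df0951374ab8a3caa6);
  (0%N, 0%N, 0xecadcd8bb4ab2ca04864a5cfa12a469496d838);
  (0%N, 0%N, 0xecadcafb6a68ade81248cb8fa10d491496d838);
  (0%N, 0%N, 0xecadcd8bb4ab2ca049252f4fa12a469496d838);
  (0%N, 0%N, 0xf6ab05b7ea761aec8aec68104a89525ea61a9d);
  (0%N, 0%N, 0xe8c3f6a896dd65249c0a686a169f4ab8a3caa6);
  (0%N, 0%N, 0xecadcafb69b4b475b281248e910d491496d838);
  (0%N, 0%N, 0xecade4acff0d5694b1c1da042e3e84d496d838);
  (0%N, 0%N, 0xecade4acfa9474b2812429a2ad3e84d496d838);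
  (0%N, 0%N, 0xe8c3f6d65d95a0492556c44a89e74ab8a3caa6);
  (0%N, 0%N, 0xecade4acff0d5694b1c1e9ed940904d496d838);
  (0%N, 0%N, 0xf6ab05b7db4d68ed6b2b20270489525ea61a9d);
  (0%N, 0%N, 0xecadcd8bb4ab4a1219297db1e12a469496d838);
  (0%N, 0%N, 0xe8c3f6d65d95a0492557e84a89e74ab8a3caa6);
  (0%N, 0%N, 0xe8c3f6d7814d0cb0d0955c4a89e74ab8a3caa6);
  (0%N, 0%N, 0xecade4acfa7156c49294b281253e84d496d838);
  (0%N, 0%N, 0xecade4acfc7596c34a5cb281253e84d496d838);
  (0%N, 0%N, 0xecadcafb6a68bb232ca0494fa10d491496d838);
  (0%N, 0%N, 0xecade4acf4b25aa715d87a042e3e84d496d838);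
  (0%N, 0%N, 0xecadcaf395b95b232ca0494fa10d491496d838);
  (0%N, 0%N, 0xf6ab05b7ea5dd2bb092052816a89525ea61a9d);
  (0%N, 0%N, 0xecade4acfa9475284909adb65a3d84d496d838);
  (0%N, 0%N, 0xf6ab05b7ea5f4c3594081c016a89525ea61a9d);
  (0%N, 0%N, 0xecadcd8bb4ad4b612ca0494fa12a469496d838);
  (0%N, 0%N, 0xecadcdacaeb2d94b2ca0494fa12a469496d838);
  (0%N, 0%N, 0xecade4acfa964f268ad87a042e3e84d496d838);
  (0%N, 0%N, 0xecad59e8788e7029280add07a6555ad496d838);
  (0%N, 0%N, 0xecade4acfa7156c3525cb281253e84d496d838);
  (0%N, 0%N, 0xecadcafd4e2ad8632ca0494fa10d491496d838);
  (0%N, 0%N, 0xe8c3f5693b5bb2b409247489515d4ab8a3caa6);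
  (0%N, 0%N, 0xecadcdaf15b6c34b2ca0494fa12a469496d838);
  (0%N, 0%N, 0xecadcafb6a68eb765681248e910d491496d838);
  (0%N, 0%N, 0xf6ab9d3fdb61e810b8fa0c9e0aaa6b6920a8f5);
  (0%N, 0%N, 0xecad59f50f12e05195741e8d4d095ad496d838);
  (0%N, 0%N, 0xe8c3f95b47b57b696c8cb281253e8924a3caa6);
  (0%N, 0%N, 0xf6abe3a5b6c35da4b85a041324b57cd520a8f5);
  (0%N, 0%N, 0xecade4acfc9552936d84b281253e84d496d838);
  (0%N, 0%N, 0xecade4acfa71cb609294b281253e84d496d838);
  (0%N, 0%N, 0xecadcafb6946db232ca0494fa10d491496d838);
  (0%N, 0%N, 0xf6ab05b79d86bada040dc2535789525ea61a9d);
  (0%N, 0%N, 0xecade4acfc7596c05294b281253e84d496d838);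
  (0%N, 0%N, 0xecade4acde5e4aaab5bb2b40921a44d496d838);
  (0%N, 0%N, 0xe8c3f5592db61aed25c2d02098be5b88a3caa6);
  (0%N, 0%N, 0xf6abedb0a037dabdb4b6465940929f435a1a9d);
  (0%N, 0%N, 0xf6ab05b7dbb84a61d86bada04089525ea61a9d);
  (0%N, 0%N, 0xecadcaf3b2da5b232ca0494fa10d491496d838);
  (0%N, 0%N, 0xecadcafc7596c34b281253e824cd491496d838);
  (0%N, 0%N, 0xecada567e3acb61a5940929f41255ad496d838);
  (0%N, 0%N, 0xe8c3f5696c8cb281253e84a8f69d4ab8a3caa6);
  (0%N, 0%N, 0xecadcdbd7156c34b2ca0494fa12a469496d838);
  (0%N, 0%N, 0xe8c3f6a8f596c34b281253e8257a4ab8a3caa6);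
  (0%N, 0%N, 0xf6ab9ded5eda5b232ca0494fa12a6b6920a8f5);
  (0%N, 0%N, 0xecadcd8b8756c34b2ca0494fa12a469496d838);
  (0%N, 0%N, 0xecade4acdda3c9552d84b281253e84d496d838);
  (0%N, 0%N, 0xecad59ef70292812dd07a6d21e215ad496d838);
  (0%N, 0%N, 0xecade4acf63acb609294b281253e84d496d838);
  (0%N, 0%N, 0xecadcadda6da5b232ca0494fa10d491496d838);
  (0%N, 0%N, 0xe8d1e2aada070292e83d079795ab6a0ea3caa6);
  (0%N, 0%N, 0xecad59f8eb2d86965024a7d049554ed496d838);
  (0%N, 0%N, 0xe8eda407ff8eb2d86965024a7d049494a3caa6);
  (0%N, 0%N, 0xecad59f4c770292812dd07a6d21e9ad496d838);
  (0%N, 0%N, 0xecade4acfc7596c34b281253e824a8d496d838);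
  (0%N, 0%N, 0xf6ab9ded5eda5b232ca0494fa0d6ed0920a8f5);
  (0%N, 0%N, 0xf6ab05b7e3acb61a5940929f419c9a5ea61a9d);
  (0%N, 0%N, 0xe8d1b56c8ed359029a436925c6e6b07ca3caa6);
  (0%N, 0%N, 0xecade23b81494096e83d369159f55ad496d838);
  (0%N, 0%N, 0xe8c3fd7d2ac96db0d7692e168104c388a3caa6);
  (0%N, 0%N, 0xe8eda407ff8eb2d86965024a7d139314a3caa6);
  (0%N, 0%N, 0xe8eeb751ed5eda5b232ca0494fa10a0ea3caa6);
  (0%N, 0%N, 0xe8c3fd47b57b696c8cb281253e840ab8a3caa6);
  (0%N, 0%N, 0xf6abed6f901b2db61aed25c2d02098535a1a9d);
  (0%N, 0%N, 0xe8ef203ffc7596c34b281253e8349494a3caa6);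
  (0%N, 0%N, 0xecada567e3acb61a5940929f4124a8d496d838);
  (0%N, 0%N, 0xf6abedb0a037dabdb4b6465940929f426a1a9d);
  (0%N, 0%N, 0xf6ab9eb751ed5eda5b232ca0494fa10920a8f5);
  (0%N, 0%N, 0xf6ab05e5b6c35da4b85a041312abe3cbda1a9d);
  (0%N, 0%N, 0xecab2b3f1d65b0d2ca0494fa092aa6d496d838);
  (0%N, 0%N, 0xe8c3f8ff1d65b0d2ca0494fa092aa4b8a3caa6);
  (0%N, 0%N, 0xe8eeb67e3acb61a5940929f41255480ea3caa6);
  (0%N, 0%N, 0xe8edd2523fc7596c34b281253e82407ca3caa6);
  (0%N, 0%N, 0xecadce7e3acb61a5940929f41255491496d838);
  (0%N, 0%N, 0xe8c3edaf8ac96db0d7692e168104c388a3caa6);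
  (0%N, 0%N, 0xecbacfc7596c34b281253e824aa92ed496d838);
  (0%N, 0%N, 0xf6ab075afcea9f4c770292812dd07a6d221a9d);
  (0%N, 0%N, 0xecadba4a4fc7596c34b281253e824b5496d838);
  (0%N, 0%N, 0xf6ab058fe72697e3acb61a5940929f40a61a9d);
  (0%N, 0%N, 0xe8ee71fe3acb61a5940929f41255480ea3caa6);
  (0%N, 0%N, 0xf6ab05acfc7596c34b281253e824aa92ed9a9d);
  (0%N, 1%N, 0xf58a8aca7b39556c369ac814d21b492e371e49);
  (0%N, 0%N, 0xecfe3fc7596c34b281253e824aa90dc496d838);
  (0%N, 0%N, 0xe8c3edb092f6af6d2d91965024a7d09823caa6);
  (0%N, 0%N, 0xf6abdb556c369ac814d21b492e373580d21a9d);
  (0%N, 0%N, 0xecad35f678ee0525025ba0f4da43d34496d838);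
  (0%N, 1%N, 0xf2b151acf71f1fe3acb61a5940929f41255481);
  (0%N, 0%N, 0xfaca5d67e3acb61a5940929f412554da7828f5);
  (0%N, 1%N, 0xf58a8aced67e3acb61a5940929f4124a9531c9);
  (0%N, 0%N, 0xf6ab05acfc7596c34b281253e824aa92ed48f5);
  (0%N, 1%N, 0xf2b151b6d67e3acb61a5940929f4124a9531c9);
  (0%N, 0%N, 0xf6ab09f0d67e3acb61a5940929f412554db0f5);
  (0%N, 0%N, 0xf5d67e3acb61a5940929f412554da7806aada7);
  (0%N, 0%N, 0xf5e32ad5b23b4d640a690da4971b9ad06aada7);
  (0%N, 1%N, 0xf76a5655ba4aab61b4d640a690da4971b9ad0c);
  (0%N, 0%N, 0xecbacfc7596c34b281253e824aa9b4f012ada7);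
  (0%N, 0%N, 0xfac987db6125ed5eda5b232ca0494fa1301a9d);
  (0%N, 0%N, 0xfd582d67e3acb61a5940929f412554976a8f2c);
  (0%N, 0%N, 0xf6ab09f0d67e3acb61a5940929f412554db49d);
  (0%N, 0%N, 0xe8c3edb092f6af6d2d91965024a7d0980c6aa6);
  (0%N, 1%N, 0xded272e33b8f8ff1d65b0d2ca0494fa092aa40);
  (0%N, 0%N, 0xf6ab05acfc7596c34b281253e824aa92ed531d);
  (0%N, 0%N, 0xfac16b3f1d65b0d2ca0494fa092aa4bb547952);
  (0%N, 0%N, 0xecbcaab61b4d640a690da4971b8f2fb094d586);
  (0%N, 0%N, 0xfa3979556c369ac814d21b492e371e5f6129ac);
  (0%N, 0%N, 0xf60b59f8eb2d86965024a7d0495525daa3caa6);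
  (0%N, 0%N, 0xf64c17db6125ed5eda5b232ca0494fa1301a9d);
  (0%N, 1%N, 0xdb78eda6b2053484d2527ab704b49b4c94ed25);
  (0%N, 1%N, 0xdb2add2555b0da6b2053486d24b8dcd68943b4);
  (0%N, 0%N, 0xecbacfc7596c34b281253e824aa9b695ef8038);
  (0%N, 0%N, 0xf6ab05acfc7596c34b281253e824aa92ed51e7);
  (0%N, 0%N, 0xfac8ad67e3acb61a5940929f412554976a8f2c);
  (0%N, 0%N, 0xfd588b76b3f1d65b0d2ca0494fa092aa4bb527);
  (0%N, 0%N, 0xf6196b3f1d65b0d2ca0494fa092aa4bb547952);
  (0%N, 1%N, 0xf6d2b2add2555b0da6b2053486d24b8dcd6894);
  (0%N, 0%N, 0xe8c3edb092f6af6d2d91965024a7d0980792a6);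
  (0%N, 1%N, 0xf86add2555b0da6b2053486d24b8dcd68943b4);
  (0%N, 0%N, 0xe8c3edb092f6af6d2d91965024a7d0980d4ca6);
  (0%N, 1%N, 0xed655ba4aab61b4d640a690da4971b9ad129b4)]%positive
  [::].

Definition points76 : seq (Z * Z) := [::
  (13064, 18656); (11784, 17480); (10144, 17536); (11640, 19416); (10120, 19096);
  (8600, 17008); (14632, 19280); (11672, 21016); (14008, 21128); (11088, 15856); (9384, 15400);
  (8568, 19368); (7312, 18208); (9336, 20960); (16144, 18224); (16288, 21560); (17632, 19448);
  (12416, 14768); (8864, 13680); (10736, 13912); (6976, 21072); (5624, 18296); (15736, 16264);
  (14240, 15016); (16000, 23992); (8000, 23992); (11368, 12304); (13512, 13112);
  (19192, 17504); (17440, 15584); (15792, 13520); (7360, 12608); (9272, 11376); (4240, 15568);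
  (5248, 13096); (24000, 24000); (0, 24000); (21648, 17664); (23696, 19200); (8056, 9504);
  (5600, 10392); (2272, 13224); (424, 16000); (3112, 9920); (14656, 11096); (20624, 15312);
  (10280, 8152); (12688, 9272); (23536, 14400); (21664, 13256); (19120, 13168); (17152, 11408);
  (424, 8000); (3424, 6528); (14256, 7448); (16352, 8872); (10344, 5496); (12976, 5224);
  (21240, 11016); (19232, 10712); (18680, 8384); (23536, 9600); (21368, 8696); (20288, 6568);
  (5352, 3616); (8424, 3664); (0, 0); (6000, 152); (14704, 3240); (11528, 2888); (12000, 128);
  (23696, 4800); (20632, 4176); (17800, 2936); (18008, 88); (24000, 0)]%Z.

Definition points74 : seq (Z * Z) := [::
  (15480, 13720); (15360, 14640); (14720, 15360); (13800, 15560); (16720, 13120);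
  (17000, 14480); (16200, 14960); (13960, 12040); (11840, 14640); (12160, 12680);
  (17320, 15840); (16440, 16520); (15880, 15880); (15000, 16240); (15800, 17440);
  (14560, 17080); (13320, 16880); (16880, 18080); (17880, 17080); (15680, 11120);
  (17400, 11920); (11160, 16440); (12280, 17680); (13040, 19200); (14640, 19840);
  (16360, 19320); (16200, 9320); (15040, 21440); (19200, 16840); (18200, 19160);
  (17320, 21560); (12680, 21520); (11320, 19560); (9840, 17720); (19160, 12440);
  (20240, 14520); (18600, 10040); (13920, 8280); (10480, 11880); (11720, 9640); (18040, 23840);
  (12000, 23720); (24000, 24000); (9360, 9280); (8080, 16200); (8840, 13760); (7800, 11720);
  (10360, 6520); (13120, 5920); (21080, 9840); (22120, 13040); (23560, 16000); (23560, 8000);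
  (20520, 6560); (6000, 23640); (5840, 13880); (5880, 16920); (5120, 19800); (8760, 4360);
  (15160, 4000); (11920, 3360); (18360, 3800); (18040, 320); (24000, 0); (12000, 400);
  (0, 24000); (4000, 11840); (3800, 15920); (440, 16000); (5960, 400); (5560, 4360);
  (3840, 7880); (440, 8000); (0, 0); (13080, 13480); (13080, 13520); (14200, 14240);
  (14200, 14200)]%Z.

Definition points152 : seq (Z * Z) := [::
  (14154, 18039); (14178, 17970); (14091, 18009); (14226, 17943); (14211, 18087);
  (14259, 18006); (14148, 17925); (14103, 17931); (14214, 17859); (14163, 17862);
  (14025, 18000); (14322, 17991); (14235, 18168); (14337, 18087); (14223, 17775);
  (14079, 17871); (14130, 17811); (14022, 17898); (14166, 17736); (13965, 18048);
  (14355, 17892); (14445, 18033); (14427, 17904); (14151, 18270); (13965, 18162);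
  (13974, 17853); (13926, 17952); (14280, 17739); (14334, 17793); (14436, 17769);
  (14373, 17709); (14538, 18075); (14160, 17652); (14256, 17643); (14349, 17607);
  (13776, 18060); (13848, 17955); (14328, 18393); (13992, 17736); (14067, 17631);
  (13902, 17811); (14565, 18210); (14487, 18348); (14472, 17643); (14424, 17526);
  (14616, 17952); (13587, 17979); (13836, 17745); (14088, 17505); (14478, 18564);
  (14700, 18180); (14712, 18024); (14637, 18387); (14697, 18522); (14775, 18300);
  (14565, 17673); (14616, 17799); (14436, 17400); (14331, 17265); (14562, 17517);
  (14424, 18771); (13332, 18126); (14790, 17889); (14718, 17772); (14706, 17613);
  (14916, 18327); (14916, 18519); (14532, 17010); (14061, 18696); (13686, 18453);
  (14913, 17859); (14862, 17676); (14781, 18885); (12963, 17910); (14970, 17385);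
  (15012, 17619); (15111, 18585); (15159, 18861); (15030, 18183); (15018, 17979);
  (15168, 18273); (15114, 17826); (15258, 17973); (15423, 17760); (14142, 16608);
  (14379, 19086); (14847, 19230); (13545, 18723); (13164, 18456); (13908, 19062);
  (12642, 17517); (13257, 16839); (15489, 18951); (15294, 19416); (15015, 16248);
  (15867, 18099); (15852, 18708); (13698, 19488); (12819, 18714); (11952, 17985);
  (12414, 16653); (13809, 15639); (11028, 17544); (16245, 16611); (16353, 17910);
  (15654, 19743); (16032, 19227); (16524, 19230); (14655, 14160); (17376, 16140);
  (14550, 20280); (15663, 20346); (16743, 20484); (9663, 18117); (12096, 12066);
  (20040, 17973); (9984, 20709); (13737, 20982); (17550, 21276); (21183, 21600); (12468, 8937);
  (8556, 16125); (9354, 13338); (6252, 20859); (6822, 18021); (20646, 14385); (24000, 24000);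
  (23574, 15999); (15918, 9186); (19023, 11022); (9810, 6357); (6381, 13380); (5283, 16209);
  (2733, 21729); (3345, 18270); (15402, 5952); (12483, 4638); (23574, 8001); (20292, 7800);
  (18213, 4749); (6405, 5175); (4146, 11454); (2937, 14760); (3849, 8022); (11865, 1365);
  (5721, 1209); (18087, 1065); (24000, 0); (0, 24000); (426, 15999); (426, 8001); (0, 0)]%Z.

Lemma piece76_sound : sound_piece piece76 routes76 points76. Proof. by vm_compute. Qed.
Lemma piece74_sound : sound_piece piece74 routes74 points74. Proof. by vm_compute. Qed.
Lemma piece152_sound : sound_piece piece152 routes152 points152. Proof. by vm_compute. Qed.

Lemma piece76_closed : closed_from piece76 [:: [::]]. Proof. by vm_compute. Qed.
Lemma piece74_closed : closed_from piece74 full_states. Proof. by vm_compute. Qed.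
Lemma piece152_closed : closed_from piece152 [:: [::]]. Proof. by vm_compute. Qed.

(** In [piece76] the outputs 35 and 36 are joined by the path 35, 24, 25, 36, which a closing edge
    would complete to a 4-cycle; hence that piece is never the last one. *)
Lemma piece74_far : far_ends piece74. Proof. by vm_compute. Qed.
Lemma piece152_far : far_ends piece152. Proof. by vm_compute. Qed.

Lemma prefix76 : prefix (extend void_pole piece76) 76.
Proof.
apply: (prefix_start piece76_sound piece76_closed) => //.
by exists [:: 0; 1; 2; 4; 3]; split=> //; vm_compute.
Qed.

Lemma prefix152 : prefix (extend void_pole piece152) 152.
Proof.
apply: (prefix_start piece152_sound piece152_closed) => //.
by exists [:: 0; 1; 3; 5; 4]; split=> //; vm_compute.
Qed.

Definition chain (j : nat) (P : pole) : pole := iter j (extend^~ piece74) P.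

Lemma chain_prefix P n j : prefix P n -> prefix (chain j P) (n + j * 74).
Proof.
move=> pP; elim: j => [|j IH]; first by rewrite mul0n addn0.
rewrite mulSnr addnA; exact: (prefix_step piece74_sound piece74_closed _ _ IH).
Qed.

Lemma chain_far P n j : prefix P n -> far (chain j.+1 P).
Proof.
move=> pP; have cP := chain_prefix j pP; have /and5P[ok _ gD _ _] := piece74_sound.
apply: (far_extend (prefix_graph cP) ok gD piece74_far).
by rewrite (prefix_size cP).
Qed.

Theorem theorem2p3 :
  forall k a : nat, 2 <= k -> (a = 2 \/ a = 4) ->
  exists (T : finType) (e : rel T),
    simple_graph e /\ #|T| = 74 * k + a /\ planar e /\ cubic e /\
    hypohamiltonian e /\ girth e 5.
Proof.
move=> k a k2 [] ->.
  (* As 76 is 74 + 2, there remain [k - 1] copies; this is at least one because [2 <= k], so the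
     chain ends with [piece74]. *)
  have -> : 74 * k + 2 = 76 + (k - 2).+1 * 74 by lia.
  by apply: (prefix_final (chain_prefix _ prefix76)); [exact: chain_far prefix76 | lia].
have -> : 74 * k + 4 = 152 + (k - 2) * 74 by lia.
apply: (prefix_final (chain_prefix _ prefix152)); last by lia.
(* For [k = 2] the piece with 152 vertices is closed directly and provides the distance condition
   itself. *)
case: (k - 2) => [|j]; last exact: chain_far prefix152.
have /and5P[ok _ gD _ _] := piece152_sound.
exact: (far_extend pole_graph_void ok gD piece152_far).
Qed.
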